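(* In the setting described in the context, consider the original model $$(\mathrm{O})\quad\operatorname*{minimize}_{\mathfrak Cx\in\Delta}\ \mathfrak f\circ A(x)+\mu\Psi_B\circ\mathfrak L(x)$$ and the reformulated model $$(\mathrm{R})\quad\operatorname*{minimize}_{\mathfrak Cx\in\Delta}\ \widetilde{\mathfrak f}\circ A(x)+\mu\Psi_B\circ\mathfrak L(x),$$ where $\widetilde{\mathfrak f}:\mathcal Y\to\mathbb R$ is the quadratic extrapolation of $\mathfrak f$ defined in the context. Then the following hold. (a) $\widetilde{\mathfrak f}$ is twice continuously differentiable over $\mathcal Y$ and $\nabla\widetilde{\mathfrak f}$ is Lipschitz continuous over $\mathcal Y$ with constant $\max\{\sup_{t\in\Pi_1}\mathfrak f_1''(t),\dots,\sup_{t\in\Pi_m}\mathfrak f_m''(t)\}<\infty$. (b) The solution set of (R) coincides with that of (O), and (R) is an instance of the cLiGME-SCF problem (defined in the context) with $f:=\widetilde{\mathfrak f}$. (c) If $A^*\Lambda A-\mu\mathfrak L^*B^*B\mathfrak L\succeq0$, then $\widetilde{\mathfrak f}\circ A$ is $\mu$-strongly convex relative to $q_{\mathfrak L^*B^*B\mathfrak L}$ and $\widetilde{\mathfrak f}\circ A+\mu\Psi_B\circ\mathfrak L\in\Gamma_0(\mathcal X)$. (d) Assume $A^*\Lambda A-\mu\mathfrak L^*B^*B\mathfrak L\succeq0$. Then both (O) and (R) have a minimizer if one of the following holds: (i) $\mathfrak f$ is coercive and $\mathfrak C^{-1}(\Delta)$ is asymptotically multipolyhedral; (ii) $\mathfrak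 f$ is coercive and $\operatorname{null}A\cap\operatorname{null}\mathfrak L=\{0_{\mathcal X}\}$; (iii) $\mathfrak f$ is bounded below and $\operatorname{null}\mathfrak L=\{0_{\mathcal X}\}$; (iv) $\mathfrak C^{-1}(\Delta)$ is bounded. (e) Assume that (i) $A^*\Lambda A-\mu\mathfrak L^*B^*B\mathfrak L\succeq0$; (ii) (R) has a minimizer; (iii) with $J:=\widetilde{\mathfrak f}\circ A+\mu\Psi_B\circ\mathfrak L$, the rules $\partial(J+\iota_\Delta\circ\mathfrak C)=\partial J+\partial(\iota_\Delta\circ\mathfrak C)$, $\partial(\Psi\circ\mathfrak L)=\mathfrak L^*\circ\partial\Psi\circ\mathfrak L$ and $\partial(\iota_\Delta\circ\mathfrak C)=\mathfrak C^*\circ\partial\iota_\Delta\circ\mathfrak C$ hold. Then the sequence $(x_k)_{k\ge0}$ generated by applying the algorithm described in the context to (R) converges to a global minimizer of the original model (O).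
   Context: Notation. $\Gamma_0(\mathcal H)$: proper lower semicontinuous convex functions $\mathcal H\to(-\infty,\infty]$; $\mathcal B(\mathcal H,\mathcal K)$: linear operators; $L^*$: adjoint; $\|\cdot\|_{\rm op}$: operator norm; $\varphi^*$: Legendre–Fenchel conjugate; $\partial$: convex subdifferential; $\operatorname{Prox}_\varphi(x)=\operatorname{argmin}_v[\varphi(v)+\frac12\|v-x\|^2]$; $\iota_\Delta$: indicator function of $\Delta$; $P_\Delta$: metric projection; $[u]_i$: $i$-th component; $M\succeq0$: positive semidefinite; $q_M(x)=\frac12\langle Mx,x\rangle$. $\varphi$ is $\alpha$-strongly convex relative to $q_M$ if $\varphi-\alpha q_M$ is convex. $\varphi\in\Gamma_0(\mathcal H)$ is coercive if $\varphi(x)\to\infty$ as $\|x\|\to\infty$. A closed convex set $C$ is asymptotically multipolyhedral if $C=S+K$ with $S$ compact and $K$ a polyhedral cone (a cone that is a finite intersection of closed half-spaces). cLiGME-SCF problem. For finite-dimensional real Hilbert spaces $\mathcal X,\mathcal Y,\mathcal Z,\widetilde{\mathcal Z},\mathfrak Z$, let $A\in\mathcal B(\mathcal X,\mathcal Y)$; $f\in\Gamma_0(\mathcal Y)$ be differentiable over $\mathcal Y$ with Lipschitz continuous gradient; $\Psi\in\Gamma_0(\mathcal Z)$ be coercive (and prox-friendly, i.e. with computable proximity operators); $\mu>0$; $\mathfrak L\in\mathcal B(\mathcal X,\mathcal Z)$; $\Delta\subset\mathfrak Z$ be closed convex (and simple, i.e. with computable projection); $\mathfrak C\in\mathcal B(\mathcal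 X,\mathfrak Z)$; $B\in\mathcal B(\mathcal Z,\widetilde{\mathcal Z})$; and $\operatorname{dom}(\Psi\circ\mathfrak L)\cap\mathfrak C^{-1}(\Delta)\ne\emptyset$. The problem is to minimize $f\circ A(x)+\mu\Psi_B\circ\mathfrak L(x)$ subject to $\mathfrak Cx\in\Delta$, where $$\Psi_B(\cdot)=\Psi(\cdot)-\min_{v\in\mathcal Z}\Big[\Psi(v)+\tfrac12\|B(\cdot-v)\|_{\widetilde{\mathcal Z}}^2\Big].$$ Setting of the claim. $\mathcal X,\mathcal Z,\widetilde{\mathcal Z},\mathfrak Z,A,\Psi,\mu,\mathfrak L,\Delta,\mathfrak C,B$ are as in the cLiGME-SCF problem with $\mathcal Y=\mathbb R^m$, but $f$ is replaced by $\mathfrak f$ as follows. For $i\in\{1,\dots,m\}$, $$\Pi_i:=\Big\{t\in\mathbb R\ \Big|\ \inf_{\mathfrak Cx\in\Delta}[Ax]_i\le t\le\sup_{\mathfrak Cx\in\Delta}[Ax]_i\Big\}.$$ $\mathfrak f\in\Gamma_0(\mathcal Y)$ satisfies: (1) $\mathfrak f(u)=\sum_{i=1}^m\mathfrak f_i([u]_i)$ with each $\mathfrak f_i\in\Gamma_0(\mathbb R)$ twice continuously differentiable over $\Pi_i$ and $\sup_{t\in\Pi_i}\mathfrak f_i''(t)<\infty$; (2) the diagonal matrix $\Lambda\in\mathbb R^{m\times m}$ with $[\Lambda]_{i,i}:=\inf_{t\in\Pi_i}\mathfrak f_i''(t)\ge0$ is nonzero. Quadratic extrapolation. With $l_i:=\inf\Pi_i\in[-\infty,\infty)$,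 $h_i:=\sup\Pi_i\in(-\infty,\infty]$, set $\widetilde{\mathfrak f}(u):=\sum_{i=1}^m\widetilde{\mathfrak f}_i([u]_i)$, where $$\widetilde{\mathfrak f}_i(t):=\begin{cases}\frac{\mathfrak f_i''(l_i)}{2}(t-l_i)^2+\mathfrak f_i'(l_i)(t-l_i)+\mathfrak f_i(l_i),&t\le l_i,\\ \mathfrak f_i(t),&l_i<t<h_i,\\ \frac{\mathfrak f_i''(h_i)}{2}(t-h_i)^2+\mathfrak f_i'(h_i)(t-h_i)+\mathfrak f_i(h_i),&t\ge h_i.\end{cases}$$ Algorithm (applied to (R)). Let $\mathfrak d:=\widetilde{\mathfrak f}\circ A-\frac\mu2\|B\mathfrak L\cdot\|_{\widetilde{\mathcal Z}}^2$, let $\beta_{\nabla\mathfrak d}>0$ be a Lipschitz constant of $\nabla\mathfrak d$, and $\rho:=1/\max\{\beta_{\nabla\mathfrak d},\mu\|B\|_{\rm op}^2\}$. Choose any $(x_0,v_0,w_0,z_0)\in\mathcal X\times\mathcal Z\times\mathcal Z\times\mathfrak Z$ and $(\sigma,\tau)\in(0,\infty)\times(\frac1{2\rho},\infty)$ with $$\sigma>\mu\|\mathfrak L^*\mathfrak L+\mathfrak C^*\mathfrak C\|_{\rm op}+\frac{2\rho\mu^2\|B^*B\mathfrak L\|_{\rm op}^2+\tau}{2\rho\tau-1}.$$ For $k=0,1,2,\dots$: $$\begin{aligned}x_{k+1}&:=(\mathrm{Id}-\tfrac1\sigma\nabla\mathfrak d)(x_k)-\tfrac\mu\sigma\mathfrak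 L^*B^*Bv_k-\tfrac\mu\sigma\mathfrak L^*w_k-\tfrac\mu\sigma\mathfrak C^*z_k,\\ v_{k+1}&:=\operatorname{Prox}_{\frac\mu\tau\Psi}\left[\tfrac{2\mu}\tau B^*B\mathfrak Lx_{k+1}-\tfrac\mu\tau B^*B\mathfrak Lx_k+(\mathrm{Id}-\tfrac\mu\tau B^*B)(v_k)\right],\\ w_{k+1}&:=\operatorname{Prox}_{\Psi^*}(2\mathfrak Lx_{k+1}-\mathfrak Lx_k+w_k),\\ z_{k+1}&:=(\mathrm{Id}-P_\Delta)(2\mathfrak Cx_{k+1}-\mathfrak Cx_k+z_k).\end{aligned}$$ *)

(* Defs.v *)
From HB Require Import structures.
From mathcomp Require Import all_boot all_order all_algebra.
From mathcomp Require Import all_classical all_reals all_analysis.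
From mathcomp Require Import ring.

Set Implicit Arguments.
Unset Strict Implicit.
Unset Printing Implicit Defensive.

Import Order.TTheory GRing.Theory Num.Theory.
Import numFieldNormedType.Exports.

Local Open Scope classical_set_scope.
Local Open Scope ring_scope.

(** The inner product induces the norm of the underlying [normedModType], so
    that the library's topology, convergence, compactness and differentials are
    those of the Hilbert space.  Completeness follows from finite dimension. *)

HB.mixin Record NormedModule_isFinHilbert (R : realType) H
    of NormedModule R H := {
  inner : H -> H -> R ;
  innerC : forall x y, inner x y = inner y x ;
  innerDl : forall x y z, inner (x + y) z = inner x z + inner y z ;
  innerZl : forall a x y, inner (a *: x) y = a * inner x y ;
  inner_norm : forall x, inner x x = `|x| ^+ 2 ;
  finite_dim : exists (n : nat) (b : 'I_n -> H), forall x, exists c : 'I_n -> R,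
    x = \sum_(i < n) c i *: b i }.

#[short(type="finHilbertType")]
HB.structure Definition FinHilbert (R : realType) :=
  {H of NormedModule R H & NormedModule_isFinHilbert R H}.

(** The space R^m with its Euclidean norm.  An alias is needed because the
    library equips ['cV[R]_m] itself with the sup norm. *)

Definition euclid (R : realType) (m : nat) : Type := 'cV[R]_m.

Section Euclid.
Variables (R : realType) (m : nat).

HB.instance Definition _ := Choice.copy (euclid R m) 'cV[R]_m.
HB.instance Definition _ := GRing.Lmodule.copy (euclid R m) 'cV[R]_m.

Definition ecoord (u : euclid R m) (i : 'I_m) : R := (u : 'cV[R]_m) i 0.

Let dot (u v : euclid R m) : R := \sum_(i < m) ecoord u i * ecoord v i.
Let nrm (u : euclid R m) : R := Num.sqrt (dot u u).

Let ecoordD u v i : ecoord (u + v) i = ecoord u i + ecoord v i.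
Proof. by rewrite /ecoord mxE. Qed.

Let ecoordZ a u i : ecoord (a *: u) i = a * ecoord u i.
Proof. by rewrite /ecoord mxE. Qed.

Let dotC u v : dot u v = dot v u.
Proof. by apply: eq_bigr => i _; rewrite mulrC. Qed.

Let dotDl u v w : dot (u + v) w = dot u w + dot v w.
Proof. by rewrite -big_split; apply: eq_bigr => i _; rewrite ecoordD mulrDl. Qed.

Let dotZl a u v : dot (a *: u) v = a * dot u v.
Proof. by rewrite mulr_sumr; apply: eq_bigr => i _; rewrite ecoordZ mulrA. Qed.

Let dot_ge0 u : 0 <= dot u u.
Proof. by apply: sumr_ge0 => i _; rewrite -expr2 sqr_ge0. Qed.

Let dot_CS u v : dot u v ^+ 2 <= dot u u * dot v v.
Proof.
have [v0|v0] := eqVneq (dot v v) 0.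
  suff -> : dot u v = 0 by rewrite expr0n mulr_ge0.
  apply: big1 => i _; move/eqP: v0; rewrite psumr_eq0; last first.
    by move=> j _; rewrite -expr2 sqr_ge0.
  by move=> /allP/(_ i (mem_index_enum _)); rewrite -expr2 sqrf_eq0 => /eqP->;
    rewrite mulr0.
have vp : 0 < dot v v by rewrite lt_neqAle eq_sym v0 dot_ge0.
have := dot_ge0 (dot v v *: u + (- dot u v) *: v).
rewrite dotDl !dotZl ![dot _ (_ + _)]dotC !dotDl !dotZl (dotC v u).
set a := dot u v; set b := dot v v; set c := dot u u => h.
have {}h : 0 <= b * (c * b - a ^+ 2).
  by apply: le_trans h _; rewrite le_eqVlt; apply/orP; left; apply/eqP; ring.
by move: h; rewrite pmulr_rge0// subr_ge0.
Qed.

Let nrmD u v : nrm (u + v) <= nrm u + nrm v.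
Proof.
rewrite -(ler_pXn2r (ltn0Sn 1)) ?nnegrE ?addr_ge0 ?sqrtr_ge0//.
have -> : nrm (u + v) ^+ 2 = dot u u + dot v v + 2 * dot u v.
  rewrite sqr_sqrtr// dotDl !(dotC _ (u + v)) !dotDl (dotC v u); ring.
have -> : (nrm u + nrm v) ^+ 2 = dot u u + dot v v + 2 * (nrm u * nrm v).
  by rewrite sqrrD !sqr_sqrtr//; ring.
rewrite lerD2l ler_pM2l// -sqrtrM// (le_trans (ler_norm _))// -sqrtr_sqr.
by rewrite ler_sqrt ?dot_CS// mulr_ge0.
Qed.

Let nrmZ (a : R) u : nrm (a *: u) = `|a| * nrm u.
Proof.
by rewrite /nrm dotZl dotC dotZl mulrA -expr2 sqrtrM ?sqr_ge0// sqrtr_sqr.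
Qed.

Let nrm0_eq0 u : nrm u = 0 -> u = 0.
Proof.
move=> /eqP; rewrite sqrtr_eq0 => u0.
have {}u0 : dot u u == 0 by rewrite eq_le u0 dot_ge0.
apply/matrixP => i j; rewrite ord1 mxE; move: u0.
rewrite psumr_eq0; last by move=> k _; rewrite -expr2 sqr_ge0.
by move=> /allP/(_ i (mem_index_enum _)); rewrite -expr2 sqrf_eq0 => /eqP.
Qed.

HB.instance Definition _ :=
  @Lmodule_isNormed.Build R (euclid R m) nrm nrmD nrmZ nrm0_eq0.

Let dot_norm (u : euclid R m) : dot u u = `|u| ^+ 2.
Proof. by rewrite /Num.norm/= sqr_sqrtr. Qed.

Let euclid_fin : exists (n : nat) (b : 'I_n -> euclid R m), forall x,
  exists c : 'I_n -> R, x = \sum_(i < n) c i *: b i.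
Proof.
exists m, (fun i => delta_mx i 0 : 'cV[R]_m) => x; exists (ecoord x).
rewrite [LHS](matrix_sum_delta (x : 'cV[R]_m)).
by apply: eq_bigr => i _; rewrite big_ord1.
Qed.

HB.instance Definition _ := @NormedModule_isFinHilbert.Build R (euclid R m)
  dot dotC dotDl dotZl dot_norm euclid_fin.

End Euclid.

Section ConvexFunctions.
Context {R : realType}.
Local Open Scope ereal_scope.

Definition econvex (V : lmodType R) (f : V -> \bar R) :=
  forall x y (t : R), (0 < t < 1)%R ->
    f (t *: x + (1 - t) *: y)%R <= t%:E * f x + (1 - t)%:E * f y.

Definition edom (V : Type) (f : V -> \bar R) : set V := [set x | f x < +oo].

Record Gamma0 (V : normedModType R) (f : V -> \bar R) : Prop := {
  Gamma0_gtNy : forall x, -oo < f x ;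
  Gamma0_proper : edom f !=set0 ;
  Gamma0_lsc : lower_semicontinuous f ;
  Gamma0_convex : econvex f }.

Definition coercive (V : normedModType R) (f : V -> \bar R) :=
  forall M : R, exists r : R, forall x, (r < `|x|)%R -> M%:E < f x.

Definition bounded_below (V : Type) (f : V -> \bar R) :=
  exists M : R, forall x, M%:E <= f x.

Definition argmin_on (V : Type) (D : set V) (f : V -> \bar R) : set V :=
  [set x | D x /\ forall y, D y -> f x <= f y].

Definition eindic (V : Type) (D : set V) (x : V) : \bar R :=
  if x \in D then 0 else +oo.

Variable H : finHilbertType R.

Definition conjugate (f : H -> \bar R) (u : H) : \bar R :=
  ereal_sup [set (inner x u)%:E - f x | x in setT].

(* For a proper [f] this is empty outside of the domain of [f]. *)
Definition subdiff (f : H -> \bar R) (x : H) : set H :=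
  [set g | forall y, f x + (inner g (y - x)%R)%:E <= f y].

(* The minimizer is unique when [f] is in Gamma0; [0] is a dummy value. *)
Definition prox (f : H -> \bar R) (x : H) : H :=
  xget 0%R (argmin_on setT (fun v => f v + (2^-1 * `|v - x| ^+ 2)%:E)).

Definition metric_proj (D : set H) (x : H) : H :=
  xget 0%R (argmin_on D (fun v => `|v - x|%:E)).

End ConvexFunctions.

Section Sets.
Context {R : realType} {H : finHilbertType R}.

Definition closed_half_space (K : set H) :=
  exists (a : H) (b : R), a != 0 /\ K = [set x | inner a x <= b].

Definition polyhedral_cone (K : set H) :=
  (forall (t : R) x, 0 < t -> K x -> K (t *: x)) /\
  exists (n : nat) (E : 'I_n -> set H), (forall i, closed_half_space (E i)) /\
    K = \bigcap_(i in [set: 'I_n]) E i.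

Definition asymptotically_multipolyhedral (D : set H) :=
  [/\ closed D, convex_set D &
      exists S K : set H, [/\ compact S, polyhedral_cone K &
                              D = [set s + k | s in S & k in K]]].

End Sets.

Section Operators.
Context {R : realType} {H K : finHilbertType R}.

(* Riesz representation makes the vector selected by [xget] exist and be unique;
   the same holds for the gradient below wherever [f] is differentiable. *)
Definition adj (F : {linear H -> K}) (y : K) : H :=
  xget 0 [set x | forall x', inner x x' = inner y (F x')].

Definition opnorm (F : H -> K) : R :=
  sup [set `|F x| | x in [set x | `|x| <= 1]].

Definition psd (M : H -> H) := forall x, 0 <= inner (M x) x.

Definition quad_form (M : H -> H) (x : H) : R := 2^-1 * inner (M x) x.

Definition strongly_convex_rel (a : R) (q f : H -> R) :=
  convex_function [set: H] (fun x => f x - a * q x).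

Definition grad (f : H -> R) (x : H) : H :=
  xget 0 [set g | forall h, 'd (f : H -> R^o) x h = inner g h].

(* In finite dimension, continuity of the second derivative in operator norm is
   the same as its pointwise continuity. *)
Definition twice_cont_diff (f : H -> R) :=
  [/\ forall x, differentiable (f : H -> R^o) x,
      forall x, differentiable (grad f) x &
      forall h, continuous (fun x => 'd (grad f) x h)].

End Operators.

Section Model.
Context {R : realType} {X Y Z Zt W : finHilbertType R}.
Variables (A : {linear X -> Y}) (Psi : Z -> \bar R) (mu : R).
Variables (L : {linear X -> Z}) (Delta : set W) (C : {linear X -> W}).
Variable (B : {linear Z -> Zt}).

(* The infimum is attained and finite for a coercive [Psi] in Gamma0. *)
Definition gme (z : Z) : \bar R :=
  (Psi z - ereal_inf [set Psi v + (2^-1 * `|B (z - v)%R| ^+ 2)%:E | v in setT])%E.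

Definition objective (f : Y -> \bar R) (x : X) : \bar R :=
  (f (A x) + mu%:E * gme (L x))%E.

Definition feasible : set X := C @^-1` Delta.

Record regularization_data : Prop := {
  Psi_Gamma0 : Gamma0 Psi ;
  Psi_coercive : coercive Psi ;
  mu_gt0 : 0 < mu ;
  Delta_closed : closed Delta ;
  Delta_convex : convex_set Delta ;
  domain_neq0 : edom (Psi \o L) `&` feasible !=set0 }.

(* The problem minimizes [objective (EFin \o f)] over [feasible].  A function
   that is differentiable over the whole space is real-valued. *)
Record cLiGME_SCF (f : Y -> R) : Prop := {
  fidelity_Gamma0 : Gamma0 (EFin \o f) ;
  fidelity_diff : forall u, differentiable (f : Y -> R^o) u ;
  fidelity_lipschitz : exists k : R, k.-lipschitz (grad f) ;
  fidelity_data :> regularization_data }.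

Definition LBBL (x : X) : X := adj L (adj B (B (L x))).

Definition smooth_part (f : Y -> R) (x : X) : R :=
  f (A x) - mu / 2 * `|B (L x)| ^+ 2.

Definition step_size_cond (rho sigma tau : R) :=
  [/\ 0 < sigma, (2 * rho)^-1 < tau &
      mu * opnorm (fun x => adj L (L x) + adj C (C x))
      + (2 * rho * mu ^+ 2 * opnorm (fun x => adj B (B (L x))) ^+ 2 + tau)
        / (2 * rho * tau - 1) < sigma].

Definition cLiGME_iteration (d : X -> R) (sigma tau : R)
    (x : nat -> X) (v w : nat -> Z) (z : nat -> W) := forall k : nat,
  [/\ x k.+1 = x k - sigma^-1 *: grad d (x k)
               - (mu / sigma) *: adj L (adj B (B (v k)))
               - (mu / sigma) *: adj L (w k) - (mu / sigma) *: adj C (z k),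
      v k.+1 = prox (fun y => (mu / tau)%:E * Psi y)%E
                 ((2 * mu / tau) *: adj B (B (L (x k.+1)))
                  - (mu / tau) *: adj B (B (L (x k)))
                  + (v k - (mu / tau) *: adj B (B (v k)))),
      w k.+1 = prox (conjugate Psi) (2 *: L (x k.+1) - L (x k) + w k) &
      z k.+1 = (2 *: C (x k.+1) - C (x k) + z k)
               - metric_proj Delta (2 *: C (x k.+1) - C (x k) + z k)].

Definition subdiff_rules (J : X -> \bar R) :=
  [/\ forall x, subdiff (fun y => J y + eindic Delta (C y))%E x
        = [set a + b | a in subdiff J x & b in subdiff (eindic Delta \o C) x],
      forall x, subdiff (Psi \o L) x = adj L @` subdiff Psi (L x) &
      forall x, subdiff (eindic Delta \o C) x
        = adj C @` subdiff (eindic Delta) (C x)].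

End Model.

(* [is_deriv_on D g t l]: the derivative of [g] at [t], relative to [D], is [l];
   at an end point of an interval [D] it is one-sided. *)
Definition is_deriv_on (R : realType) (D : set R) (g : R -> R) (t l : R) :=
  (s - t)^-1 * (g s - g t) @[s --> within D t^'] --> l.

(* [f] is twice continuously differentiable over [P], with first and second
   derivatives [f1] and [f2].  The derivatives are taken in some interval [D]
   that contains [P]: it can be [P] itself, unless [P] is a singleton, or an open
   neighbourhood of [P].  Requiring [D] to have two points makes the derivatives
   unique given [D]. *)
Definition C2_over (R : realType) (P : set R) (f : R -> \bar R)
    (f1 f2 : R -> R) :=
  exists D : set R, [/\ is_interval D, P `<=` D, (exists s t, [/\ D s, D t & s < t]),
    forall t, D t -> [/\ f t \is a fin_num, is_deriv_on D (fine \o f) t (f1 t)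
                       & is_deriv_on D f1 t (f2 t)]
    & {within D, continuous f2}].

Definition quad_extension (R : realType) (P : set R) (f f1 f2 : R -> R)
    (t : R) : R :=
  let l := ereal_inf (EFin @` P) in
  let h := ereal_sup (EFin @` P) in
  let taylor a := f2 a / 2 * (t - a) ^+ 2 + f1 a * (t - a) + f a in
  if (t%:E <= l)%E then taylor (fine l)
  else if (t%:E < h)%E then f t
  else taylor (fine h).

Section Separable.
Context {R : realType} {X : finHilbertType R} {m : nat}.
Variables (A : {linear X -> euclid R m}) (D : set X).

Definition range_itv (i : 'I_m) : set R :=
  [set t | (ereal_inf [set (ecoord (A x) i)%:E | x in D] <= t%:E
            <= ereal_sup [set (ecoord (A x) i)%:E | x in D])%E].

Definition extrapolation (f : 'I_m -> R -> \bar R) (f1 f2 : 'I_m -> R -> R)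
    (u : euclid R m) : R :=
  \sum_(i < m) quad_extension (range_itv i) (fine \o f i) (f1 i) (f2 i) (ecoord u i).

Definition inf_curv (f2 : 'I_m -> R -> R) (i : 'I_m) : \bar R :=
  ereal_inf [set (f2 i t)%:E | t in range_itv i].

Definition sup_curv (f2 : 'I_m -> R -> R) (i : 'I_m) : \bar R :=
  ereal_sup [set (f2 i t)%:E | t in range_itv i].

Definition curv_mx (f2 : 'I_m -> R -> R) : 'M[R]_m :=
  diag_mx (\row_i fine (inf_curv f2 i)).

Definition AMA (M : 'M[R]_m) (x : X) : X :=
  adj A (M *m (A x : 'cV[R]_m) : euclid R m).

End Separable.

(* Main.v *)
Require Import Defs.
From HB Require Import structures.
From mathcomp Require Import all_boot all_order all_algebra.
From mathcomp Require Import all_classical all_reals all_analysis.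
From mathcomp Require Import ring lra.

(** The quadratic extrapolation of [f_i] at [t] is the Taylor polynomial of [f_i] at
    the point [c] of [Pi_i] nearest to [t]; its second derivative [f_i''(c)] is
    continuous in [t] and lies between [Lam i i] and the supremum of [f_i''].  This
    gives (a), and (b) follows because [A] maps feasible points into the product of
    the [Pi_i].

    With [d = ft \o A - mu/2 |B L .|^2], the objective is [d + mu Psi(L .) + mu G(L .)],
    where [G z = max_v (<B z, B v> - Psi v - |B v|^2 / 2)] is convex and differentiable,
    while [d] is convex by the curvature condition; hence (c).

    A lower semicontinuous convex function attains its minimum on a closed convex set
    unless a ray of the set stays in one of its sublevel sets.  Let [h] be the direction
    of such a ray.  If [f] is coercive then [A h = 0].  If [f] is bounded below then
    [B L h = 0], since otherwise the curvature condition makes some [f_i] grow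
    quadratically along the ray, and then [L h = 0] as [Psi] is coercive.  When the
    feasible set [D] is asymptotically multipolyhedral, its sum with
    [N = null A :&: null L] is still closed, and the objective does not vary along [N],
    so that it can be minimized over the points of [D + N] orthogonal to [N].

    For (e), [grad d] is cocoercive by the Baillon-Haddad theorem, and the algorithm is a
    forward-backward iteration, in a metric mixing the primal and dual variables, for the
    Karush-Kuhn-Tucker system of (R).  The iterates are Fejer monotone in that metric and
    hence converge to a solution of the system, whose primal part is a minimizer. *)

Set Implicit Arguments.
Unset Strict Implicit.
Unset Printing Implicit Defensive.

Import Order.TTheory GRing.Theory Num.Theory.
Import numFieldNormedType.Exports.

Local Open Scope classical_set_scope.
Local Open Scope ring_scope.

(** * Finite-dimensional Hilbert spaces *)

Section InnerProduct.
Context {R : realType} {H : finHilbertType R}.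
Implicit Types (x y z : H).

Lemma innerDr x y z : inner x (y + z) = inner x y + inner x z.
Proof. by rewrite innerC innerDl !(innerC x). Qed.

Lemma innerZr (k : R) x y : inner x (k *: y) = k * inner x y.
Proof. by rewrite innerC innerZl (innerC x). Qed.

Lemma inner0l x : inner 0 x = 0.
Proof. by rewrite -(scale0r (0 : H)) innerZl mul0r. Qed.

Lemma inner0r x : inner x 0 = 0.
Proof. by rewrite innerC inner0l. Qed.

Lemma innerNl x y : inner (- x) y = - inner x y.
Proof. by rewrite -scaleN1r innerZl mulN1r. Qed.

Lemma innerNr x y : inner x (- y) = - inner x y.
Proof. by rewrite innerC innerNl innerC. Qed.

Definition innerE := (@innerDl R H, innerDr, @innerZl R H, innerZr, innerNl,
  innerNr, inner0l, inner0r).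

Lemma inner_suml (I : Type) (r : seq I) (F : I -> H) x :
  inner (\sum_(i <- r) F i) x = \sum_(i <- r) inner (F i) x.
Proof.
elim: r => [|i r IH]; first by rewrite !big_nil inner0l.
by rewrite !big_cons innerDl IH.
Qed.

Lemma inner_ge0 x : 0 <= inner x x.
Proof. by rewrite inner_norm sqr_ge0. Qed.

Lemma inner_inj x y : (forall z, inner x z = inner y z) -> x = y.
Proof.
move=> xy; apply/eqP; rewrite -subr_eq0 -normr_eq0 -sqrf_eq0 -inner_norm.
by rewrite innerDl innerNl xy subrr.
Qed.

Lemma inner_sqr_le x y : inner x y ^+ 2 <= inner x x * inner y y.
Proof.
have [->|y0] := eqVneq y 0; first by rewrite !innerE expr0n mulr0.
have yy : 0 < inner y y by rewrite inner_norm exprn_gt0 ?normr_gt0.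
have := inner_ge0 (inner y y *: x - inner x y *: y).
rewrite !innerE (innerC y x).
move=> h; have {h} : 0 <= inner y y * (inner x x * inner y y - inner x y ^+ 2).
  by move: h; lra.
by rewrite pmulr_rge0 // subr_ge0.
Qed.

Lemma inner_le x y : `|inner x y| <= `|x| * `|y|.
Proof.
rewrite -(ler_pXn2r (ltn0Sn 1)) ?nnegrE ?mulr_ge0 //.
by rewrite exprMn -!inner_norm real_normK ?num_real // inner_sqr_le.
Qed.

Lemma normDsqr x y : `|x + y| ^+ 2 = `|x| ^+ 2 + 2 * inner x y + `|y| ^+ 2.
Proof. by rewrite -!inner_norm !innerE (innerC y x); ring. Qed.

Lemma normBsqr x y : `|x - y| ^+ 2 = `|x| ^+ 2 - 2 * inner x y + `|y| ^+ 2.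
Proof. by rewrite normDsqr innerE normrN; ring. Qed.

(** Induction on [s]: the residual [r] of the new vector is orthogonal to [e]; either it is zero and
    [e] still works, or it is normalized and added to [e]. *)
Lemma gram_schmidt (s : seq H) : exists e : seq H, [/\ uniq e,
  {in e &, forall a b, inner a b = (a == b)%:R} &
  {in s, forall x, x = \sum_(a <- e) inner x a *: a}].
Proof.
elim: s => [|x s [e [ue oe se]]]; first by exists [::]; split.
have projE (r : H) b : b \in e ->
    inner (\sum_(a <- e) inner r a *: a) b = inner r b.
  move=> be; rewrite inner_suml (bigD1_seq b) //= big1_seq.
    by rewrite addr0 innerZl (oe b b) // eqxx mulr1.
  by move=> a /andP[ab ae]; rewrite innerZl (oe a b) // (negbTE ab) mulr0.
set r := x - \sum_(a <- e) inner x a *: a.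
have rb b : b \in e -> inner r b = 0.
  by move=> be; rewrite /r innerDl innerNl projE // subrr.
have [r0|r0] := eqVneq r 0.
  exists e; split => // y; rewrite inE => /predU1P[->|]; last exact: se.
  by apply/eqP; rewrite -subr_eq0; apply/eqP.
have nr : `|r| != 0 by rewrite normr_eq0.
set u := `|r|^-1 *: r.
have ub b : b \in e -> inner u b = 0 by move=> be; rewrite innerZl rb ?mulr0.
have uu : inner u u = 1.
  by rewrite innerZl innerZr inner_norm expr2 mulKf // mulVf.
have ue' : u \notin e.
  by apply/negP => /ub; rewrite uu => /eqP; rewrite oner_eq0.
have eu b : b \in e -> b != u by move=> be; apply: contraNneq ue' => <-.
exists (u :: e); split; first by rewrite /= ue'.
  move=> a b; rewrite !inE => /predU1P[->|ae] /predU1P[->|be].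
  - by rewrite uu eqxx.
  - by rewrite ub // eq_sym (negbTE (eu _ be)).
  - by rewrite innerC ub // (negbTE (eu _ ae)).
  - exact: oe.
move=> y; rewrite inE => /predU1P[->|ys]; rewrite big_cons.
  suff -> : inner x u *: u = r by rewrite /r subrK.
  rewrite {1}(_ : x = r + \sum_(a <- e) inner x a *: a); last first.
    by rewrite /r subrK.
  rewrite innerDl inner_suml big1_seq ?addr0; last first.
    by move=> a /andP[_ ae]; rewrite innerZl (innerC a) ub ?mulr0.
  by rewrite innerZr inner_norm expr2 mulKf // /u scalerA mulfV // scale1r.
suff -> : inner y u = 0 by rewrite scale0r add0r; exact: se.
rewrite {1}(se _ ys) inner_suml big1_seq //.
by move=> a /andP[_ ae]; rewrite innerZl (innerC a) ub ?mulr0.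
Qed.

(** The expansion holds on a finite spanning family by [gram_schmidt] and extends by linearity. *)
Lemma orthonormal_basis : exists e : seq H,
  forall x, x = \sum_(a <- e) inner x a *: a.
Proof.
have [n [b bP]] := @finite_dim R H.
have [e [_ _ eP]] := gram_schmidt (codom b).
exists e => x; have [c ->] := bP x.
under [RHS]eq_bigr do rewrite inner_suml scaler_suml.
rewrite exchange_big /=; apply: eq_bigr => i _.
rewrite {1}(eP (b i)) ?codom_f // scaler_sumr; apply: eq_bigr => a _.
by rewrite innerZl scalerA.
Qed.

Lemma linear_le_norm (V : normedModType R) (F : {linear H -> V}) :
  exists2 k : R, 0 < k & forall x, `|F x| <= k * `|x|.
Proof.
have [e eP] := orthonormal_basis.
have p : 0 <= \sum_(a <- e) `|a| * `|F a|.
  by apply: sumr_ge0 => a _; rewrite mulr_ge0.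
(* The summand 1 keeps the constant positive when [F] vanishes. *)
exists (1 + \sum_(a <- e) `|a| * `|F a|); first by rewrite ltr_pwDl.
move=> x; rewrite {1}(eP x) linear_sum /= (le_trans (ler_norm_sum _ _ _)) //.
apply: (@le_trans _ _ ((\sum_(a <- e) `|a| * `|F a|) * `|x|)); last first.
  by rewrite ler_wpM2r // ler_wpDl.
rewrite mulr_suml; apply: ler_sum => a _.
rewrite linearZ /= normrZ mulrAC ler_wpM2r //.
by rewrite mulrC inner_le.
Qed.

Lemma linear_hilbert_continuous (V : normedModType R) (F : {linear H -> V}) :
  continuous F.
Proof.
apply: bounded_linear_continuous.
have [k k0 kP] := linear_le_norm F.
apply/ex_bound; exists k; apply/nbhs_normP; exists 1 => //= x /=.
rewrite sub0r normrN => /ltW x1.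
by apply: (le_trans (kP x)); rewrite -[leRHS]mulr1 ler_pM2l.
Qed.

End InnerProduct.

Section Adjoint.
Context {R : realType} {H K : finHilbertType R}.
Variable F : {linear H -> K}.

(** The Riesz vector is built from an orthonormal basis, so [xget] never returns its default. *)
Lemma adjP y x : inner (adj F y) x = inner y (F x).
Proof.
rewrite /adj; case: xgetP => [_ -> -> //|noadj].
have [e eP] := @orthonormal_basis R H.
exfalso; apply: (noadj (\sum_(a <- e) inner y (F a) *: a)) => x'.
rewrite inner_suml [in RHS](eP x') linear_sum (innerC y) inner_suml.
by apply: eq_bigr => a _; rewrite innerZl linearZ innerZl (innerC y) (innerC x') mulrC.
Qed.

End Adjoint.

(** * Compactness and attainment of minima *)

Section Compactness.
Context {R : realType} {H : finHilbertType R}.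

Lemma cvg_sumr (V : normedModType R) (T I : Type) (F : set_system T)
    {FF : Filter F} (r : seq I) (f : I -> T -> V) (l : I -> V) :
  (forall i, f i x @[x --> F] --> l i) ->
  \sum_(i <- r) f i x @[x --> F] --> \sum_(i <- r) l i.
Proof.
move=> fl; elim: r => [|i r IH].
  rewrite big_nil (_ : (fun _ => _) = cst 0); first exact: cvg_cst.
  by apply/funext => x; rewrite big_nil.
rewrite big_cons (_ : (fun _ => _) = fun x => f i x + \sum_(j <- r) f j x).
  exact: cvgD.
by apply/funext => x; rewrite big_cons.
Qed.

(** In the coordinates given by [orthonormal_basis], [D] is the continuous image of a closed subset
    of a compact box. *)
Lemma bounded_closed_compact_hilbert (D : set H) (M : R) :
  closed D -> (forall x, D x -> `|x| <= M) -> compact D.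
Proof.
move=> cD bD; have [e eP] := @orthonormal_basis R H.
pose n := size e.
pose phi (c : 'rV[R]_n) : H := \sum_(i < n) c 0 i *: tnth (in_tuple e) i.
have phic : continuous phi.
  move=> c; rewrite /phi; apply: (@cvg_sumr _ _ _ (nbhs c)) => i.
  by apply: cvgZr_tmp; exact: coord_continuous.
(* By Cauchy-Schwarz each coordinate [inner x a] is at most [M * |a|] in absolute value, hence at
   most [r]. *)
pose r := M * (\sum_(a <- e) `|a|).
pose Q := [set c : 'rV[R]_n | forall i, `[- r, r]%classic (c ord0 i)].
have cQ : compact Q.
  by apply: (@rV_compact _ _ (fun=> `[- r, r]%classic)) => i; exact: segment_compact.
have -> : D = phi @` (Q `&` phi @^-1` D).
  apply/seteqP; split => [x Dx|_ [c [_ ?] <-] //].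
  have xE : phi (\row_i inner x (tnth (in_tuple e) i)) = x.
    rewrite [RHS](eP x) (big_tnth _ _ e) /phi; apply: eq_bigr => i _.
    by rewrite mxE.
  exists (\row_i inner x (tnth (in_tuple e) i)) => //; split; last first.
    by rewrite /preimage /= xE.
  move=> i; rewrite mxE /= in_itv /= -ler_norml (le_trans (inner_le _ _)) //.
  apply: ler_pM => //; first exact: bD.
  rewrite (big_tnth _ _ e) /= (bigD1 i) //= lerDl.
  by apply: sumr_ge0.
apply: continuous_compact; first exact: continuous_subspaceT.
apply: compact_closedI => //.
by apply: preimage_closed => // c _; exact: phic.
Qed.

(** [phi n] is an index past [n] at which [u] is within [1 / (n + 1)] of a cluster point; the bound
    [n <= phi n] transfers limits of other sequences to the extracted one. *)
Lemma bounded_subsequence (u : nat -> H) (M : R) : (forall n, `|u n| <= M) ->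
  exists2 phi : nat -> nat, (forall n, (n <= phi n)%N) &
    exists l : H, u (phi n) @[n --> \oo] --> l.
Proof.
move=> uM; pose D := [set x : H | `|x| <= M].
have cD : compact D.
  apply: (@bounded_closed_compact_hilbert _ M) => //.
  apply: (@preimage_closed _ _ (Num.norm : H -> R) [set x : R | x <= M]).
    by move=> x _; exact: norm_continuous.
  exact: closed_le.
have uD : (u @ \oo) D by exists 0%N => // n _; exact: uM.
have [l [_ ul]] := cD (u @ \oo) _ uD.
have phiP (n : nat) : exists k : nat, (n <= k)%N /\ `|l - u k| < n.+1%:R^-1.
  have un : (u @ \oo) (u @` [set k | (n <= k)%N]) by exists n => // k nk; exists k.
  have nl : nbhs l (ball l n.+1%:R^-1) by apply: nbhsx_ballx; rewrite invr_gt0.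
  have [_ [[k /= nk <-]]] := ul _ _ un nl.
  by rewrite -ball_normE => h; exists k.
exists (fun n => projT1 (cid (phiP n))) => [n|].
  by case: cid => k [].
exists l; apply/cvgrPdist_lt => eps eps0.
near=> n; case: cid => /= k [nk]; move/lt_trans; apply.
by near: n; exact: near_infty_natSinv_lt (PosNum eps0).
Unshelve. all: by end_near.
Qed.

Lemma subsequence_cvg (V : topologicalType) (u : nat -> V) (phi : nat -> nat)
    (l : V) : (forall n, (n <= phi n)%N) ->
  u @ \oo --> l -> u (phi n) @[n --> \oo] --> l.
Proof.
move=> phin ul; apply: cvg_comp ul.
move=> A [N _ NA]; exists N => // n /= Nn; apply: NA => /=.
exact: leq_trans (phin n).
Qed.

(* A cluster point of the filter generated by the sublevel sets is a minimizer. *)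
Lemma compact_argmin (T : topologicalType) (D : set T) (f : T -> \bar R) :
  compact D -> D !=set0 -> lower_semicontinuous f ->
  exists x, D x /\ forall y, D y -> (f x <= f y)%E.
Proof.
move=> cD [x0 Dx0] lf.
pose F := filter_from D (fun y => D `&` [set z | (f z <= f y)%E]).
have FF : ProperFilter F.
  apply: filter_from_proper; last by move=> y Dy; exists y; split => //=.
  apply: filter_from_filter; first by exists x0.
  move=> y1 y2 D1 D2; have [f12|/ltW f21] := leP (f y1) (f y2).
    by exists y1 => // z [Dz /= zy]; split; split => //=; exact: le_trans f12.
  by exists y2 => // z [Dz /= zy]; split; split => //=; exact: le_trans f21.
have [x [Dx xF]] := cD F FF (ex_intro2 _ _ x0 Dx0 (@subIsetl _ _ _)).
exists x; split => // y Dy; rewrite leNgt; apply/negP => fyx.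
have fy : (f y < +oo)%E by apply: lt_le_trans fyx _; exact: leey.
(* A real number separates the two values, also when [f y] is [-oo] or [f x] is [+oo]. *)
have [a /andP[fya fax]] : exists a : R, ((f y <= a%:E) && (a%:E < f x))%E.
  case fyE : (f y) fyx fy => [r| |] //; first by exists r; rewrite lexx.
  case: (f x) => [r _ _| |] //.
    by exists (r - 1); rewrite leNye lte_fin ltrBlDr ltrDl ltr01.
  by exists 0; rewrite leNye ltry.
have [V xV Va] := lf x a fax.
have [z [[Dz /= zy] Vz]] := xF _ V (ex_intro2 _ _ y Dy (@subset_refl _ _)) xV.
by have := Va _ Vz; rewrite ltNge (le_trans zy).
Qed.

End Compactness.

(** * Convex functions *)

Section RealArith.
Context {R : realType}.

(** Lets [t] tend to 0: if [b < a], a suitable multiple [t] of [a - b] makes [c * t] smaller than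
    [a - b]. *)
Lemma ler_of_small_slope (a b c : R) :
  (forall t, 0 < t < 1 -> a <= b + c * t) -> a <= b.
Proof.
move=> h; rewrite leNgt; apply/negP => ba.
pose k := 1 + `|c| + (a - b).
have k0 : 0 < k by rewrite /k; have := normr_ge0 c; lra.
have ka : a - b < k by rewrite /k; have := normr_ge0 c; lra.
have kc : c < k by rewrite /k; have := ler_norm c; lra.
pose t := (a - b) / k.
have tk : t * k = a - b by rewrite /t divfK // gt_eqF.
have t0 : 0 < t by rewrite divr_gt0 // subr_gt0.
have t1 : t < 1 by rewrite /t ltr_pdivrMr // mul1r.
have := h t; rewrite t0 t1 => /(_ isT) {}h.
have : c * t < k * t by rewrite ltr_pM2r.
by rewrite (mulrC k) tk; move: h; lra.
Qed.

Lemma ereal_real (e : \bar R) : (-oo < e)%E -> (e < +oo)%E -> exists r, e = r%:E.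
Proof. by case: e => [r| |] // _ _; exists r. Qed.

(** Where [f x] or [f y] is [+oo] the right-hand side is [+oo], so only finite values matter. *)
Lemma econvexP (V : lmodType R) (f : V -> \bar R) : (forall x, -oo < f x)%E ->
  econvex f <-> forall x y (t a b : R), 0 < t < 1 -> f x = a%:E -> f y = b%:E ->
    (f (t *: x + (1 - t) *: y)%R <= (t * a + (1 - t) * b)%:E)%E.
Proof.
move=> fN; split => [cf x y t a b t01 fx fy|cf x y t t01].
  by have := cf x y t t01; rewrite fx fy.
have [/(ereal_real (fN x))[a fx]|] := ltP (f x) +oo%E; last first.
  rewrite leye_eq => /eqP ->; have /andP[t0 t1] := t01.
  have t1' : 0 < 1 - t by rewrite subr_gt0.
  rewrite gt0_muley ?lte_fin // addye ?leey //.
  by case: (f y) (fN y) => [b| |] // _; rewrite ?gt0_muley ?lte_fin.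
have [/(ereal_real (fN y))[b fy]|] := ltP (f y) +oo%E; last first.
  rewrite leye_eq => /eqP ->; have /andP[t0 t1] := t01.
  have t1' : 0 < 1 - t by rewrite subr_gt0.
  by rewrite fx -EFinM [X in (_ + X)%E]gt0_muley ?lte_fin // addey // leey.
by rewrite fx fy; exact: cf fx fy.
Qed.

End RealArith.

(** * Real-valued convex functions and sums with them *)

Section Supported.
Context {R : realType} {H : finHilbertType R}.
Implicit Types (f : H -> \bar R) (k : H -> R).

(** Real-valued convexity stated through subgradients: exhibiting one at every point yields both the
    convexity inequality and lower semicontinuity. *)
Definition supported k := forall x, exists g, forall y, k x + inner g (y - x) <= k y.

(** Average the two support inequalities taken at the convex combination itself. *)
Lemma supported_conv k x y (t : R) : supported k -> 0 <= t <= 1 ->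
  k (t *: x + (1 - t) *: y) <= t * k x + (1 - t) * k y.
Proof.
move=> sk /andP[t0 t1]; have [g gP] := sk (t *: x + (1 - t) *: y).
have := gP x; have := gP y; rewrite !innerE => hy hx.
have t1' : 0 <= 1 - t by rewrite subr_ge0.
have := ler_wpM2l t0 hx; have := ler_wpM2l t1' hy.
by lra.
Qed.

Lemma supported_lower k x (e : R) : supported k -> 0 < e ->
  \forall y \near x, k x - e < k y.
Proof.
move=> sk e0; have [g gP] := sk x.
apply/nbhs_normP; exists (e / (1 + `|g|)) => /=; first by rewrite divr_gt0 // ltr_pwDl.
move=> y /=; rewrite distrC ltr_pdivlMr ?ltr_pwDl // => ye.
have := inner_le g (y - x); rewrite ler_norml => /andP[+ _].
have := gP y; have := normr_ge0 g; have := normr_ge0 (y - x); move: ye.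
by nra.
Qed.

Lemma supportedD k k' : supported k -> supported k' ->
  supported (fun x => k x + k' x).
Proof.
move=> sk sk' x; have [g gP] := sk x; have [g' gP'] := sk' x.
by exists (g + g') => y; have := gP y; have := gP' y; rewrite innerDl; lra.
Qed.

Lemma lsc_addr f k : lower_semicontinuous f -> (forall x, (-oo < f x)%E) ->
  supported k -> lower_semicontinuous (fun x => f x + (k x)%:E)%E.
Proof.
move=> lf fN sk x a ax.
(* [b] lies strictly between [a - k x] and [f x]; the gap [b - (a - k x)] is what [k] may lose near
   [x]. *)
have [b [ab bf]] : exists b : R, a - k x < b /\ (b%:E < f x)%E.
  case fxE : (f x) ax (fN x) => [r| |] // ax _.
    exists ((r + (a - k x)) / 2); rewrite lte_fin; move: ax.
    by rewrite -EFinD lte_fin; lra.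
  by exists (a - k x + 1); rewrite ltry; split => //; lra.
have [V xV Vb] := lf x b bf.
have xW : \forall y \near x, k x - (b - (a - k x)) < k y.
  by apply: supported_lower => //; rewrite subr_gt0.
exists (V `&` [set y | k x - (b - (a - k x)) < k y]).
  by apply: filterI.
move=> y [Vy /= ky]; have := Vb _ Vy.
case: (f y) => [r| |] //; rewrite -?EFinD ?lte_fin ?ltry //.
by move: ky; lra.
Qed.

Lemma Gamma0_addr f k : Gamma0 f -> supported k ->
  Gamma0 (fun x => f x + (k x)%:E)%E.
Proof.
move=> [fN [x0 fx0] lf cf] sk; split.
- by move=> x; case: (f x) (fN x) => [r| |] // _; rewrite -?EFinD ?ltNyr.
- by exists x0; rewrite /edom /=; have [r ->] := ereal_real (fN x0) fx0; rewrite -EFinD ltry.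
- exact: lsc_addr.
- have gN x : (-oo < f x + (k x)%:E)%E.
    by case: (f x) (fN x) => [r| |] // _; rewrite -?EFinD ?ltNyr.
  apply/(econvexP gN) => x y t a b t01.
  case fx : (f x) (fN x) => [a'| |] // _; rewrite -EFinD => -[<-].
  case fy : (f y) (fN y) => [b'| |] // _; rewrite -EFinD => -[<-].
  have /andP[t0 t1] := t01.
  have := @supported_conv k x y t sk; rewrite (ltW t0) (ltW t1) => /(_ isT).
  have := (econvexP fN).1 cf _ _ _ _ _ t01 fx fy.
  case: (f (_ + _)) (fN (t *: x + (1 - t) *: y)) => [r| |] // _.
  by rewrite -EFinD !lee_fin; lra.
Qed.

Lemma Gamma0_scale_comp (V : finHilbertType R) (F : {linear V -> H}) f (c : R) :
  Gamma0 f -> 0 < c -> (exists x, f (F x) < +oo)%E ->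
  Gamma0 (fun x => c%:E * f (F x))%E.
Proof.
move=> [fN _ lf cf] c0 [x0 fx0]; split.
- by move=> x; case: (f (F x)) (fN (F x)) => [r| |] //;
    rewrite ?gt0_muley ?lte_fin // -?EFinM ?ltNyr //.
- by exists x0; rewrite /edom /=; have [r ->] := ereal_real (fN _) fx0; rewrite -EFinM ltry.
- move=> x a ax.
  have {}ax : ((a / c)%:E < f (F x))%E.
    case: (f (F x)) ax (fN (F x)) => [r| |] //; rewrite ?ltry //.
    by rewrite -EFinM !lte_fin => h _; rewrite ltr_pdivrMr // mulrC.
  have [V' xV Va] := lf (F x) _ ax.
  exists (F @^-1` V').
    by apply: (@linear_hilbert_continuous _ _ _ F x).
  move=> y Vy; have := Va _ Vy.
  case: (f (F y)) => [r| |] // h; rewrite ?gt0_muley ?lte_fin ?ltry //.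
  by rewrite mulrC -ltr_pdivrMr // -lte_fin.
- have gN x : (-oo < c%:E * f (F x))%E.
    by case: (f (F x)) (fN (F x)) => [r| |] //; rewrite ?gt0_muley ?lte_fin // -?EFinM ?ltNyr //.
  apply/(econvexP gN) => x y t a b t01.
  case fx : (f (F x)) (fN (F x)) => [a'| |] //; rewrite ?gt0_muley ?lte_fin // -EFinM => _ [<-].
  case fy : (f (F y)) (fN (F y)) => [b'| |] //; rewrite ?gt0_muley ?lte_fin // -EFinM => _ [<-].
  have := (econvexP fN).1 cf _ _ _ _ _ t01 fx fy.
  rewrite -!linearZ -linearD /=.
  case: (f (F (_ + _))) (fN (F (t *: x + (1 - t) *: y))) => [r| |] // _.
    by rewrite -EFinM !lee_fin => /(ler_wpM2l (ltW c0)); lra.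
Qed.

End Supported.

(** * Subdifferentials, Fermat's rule and proximal points *)

Section Subdifferential.
Context {R : realType} {H : finHilbertType R}.
Implicit Types (f : H -> \bar R) (s : H -> R).

Lemma subdiff_finite f x g : Gamma0 f -> subdiff f x g -> (f x < +oo)%E.
Proof.
move=> [fN [x0 fx0] _ _] /(_ x0).
have [r ->] := ereal_real (fN x0) fx0.
by case: (f x) (fN x) => [a| |] //; rewrite ltry.
Qed.

Lemma subdiff_monotone f x y g h : Gamma0 f -> subdiff f x g -> subdiff f y h ->
  0 <= inner (g - h) (x - y).
Proof.
move=> Gf gx hy.
have [a fx] := ereal_real (Gamma0_gtNy Gf x) (subdiff_finite Gf gx).
have [b fy] := ereal_real (Gamma0_gtNy Gf y) (subdiff_finite Gf hy).
have := gx y; have := hy x; rewrite fx fy -!EFinD !lee_fin !innerE.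
by lra.
Qed.

Lemma cvg_inner (T : Type) (F : set_system T) {FF : Filter F} (u v : T -> H) a b :
  u @ F --> a -> v @ F --> b -> inner (u x) (v x) @[x --> F] --> inner a b.
Proof.
(* Polarization reduces the claim to continuity of the norm. *)
have E (x y : H) : inner x y = 4^-1 * (`|x + y| ^+ 2 - `|x - y| ^+ 2).
  by rewrite normDsqr normBsqr; field.
move=> ua vb; rewrite E; under eq_fun do rewrite E.
apply: cvgM; first exact: cvg_cst.
rewrite !expr2; under eq_fun do rewrite !expr2.
have nD : `|u x + v x| @[x --> F] --> `|a + b| by apply: cvg_norm; exact: cvgD.
have nB : `|u x - v x| @[x --> F] --> `|a - b| by apply: cvg_norm; exact: cvgB.
exact: (cvgB (cvgM nD nD) (cvgM nB nB)).
Qed.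

(** Closed graph: if the limit inequality fails at [y], then [f (x n)] eventually exceeds some [b]
    with [b + inner g' (y - x') > f y], against the inequality at [x n]. *)
Lemma subdiff_closed f (x g : nat -> H) x' g' : Gamma0 f ->
  (forall n, subdiff f (x n) (g n)) ->
  x @ \oo --> x' -> g @ \oo --> g' -> subdiff f x' g'.
Proof.
move=> Gf xg xx gg y; have fN := Gamma0_gtNy Gf.
case fyE : (f y) (fN y) => [c| |] // _; last by rewrite leey.
rewrite leNgt; apply/negP => cx.
have [b /andP[bc bx]] : exists b : R, (c - inner g' (y - x') < b) && (b%:E < f x')%E.
  case: (f x') cx (fN x') => [r| |] // cx _.
    exists ((r + (c - inner g' (y - x'))) / 2).
    by move: cx; rewrite -EFinD !lte_fin => ?; apply/andP; split; lra.
  by exists (c - inner g' (y - x') + 1); rewrite ltry andbT ltrDl.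
have [V xV Vb] := Gamma0_lsc Gf bx.
have gy : inner (g n) (y - x n) @[n --> \oo] --> inner g' (y - x').
  by apply: cvg_inner => //; apply: cvgB => //; exact: cvg_cst.
have : \forall n \near \oo, False.
  near=> n.
  have Vn : V (x n) by near: n; exact: xx.
  have : inner g' (y - x') - (b - (c - inner g' (y - x'))) < inner (g n) (y - x n).
    near: n; apply: (cvgr_gt (inner g' (y - x'))) => //.
    by rewrite ltrBlDr ltrDl subr_gt0.
  have := xg n y; have := Vb _ Vn; rewrite fyE.
  case: (f (x n)) => [r| |] //; rewrite -EFinD !lte_fin lee_fin.
  by lra.
by move=> /filter_ex[].
Unshelve. all: by end_near.
Qed.

(** The estimate on [s] is a first-order upper bound with slope [g]. Compare [p] with
    [p + t (y - p)], use convexity of [f], divide by [t] and let [t] tend to 0. *)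
Lemma fermat_rule f s p g : Gamma0 f -> (f p < +oo)%E ->
  (forall y, f p + (s p)%:E <= f y + (s y)%:E)%E ->
  (forall d, exists c : R, forall t, 0 < t < 1 ->
     s (p + t *: d) <= s p + t * inner g d + c * t ^+ 2) ->
  subdiff f p (- g).
Proof.
move=> Gf fp pmin sP y; have fN := Gamma0_gtNy Gf.
have [a fpE] := ereal_real (fN p) fp.
case fyE : (f y) (fN y) => [b| |] // _; last by rewrite leey.
rewrite fpE -EFinD lee_fin.
have [c cP] := sP (y - p); apply: (@ler_of_small_slope _ _ _ c) => t t01.
have := cP t t01; have := pmin (p + t *: (y - p)).
have := (econvexP fN).1 (Gamma0_convex Gf) _ _ _ _ _ t01 fyE fpE.
have -> : p + t *: (y - p) = t *: y + (1 - t) *: p.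
  by rewrite scalerBr scalerBl scale1r addrCA.
case: (f (_ + _)) (fN (t *: y + (1 - t) *: p)) => [r| |] // _.
rewrite fpE -!EFinD !lee_fin innerNl => h1 h2 h3.
have /andP[t0 _] := t01; rewrite -(ler_pM2l t0); move: h1 h2 h3; rewrite expr2.
by nra.
Qed.

(** It suffices to minimize over the part of [D] in the ball of radius [M]: elsewhere in [D], [f]
    exceeds [f x0]. *)
Lemma bounded_sublevel_argmin f (D : set H) x0 (M : R) :
  lower_semicontinuous f -> closed D -> D x0 ->
  (forall x, D x -> (f x <= f x0)%E -> `|x| <= M) ->
  exists x, D x /\ forall y, D y -> (f x <= f y)%E.
Proof.
move=> lf cD Dx0 DM.
pose E := D `&` [set x | `|x| <= M].
have cE : closed E.
  apply: closedI => //.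
  apply: (@preimage_closed _ _ (Num.norm : H -> R) [set x : R | x <= M]).
    by move=> x _; exact: norm_continuous.
  exact: closed_le.
have kE : compact E by apply: (@bounded_closed_compact_hilbert _ _ _ M) => // x [].
have Ex0 : E !=set0 by exists x0; split => //; apply: DM.
have [x [[Dx xM] xmin]] := compact_argmin kE Ex0 lf.
exists x; split => // y Dy; have [fy|/ltW fy] := leP (f y) (f x0).
    by apply: xmin; split => //; apply: DM.
  by apply: le_trans fy; apply: xmin; split => //; apply: DM.
Qed.

Lemma coercive_bounded_below f : Gamma0 f -> coercive f ->
  exists m : R, forall x, (m%:E <= f x)%E.
Proof.
move=> Gf cf; have [x0 fx0] := Gamma0_proper Gf; have fN := Gamma0_gtNy Gf.
have [a fx0E] := ereal_real (fN x0) fx0.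
have [r rP] := cf a.
have [|x [_ xmin]] := @bounded_sublevel_argmin f setT x0 r (Gamma0_lsc Gf) closedT I.
  by move=> x _ fx; rewrite leNgt; apply/negP => /rP; rewrite ltNge -fx0E fx.
have [b fxE] : exists b, f x = b%:E.
  by apply: ereal_real => //; apply: le_lt_trans (xmin x0 I) _; rewrite fx0E ltry.
by exists b => y; rewrite -fxE xmin.
Qed.

Lemma supported_half_sqr (c : R) x0 : 0 <= c ->
  supported (fun x : H => c * `|x - x0| ^+ 2).
Proof.
move=> c0 x; exists ((2 * c) *: (x - x0)) => y.
have -> : y - x0 = (x - x0) + (y - x) by rewrite addrAC [x + _]addrC subrK.
rewrite (normDsqr (x - x0)) innerZl; have := sqr_ge0 `|y - x|; move: c0; nra.
Qed.

Lemma prox_argmin_ex f x (m : R) : Gamma0 f -> (forall v, m%:E <= f v)%E ->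
  exists p, argmin_on setT (fun v => f v + (2^-1 * `|v - x| ^+ 2)%:E)%E p.
Proof.
move=> Gf fm; have [v0 fv0] := Gamma0_proper Gf; have fN := Gamma0_gtNy Gf.
have [a fv0E] := ereal_real (fN v0) fv0.
(* A point [v] no worse than [v0] satisfies [|v - x|^2 / 2 <= a + |v0 - x|^2 / 2 - m], and
   [|v - x| <= (1 + |v - x|^2) / 2]. *)
pose M := `|x| + 1 + 2 * (a + 2^-1 * `|v0 - x| ^+ 2 - m).
have lsc : lower_semicontinuous (fun v => f v + (2^-1 * `|v - x| ^+ 2)%:E)%E.
  apply: lsc_addr => //; first exact: Gamma0_lsc.
  by apply: supported_half_sqr.
have [|p [_ pP]] := @bounded_sublevel_argmin _ setT v0 M lsc closedT I; last first.
  by exists p; split => // y _; exact: pP.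
move=> v _; rewrite fv0E; have := fm v; case: (f v) => [b| |] //.
rewrite -!EFinD !lee_fin => mb h.
have : `|v| <= `|v - x| + `|x| by rewrite -[in leLHS](subrK x v) ler_normD.
by rewrite /M; move: h mb; have := sqr_ge0 (`|v - x| - 1); nra.
Qed.

Lemma prox_subdiff f x (m : R) : Gamma0 f -> (forall v, m%:E <= f v)%E ->
  subdiff f (prox f x) (x - prox f x).
Proof.
move=> Gf fm; rewrite /prox; have fN := Gamma0_gtNy Gf.
case: xgetP => [p _ [_ pP]|]; last first.
  by move=> h; have [p pP] := prox_argmin_ex x Gf fm; case: (h p).
rewrite -opprB; apply: (@fermat_rule _ (fun v => 2^-1 * `|v - x| ^+ 2)) => //.
- have [v0 fv0] := Gamma0_proper Gf.
  have [a fv0E] := ereal_real (fN v0) fv0.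
  by have := pP v0 I; rewrite fv0E; case: (f p) => [b| |] //; rewrite ltry.
- by move=> y; apply: pP.
- move=> d; exists (2^-1 * `|d| ^+ 2) => t _.
  have -> : p + t *: d - x = (p - x) + t *: d by rewrite addrAC.
  by rewrite (normDsqr (p - x)) normrZ exprMn real_normK ?num_real // innerZr; lra.
Qed.

End Subdifferential.

(** * Moreau's identity, indicator functions and projections *)

Section ProximalMaps.
Context {R : realType} {H : finHilbertType R}.
Implicit Types (f : H -> \bar R).

(* Moreau's identity; the minimizer is exhibited, so that [conjugate f] need not
   be shown to belong to Gamma0. *)
Lemma prox_conjugate f x (m : R) : Gamma0 f -> (forall v, m%:E <= f v)%E ->
  prox (conjugate f) x = x - prox f x.
Proof.
move=> Gf fm; have := prox_subdiff x Gf fm; set p := prox f x => px.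
have fp := subdiff_finite Gf px.
have [a fpE] := ereal_real (Gamma0_gtNy Gf p) fp.
(* Equality in the Fenchel-Young inequality, since [x - p] is a subgradient of [f] at [p]. *)
have conj_p : conjugate f (x - p) = (inner p (x - p) - a)%:E.
  apply/eqP; rewrite eq_le; apply/andP; split.
    apply: ge_ereal_sup => _ [y _ <-]; have := px y; rewrite fpE.
    case: (f y) => [b| |]; rewrite ?leNye //.
    rewrite -EFinD -EFinB !lee_fin !innerE.
    by have := innerC x p; have := innerC p y; have := innerC x y; lra.
  by apply: ereal_sup_ubound; exists p => //; rewrite fpE -EFinB.
have conj_ge u : ((inner p u - a)%:E <= conjugate f u)%E.
  by apply: ereal_sup_ubound; exists p => //; rewrite fpE -EFinB.
(* The affine minorant of the conjugate, plus the quadratic, is minimal at [x - p] and grows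
   quadratically away from it; this gives uniqueness of the minimizer too. *)
have lower u : (((inner p (x - p) - a) + 2^-1 * `|x - p - x| ^+ 2)%:E +
     (2^-1 * `|u - (x - p)| ^+ 2)%:E <= conjugate f u + (2^-1 * `|u - x| ^+ 2)%:E)%E.
  case: (conjugate f u) (conj_ge u) => [b| |] //; last by rewrite addye ?leey.
  rewrite -!EFinD !lee_fin -!inner_norm !innerE.
  have := innerC x p; have := innerC p u; have := innerC x u; lra.
have minp : argmin_on setT
    (fun v => conjugate f v + (2^-1 * `|v - x| ^+ 2)%:E)%E (x - p).
  split => // y _; apply: le_trans (lower y); rewrite conj_p -EFinD -EFinD lee_fin.
  by rewrite lerDl mulr_ge0 ?invr_ge0 // sqr_ge0.
rewrite {1}/prox; case: xgetP => [q _ [_ qP]|]; last by move=> /(_ _ minp).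
have := le_trans (lower q) (qP (x - p) I).
rewrite conj_p -!EFinD lee_fin gerDl pmulr_rle0 ?invr_gt0 // => q0.
apply/eqP; rewrite -subr_eq0 -normr_eq0 -sqrf_eq0 eq_le q0 /=.
exact: sqr_ge0.
Qed.

Lemma convex_setP (D : set H) : convex_set D <->
  forall x y (t : R), 0 <= t <= 1 -> D x -> D y -> D (t *: x + (1 - t) *: y).
Proof.
split=> [cD x y t /andP[t0 t1] Dx Dy|cD x y t].
  have := cD x y (Itv01 t0 t1); rewrite !inE => /(_ Dx Dy).
  by [].
rewrite !inE => Dx Dy; apply: cD => //.
by apply/andP; split; [exact: ge0 | exact: le1].
Qed.

Lemma Gamma0_eindic (D : set H) : closed D -> convex_set D -> D !=set0 ->
  Gamma0 (eindic D : H -> \bar R).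
Proof.
move=> cD /convex_setP kD [x0 Dx0].
have eN (x : H) : (-oo < eindic D x :> \bar R)%E by rewrite /eindic; case: ifP.
split => //.
- by exists x0; rewrite /edom /= /eindic mem_set.
- move=> x a; rewrite {1}/eindic; case: ifPn => [_|]; rewrite ?notin_setE => ax.
    exists setT => [|y _]; first exact: filterT.
    by rewrite /eindic; case: ifP => // _; rewrite ltry.
  move=> _; exists (~` D); last first.
    by move=> y Dy; rewrite /eindic memNset // ltry.
  by apply: open_nbhs_nbhs; split => //; exact: closed_openC.
- apply/(econvexP eN) => x y t a b /andP[t0 t1]; rewrite /eindic.
  case: ifPn => // xD [<-]; case: ifPn => // yD [<-].
  have Dt : D (t *: x + (1 - t) *: y).
    by apply: kD; [rewrite !ltW | exact: set_mem | exact: set_mem].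
  by rewrite mem_set // !mulr0 addr0.
Qed.

Lemma subdiff_eindic (D : set H) (x g : H) : D x ->
  (forall y, D y -> inner g (y - x) <= 0) -> subdiff (eindic D : H -> \bar R) x g.
Proof.
move=> Dx gx y; rewrite /eindic mem_set // add0e; case: ifPn => [|_]; last by rewrite leey.
by rewrite in_setE lee_fin => /gx.
Qed.

Lemma subdiff_eindicP (D : set H) (x g : H) : D !=set0 ->
  subdiff (eindic D : H -> \bar R) x g ->
  D x /\ forall y, D y -> inner g (y - x) <= 0.
Proof.
move=> [x0 Dx0] gx; have Dx : D x.
  have := gx x0; rewrite /eindic (mem_set Dx0); case: ifPn => // /set_mem //.
by split => // y Dy; have := gx y; rewrite /eindic !mem_set // add0e lee_fin.
Qed.

(** The residual is normal to [D]: comparing the projection [q] with [q + t (y - q)] and letting [t]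
    tend to 0 gives the obtuse-angle inequality. *)
Lemma metric_proj_normal (D : set H) x : closed D -> convex_set D -> D !=set0 ->
  subdiff (eindic D : H -> \bar R) (metric_proj D x) (x - metric_proj D x).
Proof.
move=> cD kD [x0 Dx0].
have nl : lower_semicontinuous (fun v => `|v - x|%:E : \bar R).
  have -> : (fun v => `|v - x|%:E) = (fun v => 0%E + `|v - x|%:E)%E.
    by apply/funext => v; rewrite add0e.
  apply: (@lsc_addr _ _ (fun=> 0%E) (fun v => `|v - x|)) => //.
  - move=> y a a0; exists setT => //; exact: filterT.
  (* A subgradient of the distance to [x]: zero at [x], the unit vector from [x] to [y]
     elsewhere. *)
  - move=> y; have [->|yx] := eqVneq y x.
      by exists 0 => z; rewrite subrr normr0 inner0l addr0.
    have nyx : 0 < `|y - x| by rewrite normr_gt0 subr_eq0.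
    exists (`|y - x|^-1 *: (y - x)) => z; rewrite innerZl.
    rewrite -(ler_pM2l nyx) mulrDr mulrA mulfV ?gt_eqF // mul1r -expr2 -inner_norm.
    have -> : z - x = (y - x) + (z - y) by rewrite [RHS]addrC addrA subrK.
    rewrite -innerDr.
    by apply: le_trans (inner_le _ _); exact: ler_norm.
have [|p [Dp pP]] := @bounded_sublevel_argmin _ _ (fun v => `|v - x|%:E) D x0
    (`|x0 - x| + `|x|) nl cD Dx0.
  move=> v _; rewrite lee_fin => vx; rewrite -[v](subrK x).
  by rewrite (le_trans (ler_normD _ _)) // lerD2r.
rewrite /metric_proj; case: xgetP => [q _ [Dq qP]|]; last first.
  by move=> /(_ p) []; split => // y Dy; apply: pP.
apply: subdiff_eindic => // y Dy.
apply: (@ler_of_small_slope _ _ _ (2^-1 * `|y - q| ^+ 2)) => t /andP[t0 t1].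
have Dt : D (q + t *: (y - q)).
  have -> : q + t *: (y - q) = t *: y + (1 - t) *: q.
    by rewrite scalerBr scalerBl scale1r addrCA.
  by apply: (convex_setP D).1 => //; rewrite !ltW.
have := qP _ Dt; rewrite lee_fin -ler_sqr ?nnegrE //.
have -> : q + t *: (y - q) - x = t *: (y - q) - (x - q).
  by rewrite opprB [RHS]addrA [t *: (y - q) + q]addrC.
rewrite (normBsqr (t *: _)) normrZ exprMn real_normK ?num_real // innerZl (innerC (y - q)).
rewrite (distrC q x) add0r; set a := inner _ _; set b := `|y - q| ^+ 2 => h.
have {}h : 0 <= t * (b * t - 2 * a) by move: h; lra.
by move: h; rewrite pmulr_rge0 //; lra.
Qed.

End ProximalMaps.

(** * The generalized Moreau enhancement *)

Section MoreauEnhancement.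
Context {R : realType} {Z Zt : finHilbertType R}.
Variables (Psi : Z -> \bar R) (B : {linear Z -> Zt}).
Hypotheses (Psi_G : Gamma0 Psi) (Psi_c : coercive Psi).

Lemma supported_comp (V : finHilbertType R) (F : {linear V -> Z}) (k : Z -> R) :
  supported k -> supported (fun x => k (F x)).
Proof.
move=> sk x; have [g gP] := sk (F x); exists (adj F g) => y.
by rewrite adjP linearB.
Qed.

Definition gmenv (z : Z) : \bar R :=
  ereal_inf [set Psi v + (2^-1 * `|B (z - v)%R| ^+ 2)%:E | v in setT]%E.

Lemma gmenv_attained z : exists v r, Psi v = r%:E /\
  gmenv z = (r + 2^-1 * `|B (z - v)| ^+ 2)%:E.
Proof.
have PN := Gamma0_gtNy Psi_G.
have [v0 Pv0] := Gamma0_proper Psi_G; have [a v0E] := ereal_real (PN v0) Pv0.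
pose q v := 2^-1 * `|B (z - v)| ^+ 2.
have sq : supported q.
  move=> x; exists (- adj B (B (z - x))) => y; rewrite /q innerNl adjP.
  have -> : z - y = (z - x) - (y - x) by rewrite opprB addrA subrK.
  by rewrite [B (z - x - _)]linearB normBsqr; have := sqr_ge0 `|B (y - x)|; lra.
(* As [q] is nonnegative, coercivity of [Psi] bounds the sublevel set of [Psi + q] at [v0]. *)
have [r rP] := Psi_c (a + q v0).
have [|v [_ vP]] := @bounded_sublevel_argmin _ _ (fun v => Psi v + (q v)%:E)%E
    setT v0 r (lsc_addr (Gamma0_lsc Psi_G) PN sq) closedT I.
  move=> v _; rewrite v0E => h; rewrite leNgt; apply/negP => /rP.
  move: h; case: (Psi v) => [b| |] //; rewrite -!EFinD lee_fin lte_fin.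
  have : 0 <= q v by rewrite mulr_ge0 ?invr_ge0 ?sqr_ge0.
  by lra.
have [b vE] : exists b, Psi v = b%:E.
  apply: ereal_real => //.
  by have := vP v0 I; rewrite v0E; case: (Psi v) => [b| |] //; rewrite ltry.
exists v, b; split => //; apply/eqP; rewrite eq_le; apply/andP; split.
  by apply: ereal_inf_lbound; exists v => //; rewrite vE.
by apply: le_ereal_inf_tmp => _ [u _ <-]; have := vP u I; rewrite vE.
Qed.

(* [(Psi + 1/2 |B .|^2)^* (B^* B z)], which makes
   [gme Psi B z = Psi z - 1/2 |B z|^2 + gm_conj z]. *)
Definition gm_conj (z : Z) : R := 2^-1 * `|B z| ^+ 2 - fine (gmenv z).

Lemma gm_conj_attained z : exists v r, Psi v = r%:E /\
  gm_conj z = inner (B z) (B v) - r - 2^-1 * `|B v| ^+ 2.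
Proof.
have [v [r [vE zE]]] := gmenv_attained z; exists v, r; split => //.
by rewrite /gm_conj zE /= linearB normBsqr; lra.
Qed.

(** With [gm_conj_attained], this makes [gm_conj] a maximum of functions affine in [z], which is why
    it is convex. *)
Lemma gm_conj_ge z v r : Psi v = r%:E ->
  inner (B z) (B v) - r - 2^-1 * `|B v| ^+ 2 <= gm_conj z.
Proof.
move=> vE; have [u [s [uE zE]]] := gmenv_attained z.
have : (gmenv z <= (r + 2^-1 * `|B (z - v)| ^+ 2)%:E)%E.
  by apply: ereal_inf_lbound; exists v => //; rewrite vE.
by rewrite /gm_conj zE /= lee_fin [B (z - v)]linearB normBsqr; lra.
Qed.

Lemma gmeE z : gme Psi B z = (Psi z + (gm_conj z - 2^-1 * `|B z| ^+ 2)%:E)%E.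
Proof.
have [u [s [uE zE]]] := gmenv_attained z.
rewrite /gme -/(gmenv z) /gm_conj zE /= EFinN /=; congr (_ + (_)%:E)%E.
by lra.
Qed.

(** The affine function of a maximizer [v] supports [gm_conj] at [z], with slope [B^* B v]. *)
Lemma gm_conj_supported : supported gm_conj.
Proof.
move=> z; have [v [r [vE zE]]] := gm_conj_attained z.
exists (adj B (B v)) => y; rewrite adjP zE linearB innerDr innerNr.
by have := gm_conj_ge y vE; rewrite (innerC (B y)) (innerC (B z)); lra.
Qed.

(** The optimality condition makes [v] a maximizer: apply the subgradient inequality at a maximizer
    [u] and use [|B u - B v|^2 >= 0]. *)
Lemma gm_conj_subdiff z v r : Psi v = r%:E -> subdiff Psi v (adj B (B (z - v))) ->
  gm_conj z = inner (B z) (B v) - r - 2^-1 * `|B v| ^+ 2.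
Proof.
move=> vE vz; apply/eqP; rewrite eq_le gm_conj_ge // andbT.
have [u [s [uE ->]]] := gm_conj_attained z.
have := vz u; rewrite vE uE adjP -EFinD lee_fin !linearB.
have := sqr_ge0 `|B u - B v|; rewrite -!inner_norm !innerE.
by rewrite (innerC (B v) (B u)); lra.
Qed.

(** Conversely, a maximizer minimizes [Psi + |B (z - .)|^2 / 2], whose Fermat rule is this
    inclusion. *)
Lemma gm_conj_optimal z v r : Psi v = r%:E ->
  gm_conj z = inner (B z) (B v) - r - 2^-1 * `|B v| ^+ 2 ->
  subdiff Psi v (adj B (B (z - v))).
Proof.
move=> vE zE; rewrite -[adj B _]opprK.
apply: (@fermat_rule _ _ _ (fun u => 2^-1 * `|B (z - u)| ^+ 2)) => //.
- by rewrite vE ltry.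
- move=> y; rewrite vE.
  case yE : (Psi y) (Gamma0_gtNy Psi_G y) => [s| |] // _; last by rewrite addye // leey.
  rewrite -!EFinD lee_fin; have := gm_conj_ge z yE; rewrite zE.
  by rewrite !linearB !normBsqr; lra.
- move=> h; exists (2^-1 * `|B h| ^+ 2) => t _.
  have -> : B (z - (v + t *: h)) = B (z - v) - t *: B h.
    by rewrite opprD addrA linearB linearZ.
  rewrite normBsqr innerZr innerNl adjP normrZ exprMn real_normK ?num_real //.
  by lra.
Qed.

(* With [gm_conj_ge], this makes [gm_conj] differentiable. *)
Lemma gm_conj_upper z h v r : Psi v = r%:E ->
  gm_conj z = inner (B z) (B v) - r - 2^-1 * `|B v| ^+ 2 ->
  gm_conj (z + h) <= gm_conj z + inner (B v) (B h) + 2^-1 * `|B h| ^+ 2.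
Proof.
move=> vE zE; have := gm_conj_optimal vE zE.
have [u [s [uE ->]]] := gm_conj_attained (z + h).
move=> /(_ u); rewrite vE uE adjP -EFinD lee_fin zE.
(* This square absorbs the terms in the maximizer [u] at [z + h], leaving [|B h|^2 / 2]. *)
have := sqr_ge0 `|B u - B v - B h|.
rewrite -!inner_norm !linearB linearD !innerE.
by rewrite (innerC (B v) (B u)) (innerC (B h) (B u)) (innerC (B h) (B v)); lra.
Qed.

(** The candidate [v = z] in the infimum already gives the value [Psi z]. *)
Lemma gme_ge0 z : (0 <= gme Psi B z)%E.
Proof.
rewrite gmeE; case zE : (Psi z) (Gamma0_gtNy Psi_G z) => [r| |] // _; rewrite ?leey //.
rewrite -EFinD lee_fin.
by have := gm_conj_ge z zE; rewrite inner_norm; lra.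
Qed.

(** The maximized expression depends on [z] only through [B z]. *)
Lemma gm_conj_ker z d : B d = 0 -> gm_conj (z + d) = gm_conj z.
Proof.
have h z' d' : B d' = 0 -> gm_conj z' <= gm_conj (z' + d').
  move=> Bd; have [u [s [uE ->]]] := gm_conj_attained z'.
  by have := gm_conj_ge (z' + d') uE; rewrite linearD Bd addr0.
move=> Bd; apply/eqP; rewrite eq_le h // andbT -{2}(addrK d z).
by apply: h; rewrite linearN Bd oppr0.
Qed.

End MoreauEnhancement.

(** * Differential calculus *)

Lemma near_small (R : realType) (V : normedModType R) (c e : R) :
  0 < e -> \forall x \near (0 : V), c * `|x| <= e.
Proof.
move=> e0; near=> x.
have : `|x| < e / (1 + `|c|).
  near: x; apply/nbhs_normP; exists (e / (1 + `|c|)) => /=.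
    by rewrite divr_gt0 // ltr_pwDl.
  by move=> y /=; rewrite sub0r normrN.
rewrite ltr_pdivlMr ?ltr_pwDl //; have := normr_ge0 x; have := ler_norm c.
by nra.
Unshelve. all: by end_near.
Qed.

Section FrechetCriterion.
Context {R : realType} {V W : normedModType R}.
Implicit Types (F : V -> W) (D : V -> W).

(** The remainder condition of the Frechet derivative in epsilon form; linearity and continuity of
    [D] enter in [has_diffP]. *)
Definition has_diff F x D :=
  forall e : R, 0 < e -> \forall h \near (0 : V), `|F (x + h) - F x - D h| <= e * `|h|.

Lemma has_diffP F x D : linear D -> continuous D -> has_diff F x D ->
  differentiable F x /\ ('d F x = D :> (V -> W)).
Proof.
move=> lD cD FD.
pose DL : {linear V -> W} := HB.pack D (GRing.isLinear.Build R V W _ D lD).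
have E : F \o shift x = cst (F x) + DL +o_ (0 : V) id.
  apply/eqaddoP => e e0; near=> h.
  have -> : (F \o shift x - (cst (F x) + DL)) h = F (x + h) - F x - D h.
    by rewrite !fctE /= opprD addrA [h + x]addrC.
  by near: h; exact: FD.
have dE := diff_unique (cD : continuous DL) E.
split=> //; apply/diff_locallyP; rewrite dE; split => //.
Unshelve. all: by end_near.
Qed.

End FrechetCriterion.

Section Gradient.
Context {R : realType} {H : finHilbertType R}.
Implicit Types (F : H -> R) (x g : H).

Lemma has_grad F x g : has_diff (F : H -> R^o) x (inner g : H -> R^o) ->
  differentiable (F : H -> R^o) x /\ grad F x = g.
Proof.
have lg : linear (inner g : H -> R^o).
  by move=> a u v; rewrite innerDr innerZr.
have cg : continuous (inner g : H -> R^o).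
  by move=> u; apply: cvg_inner => //; exact: cvg_cst.
move=> /(has_diffP lg cg) [dF dE]; split => //.
rewrite /grad; case: xgetP => [g' _ g'P|/(_ g)]; last by rewrite dE; case.
by apply: inner_inj => z; rewrite -[LHS]g'P dE.
Qed.

Lemma has_grad_quad F x g (c : R) :
  (forall y, `|F y - F x - inner g (y - x)| <= c * `|y - x| ^+ 2) ->
  differentiable (F : H -> R^o) x /\ grad F x = g.
Proof.
move=> Fc; apply: has_grad => e e0.
have small := @near_small _ H c _ e0; near=> h.
have := Fc (x + h); rewrite [x + h]addrC addrK [h + x]addrC; move/le_trans; apply.
rewrite expr2 mulrA ler_wpM2r //.
by near: h.
Unshelve. all: by end_near.
Qed.

End Gradient.

(** * Derivatives on the real line and Taylor bounds *)

Section MeanValue.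
Context {R : realType}.
Implicit Types (g : R -> R) (t l : R).

Definition has_der g t l := has_diff (g : R^o -> R^o) t (fun h => l * h : R^o).

Lemma has_derP g t l : has_der g t l -> is_derive (t : R^o) (1 : R^o) (g : R^o -> R^o) l.
Proof.
have lD : linear ((fun h => l * h) : R^o -> R^o).
  by move=> a u v; rewrite mulrDr /GRing.scale /=; congr (_ + _); rewrite mulrCA.
have cD : continuous ((fun h => l * h) : R^o -> R^o).
  by move=> u; apply: cvgM; [exact: cvg_cst | exact: cvg_id].
move=> /(has_diffP lD cD) [dg dE].
by apply: DeriveDef; [exact: diff_derivable | rewrite deriveE // dE mulr1].
Qed.

Lemma has_derD g g' t l l' : has_der g t l -> has_der g' t l' ->
  has_der (fun s => g s + g' s) t (l + l').
Proof.
move=> h1 h2 e e0; have e2 : 0 < e / 2 by rewrite divr_gt0.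
near=> h; rewrite [leRHS](_ : _ = e / 2 * `|h| + e / 2 * `|h|); last by field.
have -> : g (t + h) + g' (t + h) - (g t + g' t) - (l + l') * h =
  (g (t + h) - g t - l * h) + (g' (t + h) - g' t - l' * h) by ring.
apply: (le_trans (ler_normD _ _)); apply: lerD; near: h; [exact: h1|exact: h2].
Unshelve. all: by end_near.
Qed.

Lemma has_der_quad (a b t0 t : R) :
  has_der (fun s => a * (s - t0) + b * (s - t0) ^+ 2) t (a + 2 * b * (t - t0)).
Proof.
move=> e e0; have small := @near_small _ R^o `|b| _ e0; near=> h.
have -> : a * (t + h - t0) + b * (t + h - t0) ^+ 2 -
   (a * (t - t0) + b * (t - t0) ^+ 2) - (a + 2 * b * (t - t0)) * h = (b * h) * h.
  by ring.
rewrite normrM ler_wpM2r // normrM.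
by near: h.
Unshelve. all: by end_near.
Qed.

Lemma has_der_mvt (g g1 : R -> R) a b : (forall t, has_der g t (g1 t)) -> a <= b ->
  exists2 c, a <= c <= b & g b - g a = g1 c * (b - a).
Proof.
move=> gd ab; have [//|||c] := @MVT_segment R g g1 a b.
- by move=> x _; exact: has_derP.
- apply: continuous_subspaceT => x.
  by apply: differentiable_continuous; apply/derivable1_diffP; case: (has_derP (gd x)).
- by rewrite in_itv /= => cab gE; exists c.
Qed.

Section TwoDerivatives.
Variables (g g1 g2 : R -> R) (lo up : R).
Hypothesis gd : forall t, has_der g t (g1 t).
Hypothesis g1d : forall t, has_der g1 t (g2 t).
Hypothesis g2b : forall t, lo <= g2 t <= up.

Lemma der_incr a b : a <= b -> lo * (b - a) <= g1 b - g1 a <= up * (b - a).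
Proof.
move=> ab; have [c _ ->] := has_der_mvt g1d ab.
by have /andP[h1 h2] := g2b c; rewrite !ler_wpM2r // subr_ge0.
Qed.

(** [f] is [g] minus its lower parabola at [a]; by [der_incr] its derivative has weakly the sign of
    [s - a], so [f] is minimal at [a]. *)
Lemma taylor_lower a b :
  g a + g1 a * (b - a) + lo / 2 * (b - a) ^+ 2 <= g b.
Proof.
pose f s := g s + (- g1 a * (s - a) + - (lo / 2) * (s - a) ^+ 2).
have fd s : has_der f s (g1 s + (- g1 a + 2 * - (lo / 2) * (s - a))).
  by apply: has_derD; [exact: gd | exact: has_der_quad].
suff : f a <= f b by rewrite /f; lra.
have [ab|/ltW ba] := leP a b.
  have [c /andP[ac _] fE] := has_der_mvt fd ab; rewrite -subr_ge0 fE.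
  have /andP[+ _] := der_incr ac; move: ab; nra.
have [c /andP[_ ca] fE] := has_der_mvt fd ba; rewrite -subr_le0 fE.
have /andP[+ _] := der_incr ca; move: ba; nra.
Qed.

(** As for [taylor_lower], with [f] now maximal at [a]. *)
Lemma taylor_upper a b :
  g b <= g a + g1 a * (b - a) + up / 2 * (b - a) ^+ 2.
Proof.
pose f s := g s + (- g1 a * (s - a) + - (up / 2) * (s - a) ^+ 2).
have fd s : has_der f s (g1 s + (- g1 a + 2 * - (up / 2) * (s - a))).
  by apply: has_derD; [exact: gd | exact: has_der_quad].
suff : f b <= f a by rewrite /f; lra.
have [ab|/ltW ba] := leP a b.
  have [c /andP[ac _] fE] := has_der_mvt fd ab; rewrite -subr_le0 fE.
  have /andP[_ +] := der_incr ac; move: ab; nra.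
have [c /andP[_ ca] fE] := has_der_mvt fd ba; rewrite -subr_ge0 fE.
have /andP[_ +] := der_incr ca; move: ba; nra.
Qed.

End TwoDerivatives.

End MeanValue.

(** * Quadratic extrapolation on the real line *)

Section QuadraticExtension.
Context {R : realType}.
Variables (P D : set R) (g g1 g2 : R -> R).
Let l : \bar R := ereal_inf (EFin @` P).
Let h : \bar R := ereal_sup (EFin @` P).
Hypothesis P_neq0 : P !=set0.
Hypothesis P_itv : forall t, P t <-> (l <= t%:E <= h)%E.
Hypothesis PD : P `<=` D.
Hypothesis gd : forall t, D t -> is_deriv_on D g t (g1 t).
Hypothesis g1d : forall t, D t -> is_deriv_on D g1 t (g2 t).
Hypothesis g2c : {within D, continuous g2}.

(** Projection onto the closed interval [P], with the case distinction of [quad_extension]; for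
    nonempty [P], [fine] only meets finite end points. *)
Definition nearest (t : R) : R :=
  if (t%:E <= l)%E then fine l else if (t%:E < h)%E then t else fine h.

Lemma inf_lty : (l < +oo)%E.
Proof. by have [t /P_itv/andP[lt _]] := P_neq0; exact: le_lt_trans (ltry t). Qed.

Lemma sup_gtNy : (-oo < h)%E.
Proof. by have [t /P_itv/andP[_ th]] := P_neq0; exact: lt_le_trans (ltNyr t) th. Qed.

Lemma inf_le_sup : (l <= h)%E.
Proof. by have [t /P_itv/andP[lt th]] := P_neq0; exact: le_trans th. Qed.

Lemma nearest_in t : P (nearest t).
Proof.
apply/P_itv; rewrite /nearest; have [tl|lt] := leP t%:E l.
  have [r lE] := ereal_real (lt_le_trans (ltNyr t) tl) inf_lty.
  by have := inf_le_sup; rewrite lE /= lexx.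
have [th|ht] := ltP t%:E h; first by rewrite !ltW.
have [r hE] := ereal_real sup_gtNy (le_lt_trans ht (ltry t)).
by have := inf_le_sup; rewrite hE /= lexx => ->.
Qed.

Lemma nearest_id t : P t -> nearest t = t.
Proof.
move=> /P_itv/andP[lt th]; rewrite /nearest; case: ifPn => [tl|_].
  by have -> : l = t%:E by apply/eqP; rewrite eq_le lt tl.
case: ifPn => // /negP/negP; rewrite -leNgt => ht.
by have -> : h = t%:E by apply/eqP; rewrite eq_le ht th.
Qed.

Lemma near_gt (e : \bar R) (t : R) : (e < t%:E)%E -> \forall s \near t, (e < s%:E)%E.
Proof.
case: e => [r| |] //; last by move=> _; near=> s; rewrite ltNyr.
by rewrite lte_fin => rt; near do rewrite lte_fin; exact: lt_nbhsr.
Unshelve. all: by end_near.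
Qed.

Lemma near_lt (e : \bar R) (t : R) : (t%:E < e)%E -> \forall s \near t, (s%:E < e)%E.
Proof.
case: e => [r| |] //; last by move=> _; near=> s; rewrite ltry.
by rewrite lte_fin => rt; near do rewrite lte_fin; exact: lt_nbhsl.
Unshelve. all: by end_near.
Qed.

(** Where [s] leaves [P] close to a point [t] of [P], [t] is an end point and [s] projects to it. *)
Lemma nearest_near_in t : P t -> \forall s \near t, P s \/ nearest s = t.
Proof.
move=> /P_itv/andP[lt th].
have n1 : \forall s \near t, (l < t%:E)%E -> (l < s%:E)%E.
  have [/near_gt lt'|_] := boolP (l < t%:E)%E; last by near=> s.
  by apply: filterS lt' => s.
have n2 : \forall s \near t, (t%:E < h)%E -> (s%:E < h)%E.
  have [/near_lt lt'|_] := boolP (t%:E < h)%E; last by near=> s.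
  by apply: filterS lt' => s.
near=> s; rewrite /nearest; case: ifPn => [sl|/negP/negP].
  right; suff -> : l = t%:E by [].
  apply/eqP; rewrite eq_le lt /= leNgt; apply/negP => lt'.
  have : (l < s%:E)%E by move: lt'; near: s.
  by rewrite ltNge sl.
rewrite -ltNge => ls; case: ifPn => [sh|/negP/negP].
  by left; apply/P_itv; rewrite !ltW.
rewrite -leNgt => hs; right; suff -> : h = t%:E by [].
apply/eqP; rewrite eq_le th andbT leNgt; apply/negP => th'.
have : (s%:E < h)%E by move: th'; near: s.
by rewrite ltNge hs.
Unshelve. all: by end_near.
Qed.

Lemma nearest_near_out t : ~ P t -> \forall s \near t, nearest s = nearest t.
Proof.
move=> nP; have [tl|lt] := ltP t%:E l.
  have n1 := near_lt tl; near=> s.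
  have sl : (s%:E < l)%E by near: s.
  by rewrite /nearest (ltW tl) (ltW sl).
have ht : (h < t%:E)%E.
  by rewrite ltNge; apply/negP => th; apply: nP; apply/P_itv; rewrite lt.
have n1 := near_gt ht; near=> s.
have hs : (h < s%:E)%E by near: s.
have hl r : (h < r%:E)%E -> (r%:E <= l)%E = false.
  by move=> hr; apply/negbTE; rewrite -ltNge; exact: le_lt_trans inf_le_sup hr.
by rewrite /nearest !hl // !ltNge !ltW.
Unshelve. all: by end_near.
Qed.

Lemma nearest_dist t : \forall s \near t, `|nearest s - nearest t| <= `|s - t|.
Proof.
have [Pt|nPt] := pselect (P t).
  have n1 := nearest_near_in Pt; near=> s.
  rewrite (nearest_id Pt).
  have [/nearest_id -> //|->] : P s \/ nearest s = t by near: s.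
  by rewrite subrr normr0.
have n1 := nearest_near_out nPt; near=> s.
have -> : nearest s = nearest t by near: s.
by rewrite subrr normr0.
Unshelve. all: by end_near.
Qed.

(* [quad_extension] is the Taylor polynomial of [g] at the nearest point of [P]. *)
Definition ext_val t := g (nearest t) + g1 (nearest t) * (t - nearest t)
  + g2 (nearest t) / 2 * (t - nearest t) ^+ 2.
Definition ext_der t := g1 (nearest t) + g2 (nearest t) * (t - nearest t).
Definition ext_der2 t := g2 (nearest t).

Lemma quad_extensionE t : quad_extension P g g1 g2 t = ext_val t.
Proof.
rewrite /quad_extension /ext_val /nearest -/l -/h; case: ifPn => _; first by ring.
by case: ifPn => _; [rewrite subrr; ring | ring].
Qed.

(** Clears the denominator of the difference quotient, so that the increment 0 is covered too. *)
Lemma deriv_on_near (k : R -> R) t m (e : R) : is_deriv_on D k t m -> 0 < e ->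
  \forall x \near (0 : R), D (t + x) -> `|k (t + x) - k t - m * x| <= e * `|x|.
Proof.
move=> /cvgrPdist_le/(_ e) + e0 => /(_ e0) n1.
have : \forall s \near t, s != t -> D s -> `|m - (s - t)^-1 * (k s - k t)| <= e.
  exact: n1.
move=> /nbhs0P n2; near=> x => Dx; have [->|x0] := eqVneq x 0.
  by rewrite addr0 subrr mulr0 subr0 normr0 mulr0.
have xt : t + x != t by rewrite -subr_eq0 addrAC subrr add0r.
have : `|m - (t + x - t)^-1 * (k (t + x) - k t)| <= e by move: xt Dx; near: x.
have -> : t + x - t = x by ring.
have -> : k (t + x) - k t - m * x = - (m - x^-1 * (k (t + x) - k t)) * x by field.
by rewrite normrM normrN => ?; rewrite ler_wpM2r.
Unshelve. all: by end_near.
Qed.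

(** Off [P] the map is locally affine. At a point of [P], increments staying in [P] use the
    derivative of [g1] relative to [D], and on the others the map is affine with the same slope. *)
Lemma ext_der_has_der t : has_der ext_der t (ext_der2 t).
Proof.
move=> e e0; rewrite /ext_der2 /ext_der; have [Pt|nPt] := pselect (P t).
  have /nbhs0P n1 := nearest_near_in Pt.
  have n2 := deriv_on_near (g1d (PD Pt)) e0.
  near=> x; rewrite (nearest_id Pt) subrr mulr0 addr0.
  have [Px|xE] : P (t + x) \/ nearest (t + x) = t by near: x.
    rewrite (nearest_id Px) subrr mulr0 addr0; have := PD Px.
    by near: x.
  rewrite xE (_ : _ - _ - _ = 0); last by ring.
  by rewrite normr0 mulr_ge0 // ltW.
have /nbhs0P n1 := nearest_near_out nPt.
near=> x; have -> : nearest (t + x) = nearest t by near: x.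
rewrite (_ : _ - _ - _ = 0); last by ring.
by rewrite normr0 mulr_ge0 // ltW.
Unshelve. all: by end_near.
Qed.

Lemma ext_val_has_der t : has_der ext_val t (ext_der t).
Proof.
move=> e e0; rewrite /ext_val /ext_der; set b := `|g2 (nearest t) / 2|.
have n3 := @near_small R R^o b _ e0.
(* Where [nearest] does not move, the remainder is exactly quadratic in the increment. *)
have bnd x y : b * `|x| <= e -> y = (g2 (nearest t) / 2 * x) * x -> `|y| <= e * `|x|.
  by move=> bx ->; rewrite normrM ler_wpM2r // normrM.
have [Pt|nPt] := pselect (P t).
  have /nbhs0P n1 := nearest_near_in Pt.
  have n2 := deriv_on_near (gd (PD Pt)) e0.
  near=> x.
  have [Px|xE] : P (t + x) \/ nearest (t + x) = t by near: x.
    rewrite (nearest_id Px) (nearest_id Pt) !subrr !expr0n /= !mulr0 !addr0.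
    by have := PD Px; near: x.
  rewrite xE; apply: bnd; first by near: x.
  by rewrite (nearest_id Pt); ring.
have /nbhs0P n1 := nearest_near_out nPt.
near=> x; have -> : nearest (t + x) = nearest t by near: x.
apply: bnd; first by near: x.
by field.
Unshelve. all: by end_near.
Qed.

(** Composes [g2], continuous relative to [D], with [nearest], which is locally nonexpansive and has
    its values in [P]. *)
Lemma ext_der2_continuous : continuous ext_der2.
Proof.
move=> t; apply/cvgrPdist_le => e e0.
have Dc : D (nearest t) by apply: PD; exact: nearest_in.
have := (subspace_continuousP D _).1 g2c _ Dc.
move=> /cvgrPdist_le/(_ e e0) /= n1.
have /nbhs_normP[d /= d0 dP] :
  \forall s \near nearest t, D s -> `|g2 (nearest t) - g2 s| <= e by exact: n1.
near=> s; apply: (dP (nearest s)); last by apply: PD; exact: nearest_in.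
have st : `|s - t| < d.
  by near: s; apply/nbhs_normP; exists d => //= s; rewrite distrC.
have : `|nearest s - nearest t| <= `|s - t| by near: s; exact: nearest_dist.
by rewrite /= distrC => /le_lt_trans; apply.
Unshelve. all: by end_near.
Qed.

Lemma ext_val_id t : P t -> ext_val t = g t.
Proof. by move=> Pt; rewrite /ext_val nearest_id // subrr; ring. Qed.

End QuadraticExtension.

(** * Existence of minimizers *)

Lemma closed_seq_lim (T : topologicalType) (D : set T) (u : nat -> T) l :
  closed D -> (forall n, D (u n)) -> u @ \oo --> l -> D l.
Proof.
move=> cD uD ul; apply: cD => V /ul[k _ kV]; exists (u k); split => //.
by apply: kV => /=.
Qed.

Section Existence.
Context {R : realType} {H : finHilbertType R}.
Implicit Types (S D : set H) (F : H -> \bar R).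

Lemma closed_seqP D : (forall (u : nat -> H) l, (forall n, D (u n)) ->
  u @ \oo --> l -> D l) -> closed D.
Proof.
move=> h l lD.
have uP (n : nat) : exists x, D x /\ `|l - x| < n.+1%:R^-1.
  have nl : nbhs l (ball l n.+1%:R^-1) by apply: nbhsx_ballx; rewrite invr_gt0.
  by have [x [Dx]] := lD _ nl; rewrite -ball_normE => lx; exists x.
pose u n := projT1 (cid (uP n)).
have uD n : D (u n) by rewrite /u; case: cid => x [].
have ul n : `|l - u n| < n.+1%:R^-1 by rewrite /u; case: cid => x [].
apply: (h u) => //; apply/cvgrPdist_lt => e e0; near=> n.
apply: lt_trans (ul n) _; near: n; exact: near_infty_natSinv_lt (PosNum e0).
Unshelve. all: by end_near.
Qed.

Lemma lsc_sublevel_closed F (a : R) :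
  lower_semicontinuous F -> closed [set x | (F x <= a%:E)%E].
Proof.
move=> lF x xcl /=; rewrite leNgt; apply/negP => /lF[V xV Va].
by have [y [/= ya /Va]] := xcl _ xV; rewrite ltNge ya.
Qed.

(** Directions from [x0] to ever farther points of [S] subconverge to a unit vector [d], and the ray
    along [d] is a limit of segments of [S]. *)
Lemma recession_ray S x0 : closed S -> convex_set S -> S x0 ->
  (forall M : R, exists2 x, S x & M < `|x|) ->
  exists2 d, d != 0 & forall t, 0 <= t -> S (x0 + t *: d).
Proof.
move=> cS /convex_setP kS Sx0 nb.
have xP (n : nat) : exists x, S x /\ n.+1%:R < `|x - x0|.
  have [x Sx xn] := nb (n.+1%:R + `|x0|); exists x; split => //.
  have := ler_normD (x - x0) x0; rewrite subrK.
  by move: xn; lra.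
pose x n := projT1 (cid (xP n)).
have xS n : S (x n) by rewrite /x; case: cid => y [].
have xn n : n.+1%:R < `|x n - x0| by rewrite /x; case: cid => y [].
have x0n n : 0 < `|x n - x0| by apply: le_lt_trans (xn n).
pose u n := `|x n - x0|^-1 *: (x n - x0).
have un n : `|u n| = 1.
  by rewrite normrZ normfV normr_id mulVf // gt_eqF.
have un1 n : `|u n| <= 1 by rewrite un.
have [phi phin [d ud]] := bounded_subsequence un1.
exists d => [|t t0].
  apply/eqP => d0; move/cvgrPdist_lt: ud => /(_ 1 ltr01)/filter_ex[n].
  by rewrite d0 sub0r normrN un ltxx.
apply: (@closed_cvg _ _ \oo _ (fun n => x0 + t *: u (phi n)) S) => //.
  near=> n; have tn : t <= `|x (phi n) - x0|.
    apply: le_trans (ltW (xn _)); apply: (@le_trans _ _ n%:R).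
      by near: n; exact: nbhs_infty_ger.
    by rewrite ler_nat; apply: leqW.
  (* Once [|x (phi n) - x0|] reaches [t], this point lies on the segment from [x0] to
     [x (phi n)]. *)
  have -> : x0 + t *: u (phi n) = (t / `|x (phi n) - x0|) *: x (phi n) +
      (1 - t / `|x (phi n) - x0|) *: x0.
    by rewrite /u scalerA scalerBr scalerBl scale1r addrCA.
  apply: kS => //; rewrite divr_ge0 ?(ltW (x0n _)) //=.
  by rewrite ler_pdivrMr // mul1r.
by apply: cvgD; [exact: cvg_cst | exact: cvgZl_tmp].
Unshelve. all: by end_near.
Qed.

(** The sublevel set of [F] in [D] at level [F x0] is closed and convex: either it is bounded, and a
    minimizer exists, or it contains a ray from [x0], which the hypothesis excludes. *)
Lemma argmin_no_ray F D x0 : Gamma0 F -> closed D -> convex_set D -> D x0 ->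
  (F x0 < +oo)%E ->
  (forall d, (forall t, 0 <= t -> D (x0 + t *: d) /\ (F (x0 + t *: d)%R <= F x0)%E) ->
     d = 0) ->
  exists x, D x /\ forall y, D y -> (F x <= F y)%E.
Proof.
move=> GF cD kD Dx0 fx0 noray; have FN := Gamma0_gtNy GF.
have [a aE] := ereal_real (FN x0) fx0.
pose S := D `&` [set x | (F x <= a%:E)%E].
have cS : closed S by apply: closedI => //; exact: lsc_sublevel_closed (Gamma0_lsc GF).
have kS : convex_set S.
  apply/convex_setP => x y t t01 [Dx /= xa] [Dy /= ya]; split => /=.
    exact: (convex_setP D).1.
  have /andP[t0 t1] := t01.
  have [->|tn0] := eqVneq t 0; first by rewrite scale0r add0r subr0 scale1r.
  have [->|tn1] := eqVneq t 1; first by rewrite scale1r subrr scale0r addr0.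
  have t01' : 0 < t < 1 by rewrite !lt_neqAle eq_sym tn0 tn1 t0 t1.
  have [b bE] := ereal_real (FN x) (le_lt_trans xa (ltry a)).
  have [c cE] := ereal_real (FN y) (le_lt_trans ya (ltry a)).
  apply: le_trans ((econvexP FN).1 (Gamma0_convex GF) _ _ _ _ _ t01' bE cE) _.
  move: xa ya; rewrite bE cE !lee_fin.
  by move: t0 t1; nra.
have Sx0 : S x0 by split => //=; rewrite aE.
have [[M SM]|nb] := pselect (exists M : R, forall x, S x -> `|x| <= M).
  apply: (@bounded_sublevel_argmin _ _ F D x0 M) => //; first exact: Gamma0_lsc.
  by move=> x Dx; rewrite aE => xa; apply: SM.
have [M|d d0 dS] := recession_ray cS kS Sx0.
  have [//|hM] := pselect (exists2 x, S x & M < `|x|).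
  exfalso; apply: nb; exists M => x Sx; rewrite leNgt; apply/negP => xM.
  by apply: hM; exists x.
by move/eqP: d0 => []; apply: noray => t /dS[Dt Ft]; rewrite aE.
Qed.

(** The normal inequality of the projection [p], tested at [p + n] and [p - n], becomes an
    equality. *)
Lemma orth_projection (N : set H) : closed N -> N 0 ->
  (forall x y, N x -> N y -> N (x + y)) -> (forall (a : R) x, N x -> N (a *: x)) ->
  forall x, N (metric_proj N x) /\ forall n, N n -> inner (x - metric_proj N x) n = 0.
Proof.
move=> cN N0 ND NZ x.
have kN : convex_set N.
  by apply/convex_setP => y z t _ Ny Nz; apply: ND; apply: NZ.
have nN : N !=set0 by exists 0.
have [Np np] := subdiff_eindicP nN (metric_proj_normal x cN kN nN).
split=> // n Nn; apply/eqP; rewrite eq_le; apply/andP; split.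
  by have := np _ (ND _ _ Np Nn); rewrite addrAC subrr add0r.
have := np _ (ND _ _ Np (NZ (-1) _ Nn)).
by rewrite addrAC subrr add0r innerZr mulN1r oppr_le0.
Qed.

(** The spanning family consists of the projections onto [N] of an orthonormal basis of [H]. *)
Lemma subspace_span (N : set H) : closed N -> N 0 ->
  (forall x y, N x -> N y -> N (x + y)) -> (forall (a : R) x, N x -> N (a *: x)) ->
  exists s : seq H, forall n, N n <-> exists c : nat -> R,
    n = \sum_(i < size s) c i *: s`_i.
Proof.
move=> cN N0 ND NZ; have [e eP] := @orthonormal_basis R H.
have PN := orth_projection cN N0 ND NZ.
have Nsum (I : Type) (r : seq I) (G : I -> H) : (forall i, N (G i)) -> N (\sum_(i <- r) G i).
  by move=> NG; elim/big_ind: _.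
exists [seq metric_proj N a | a <- e] => n; split => [Nn|[c ->]]; last first.
  apply: Nsum => i; apply: NZ.
  have ie : (i < size e)%N by have := ltn_ord i; rewrite [X in (_ < X)%N -> _]size_map.
  by rewrite (nth_map 0) //; have [] := PN e`_i.
exists (fun i => inner n e`_i); rewrite size_map.
set p := (X in _ = X).
have pE : p = \sum_(a <- e) inner n a *: metric_proj N a.
  rewrite (big_nth 0) big_mkord; apply: eq_bigr => i _.
  by rewrite (nth_map 0).
have Np : N p by rewrite pE; apply: Nsum => a; apply: NZ; have [] := PN a.
(* [n - p] lies in [N] and is also a combination of residuals [a - metric_proj N a], all orthogonal
   to [N]; so it vanishes. *)
have Nd : N (n - p) by apply: ND => //; rewrite -scaleN1r; apply: NZ.
apply/eqP; rewrite -subr_eq0 -normr_eq0 -sqrf_eq0 -inner_norm; apply/eqP.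
have {1}-> : n - p = \sum_(a <- e) inner n a *: (a - metric_proj N a).
  by rewrite {1}(eP n) pE -sumrB; apply: eq_bigr => a _; rewrite scalerBr.
rewrite inner_suml big1_seq // => a _; rewrite innerZl.
by have [_ ->] := PN a; rewrite ?mulr0.
Qed.

End Existence.

(** * Sums of polyhedral cones and subspaces *)

Section FourierMotzkin.
Context {R : realType} {H : finHilbertType R}.

(** Gives a value of the eliminated variable between its finitely many lower and upper bounds, also
    when one list is empty. *)
Lemma real_between (s1 s2 : seq R) :
  (forall a b, a \in s1 -> b \in s2 -> a <= b) ->
  exists t, (forall a, a \in s1 -> a <= t) /\ (forall b, b \in s2 -> t <= b).
Proof.
elim: s1 => [_|a s1 IH h].
  elim: s2 => [|b s2 [t [_ tP]]]; first by exists 0.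
  exists (Num.min b t); split => // c; rewrite inE => /predU1P[->|cs].
    by rewrite ge_min lexx.
  by rewrite ge_min tP ?orbT.
have [x y xs ys|t [t1 t2]] := IH; first by apply: h; rewrite ?inE ?xs ?orbT.
exists (Num.max a t); split => c.
  rewrite inE => /predU1P[->|cs]; first by rewrite le_max lexx.
  by rewrite le_max t1 ?orbT.
by move=> cs; rewrite ge_max t2 // h ?inE ?eqxx.
Qed.

Definition cone_of (ps : seq H) : set H := [set x | forall p, p \in ps -> inner p x <= 0].

(* Fourier-Motzkin elimination of [t]. *)
Lemma cone_add_line (ps : seq H) (n : H) : exists ps' : seq H,
  forall x, cone_of ps' x <-> exists t, cone_of ps (x + t *: n).
Proof.
pose pos := [seq p <- ps | 0 < inner p n].
pose neg := [seq p <- ps | inner p n < 0].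
exists ([seq p <- ps | inner p n == 0] ++
  [seq - inner q n *: p + inner p n *: q | p <- pos, q <- neg]) => x; split.
- move=> xP.
  (* Each [q] in [neg] bounds [t] below and each [p] in [pos] bounds it above; the combined vectors
     say that these bounds are compatible. *)
  have [a b|t [t1 t2]] := @real_between
    [seq inner q x / - inner q n | q <- neg] [seq - inner p x / inner p n | p <- pos].
    move=> /mapP[q]; rewrite mem_filter => /andP[qn qs] -> /mapP[p].
    rewrite mem_filter => /andP[pn pp] ->.
    have := xP (- inner q n *: p + inner p n *: q).
    rewrite mem_cat [X in _ || X](_ : _ = true) ?orbT; last first.
      by apply: allpairs_f; rewrite mem_filter ?pn ?qn.
    move=> /(_ isT); rewrite innerDl !innerZl => h.
    rewrite ler_pdivrMr ?oppr_gt0 // mulrAC ler_pdivlMr //.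
    by move: h; lra.
  exists t => p pps; rewrite innerDr innerZr.
  have [pn|pn|pn] := ltgtP (inner p n) 0.
  - have : inner p x / - inner p n <= t by apply: t1; apply: map_f; rewrite mem_filter pn.
    by rewrite ler_pdivrMr ?oppr_gt0 //; lra.
  - have : t <= - inner p x / inner p n by apply: t2; apply: map_f; rewrite mem_filter pn.
    by rewrite ler_pdivlMr //; lra.
  - by rewrite pn mulr0 addr0; apply: xP; rewrite mem_cat mem_filter pn eqxx pps.
- move=> [t tP] r; rewrite mem_cat mem_filter => /orP[/andP[/eqP rn rs]|].
    by have := tP r rs; rewrite innerDr innerZr rn mulr0 addr0.
  move=> /allpairsP[[p q] /= []]; rewrite !mem_filter => /andP[pn pp] /andP[qn qs] ->.
  have := tP p pp; have := tP q qs; rewrite !innerDr !innerZr innerDl !innerZl.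
  by move: pn qn; set a := inner p n; set b := inner q n; nra.
Qed.

Lemma cone_add_span (ps s : seq H) : exists ps' : seq H,
  forall x, cone_of ps' x <->
    exists c : nat -> R, cone_of ps (x + \sum_(i < size s) c i *: s`_i).
Proof.
elim: s ps => [|n s IH] ps.
  exists ps => x; split => [px|[c]]; last by rewrite big_ord0 addr0.
  by exists (fun=> 0); rewrite big_ord0 addr0.
have [ps1 h1] := cone_add_line ps n.
have [ps2 h2] := IH ps1.
exists ps2 => x; rewrite h2; split => [[c /h1[t ht]]|[c hc]].
  (* Coefficient 0 belongs to the head [n]; the others shift by one. *)
  exists (fun i => if i is j.+1 then c j else t); rewrite /= big_ord_recl /=.
  by rewrite addrCA addrC.
exists (fun i => c i.+1); apply/h1; exists (c 0%N).
by move: hc; rewrite /= big_ord_recl /= addrCA addrC.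
Qed.

Lemma cone_of_closed (ps : seq H) : closed (cone_of ps).
Proof.
apply: closed_seqP => u l uP ul p pps.
have h : inner p (u n) @[n --> \oo] --> inner p l by apply: cvg_inner => //; exact: cvg_cst.
apply: (@closed_seq_lim _ [set x : R | x <= 0] _ _ _ _ h) => [|n]; first exact: closed_le.
exact: uP.
Qed.

(** Invariance under positive scaling turns every half-space [inner a x <= b] into
    [inner a x <= 0]. *)
Lemma polyhedral_coneE (K : set H) : polyhedral_cone K -> K !=set0 ->
  exists ps, K = cone_of ps.
Proof.
move=> [Kc [n [E [Eh KE]]]] [y Ky].
pose a i := projT1 (cid (Eh i)).
have aP i : exists b, E i = [set x | inner (a i) x <= b].
  by rewrite /a; case: cid => /= ? [b [_ ->]]; exists b.
exists [seq a i | i <- enum 'I_n]; apply/seteqP; split => x.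
  move=> Kx p /mapP[i _ ->]; have [b bE] := aP i.
  rewrite leNgt; apply/negP => w0.
  (* This factor scales the value at [x] to [|b| + 1 > b]. *)
  have t0 : 0 < (`|b| + 1) / inner (a i) x by rewrite divr_gt0 // ltr_wpDl.
  have := Kc _ _ t0 Kx; rewrite KE => /(_ i I); rewrite bE /= innerZr divfK ?gt_eqF //.
  by have := ler_norm b; lra.
move=> px; rewrite KE => i _; have [b bE] := aP i; rewrite bE /=.
have : inner (a i) x <= 0 by apply: px; apply: map_f; rewrite mem_enum.
move/le_trans; apply; rewrite leNgt; apply/negP => b0.
have yb : inner (a i) y <= b by move: Ky; rewrite KE => /(_ i I); rewrite bE.
have w0 : inner (a i) y < 0 by apply: le_lt_trans yb b0.
(* With [b < 0], this factor scales the value at [y] to [b / 2 > b]. *)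
have t0 : 0 < b / (2 * inner (a i) y) by rewrite nmulr_rgt0 // invr_lt0 pmulr_rlt0.
have := Kc _ _ t0 Ky; rewrite KE => /(_ i I); rewrite bE /= innerZr.
rewrite (_ : b / _ * _ = b / 2); last by field; rewrite lt_eqF.
by move: b0; lra.
Qed.

(** The set is [S + (K + N)]: by elimination [K + N] is again a polyhedral cone, hence closed, and
    adding the compact [S] keeps it closed. *)
Lemma multipolyhedral_add_subspace (D N : set H) :
  asymptotically_multipolyhedral D -> D !=set0 -> closed N -> N 0 ->
  (forall x y, N x -> N y -> N (x + y)) -> (forall (a : R) x, N x -> N (a *: x)) ->
  closed [set x | exists2 n, N n & D (x + n)].
Proof.
move=> [cD kD [S [K [cS pK DE]]]] [x0 Dx0] cN N0 ND NZ.
have nK : K !=set0 by move: Dx0; rewrite DE => -[s _ [k Kk _]]; exists k.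
have [ps psE] := polyhedral_coneE pK nK.
have [s sE] := subspace_span cN N0 ND NZ.
have [qs qsE] := cone_add_span ps s.
have -> : [set x | exists2 n, N n & D (x + n)] =
    [set x | exists2 y, S y & cone_of qs (x - y)].
  apply/seteqP; split => x /=.
    move=> [n /sE[c nE]]; rewrite DE => -[y Sy [k Kk yk]]; exists y => //.
    apply/qsE; exists c; rewrite -nE -psE.
    by rewrite addrAC -yk addrAC subrr add0r.
  move=> [y Sy /qsE[c]]; rewrite -psE => Kk.
  exists (\sum_(i < size s) c i *: s`_i); first by apply/sE; exists c.
  rewrite DE; exists y => //; eexists; first exact: Kk.
  by rewrite addrA addrCA subrr addr0.
have [M [_ SM]] := compact_bounded cS.
have cS' : closed S by apply: compact_closed => //; exact: norm_hausdorff.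
apply: closed_seqP => u l uP ul.
pose y n := projT1 (cid2 (uP n)).
have Sy n : S (y n) by rewrite /y; case: cid2.
have qy n : cone_of qs (u n - y n) by rewrite /y; case: cid2.
have yM n : `|y n| <= M + 1 by apply: (SM (M + 1)); rewrite ?ltrDl //; exact: Sy.
have [phi phin [z yz]] := bounded_subsequence yM.
exists z; first by apply: closed_seq_lim yz.
have ul' := subsequence_cvg phin ul.
apply: (@closed_seq_lim _ (cone_of qs) (fun n => u (phi n) - y (phi n))) => //.
  exact: cone_of_closed.
exact: cvgB.
Qed.

End FourierMotzkin.

(** * Primal-dual forward-backward iterations *)

Section AdjointLinear.
Context {R : realType} {H K : finHilbertType R}.
Variable F : {linear H -> K}.

Lemma adj_is_linear : linear (adj F).
Proof.
by move=> a x y; apply: inner_inj => z; rewrite innerDl innerZl !adjP innerDl innerZl.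
Qed.

HB.instance Definition _ := GRing.isLinear.Build R K H _ (adj F) adj_is_linear.

End AdjointLinear.

Section OperatorNorm.
Context {R : realType} {H K : finHilbertType R}.

Lemma opnorm_le (F : {linear H -> K}) x : `|F x| <= opnorm F * `|x|.
Proof.
have [k k0 kP] := linear_le_norm F.
have [->|x0] := eqVneq x 0; first by rewrite linear0 !normr0 mulr0.
have nx : 0 < `|x| by rewrite normr_gt0.
rewrite -ler_pdivrMr //.
have -> : `|F x| / `|x| = `|F (`|x|^-1 *: x)|.
  by rewrite linearZ /= normrZ normfV normr_id mulrC.
apply: ub_le_sup; last first.
  by exists (`|x|^-1 *: x) => //=; rewrite normrZ normfV normr_id mulVf // gt_eqF.
exists k => _ [y /= y1 <-]; apply: (le_trans (kP y)).
by rewrite -[leRHS]mulr1 ler_pM2l.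
Qed.

End OperatorNorm.

Lemma inner_young (R : realType) (H : finHilbertType R) (x y : H) (t : R) :
  0 < t -> inner x y <= t^-1 * `|x| ^+ 2 + t / 4 * `|y| ^+ 2.
Proof.
move=> t0; have h := inner_le x y; apply: (le_trans (ler_norm _)).
apply: (le_trans h); rewrite -subr_ge0.
have -> : t^-1 * `|x| ^+ 2 + t / 4 * `|y| ^+ 2 - `|x| * `|y| =
    t^-1 * (`|x| - t / 2 * `|y|) ^+ 2 by field; rewrite gt_eqF.
by rewrite mulr_ge0 ?invr_ge0 ?sqr_ge0 // ltW.
Qed.

(** * The Baillon-Haddad theorem *)

Section BaillonHaddad.
Context {R : realType} {H : finHilbertType R}.
Variables (d : H -> R) (gd : H -> H) (c beta : R).
Hypothesis d_quad : forall x y, `|d y - d x - inner (gd x) (y - x)| <= c * `|y - x| ^+ 2.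
Hypothesis beta_gt0 : 0 < beta.
Hypothesis gd_lip : forall x y, `|gd x - gd y| <= beta * `|x - y|.
Hypothesis d_convex : forall x y, d x + inner (gd x) (y - x) <= d y.

Lemma line_has_der x h t :
  has_der (fun s => d (x + s *: h)) t (inner (gd (x + t *: h)) h).
Proof.
move=> e e0; have n1 := @near_small R R^o (c * `|h| ^+ 2) _ e0; near=> s.
have := d_quad (x + t *: h) (x + (t + s) *: h).
have -> : x + (t + s) *: h - (x + t *: h) = s *: h.
  by rewrite scalerDl opprD addrACA subrr add0r addrAC subrr add0r.
rewrite innerZr normrZ exprMn real_normK ?num_real // (mulrC s (inner _ _)).
move/le_trans; apply.
rewrite -(real_normK (num_real s)).
rewrite (_ : c * _ = (c * `|h| ^+ 2 * `|s|) * `|s|); last by ring.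
by rewrite ler_wpM2r //; near: s.
Unshelve. all: by end_near.
Qed.

(** Mean value theorem for [d] along the segment minus its claimed upper parabola, whose derivative
    is nonpositive on the segment. *)
Lemma descent x y : d y <= d x + inner (gd x) (y - x) + beta / 2 * `|y - x| ^+ 2.
Proof.
set h := y - x.
pose f s := d (x + s *: h) +
  (- inner (gd x) h * (s - 0) + - (beta / 2 * `|h| ^+ 2) * (s - 0) ^+ 2).
have fd t : has_der f t (inner (gd (x + t *: h)) h +
    (- inner (gd x) h + 2 * - (beta / 2 * `|h| ^+ 2) * (t - 0))).
  by apply: has_derD; [exact: line_has_der | exact: has_der_quad].
have [t /andP[t0 t1]] := has_der_mvt fd ler01.
have xh : x + 1 *: h = y by rewrite scale1r /h addrC subrK.
rewrite /f scale0r addr0 xh => fE.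
have h1 : inner (gd (x + t *: h) - gd x) h <= beta * (t * `|h|) * `|h|.
  apply: le_trans (ler_norm _) _; apply: le_trans (inner_le _ _) _.
  rewrite ler_wpM2r //; apply: le_trans (gd_lip _ _) _.
  by rewrite addrAC subrr add0r normrZ (ger0_norm t0).
rewrite innerDl innerNl in h1.
by move: fE h1; rewrite !subr0 expr0n expr1n /=; lra.
Qed.

Lemma cocoercive x y :
  beta^-1 * `|gd x - gd y| ^+ 2 <= inner (gd x - gd y) (x - y).
Proof.
have bregman u v :
    d v + inner (gd v) (u - v) + beta^-1 / 2 * `|gd u - gd v| ^+ 2 <= d u.
  (* [w] is a gradient step of length [1 / beta] from [u] for [d - inner (gd v) .], a function
     minimal at [v]; [descent] bounds its value at [w]. *)
  set g := gd u - gd v; pose w := u - beta^-1 *: g.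
  have h1 := d_convex v w; have := descent u w.
  have wu : w - u = - (beta^-1 *: g) by rewrite /w addrAC subrr add0r.
  have wv : w - v = (u - v) - beta^-1 *: g by rewrite /w addrAC.
  rewrite wu innerNr innerZr normrN normrZ exprMn normfV (gtr0_norm beta_gt0) => h2.
  rewrite wv innerDr innerNr innerZr in h1.
  have gE : `|g| ^+ 2 = inner (gd u) g - inner (gd v) g.
    by rewrite -inner_norm {1}/g innerDl innerNl.
  have bE : beta / 2 * (beta^-1 ^+ 2 * `|g| ^+ 2) = beta^-1 / 2 * `|g| ^+ 2.
    by field; rewrite gt_eqF.
  by move: h1 h2; rewrite bE gE; lra.
have := bregman x y; have := bregman y x.
rewrite (distrC (gd y)) -(opprB x y) innerNr !innerDl !innerNl.
set q := _ ^+ 2; lra.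
Qed.

End BaillonHaddad.

(** * One step of the primal-dual iteration *)

Section PrimalDualStep.
Context {R : realType} {X Z Zt W : finHilbertType R}.
Variables (L : {linear X -> Z}) (C : {linear X -> W}) (B : {linear Z -> Zt}).
Variables (mu sigma tau M beta : R).
Hypotheses (mu_gt0 : 0 < mu) (beta_gt0 : 0 < beta).
Hypotheses (beta_M : beta <= M) (B_M : forall v, mu * `|B v| ^+ 2 <= M * `|v| ^+ 2).

(* Squared norm in the metric that turns the iteration into a forward-backward
   step for a monotone operator plus a cocoercive one. *)
Definition pd_norm (a : X) (b c : Z) (e : W) : R :=
  sigma * inner a a + tau * inner b b + mu * inner c c + mu * inner e e
  - 2 * mu * inner (B (L a)) (B b) - 2 * mu * inner (L a) c
  - 2 * mu * inner (C a) e.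

(** What remains of [pd_norm] once the terms evaluated at the old iterate, the gradient and [B b],
    have cost [M / 2] each. *)
Definition pd_gap (a : X) (b c : Z) (e : W) : R :=
  pd_norm a b c e - M / 2 * (inner a a + inner b b).

(** Unprimed variables stand for the current iterate minus a solution, primed ones for the next
    iterate minus it, and [g] for the difference of gradients. The hypotheses are the primal update,
    monotonicity for the three implicit updates, and cocoercivity. *)
Lemma fejer_step (a a' g : X) (b b' c c' : Z) (e e' : W) :
  sigma * inner (a - a') a' = inner g a' + mu * inner (B b) (B (L a'))
     + mu * inner c (L a') + mu * inner e (C a') ->
  0 <= tau * inner (b - b') b' - mu * inner (B b) (B b')
     + 2 * mu * inner (B (L a')) (B b') - mu * inner (B (L a)) (B b') ->
  0 <= inner c' (2 *: L a' - L a + c - c') ->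
  0 <= inner e' (2 *: C a' - C a + e - e') ->
  beta^-1 * `|g| ^+ 2 <= inner g a ->
  pd_norm a' b' c' e' <=
    pd_norm a b c e - pd_gap (a - a') (b - b') (c - c') (e - e').
Proof.
move=> h1 h2 h3 h4 h5.
have h3' := mulr_ge0 (ltW mu_gt0) h3; have h4' := mulr_ge0 (ltW mu_gt0) h4.
(* Young with parameter [beta]: cocoercivity pays for the gradient term, and [beta <= M] for the
   square. *)
have y1 : 2 * inner g (a - a') <= 2 * inner g a + M / 2 * inner (a - a') (a - a').
  have := inner_young g (a - a') beta_gt0; rewrite [inner (a - a') _]inner_norm.
  have : beta * `|a - a'| ^+ 2 <= M * `|a - a'| ^+ 2 by rewrite ler_wpM2r ?sqr_ge0.
  by move: h5; lra.
(* The explicit term [B b] is treated alike, through the bound of [mu * |B v|^2] by [M * |v|^2]. *)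
have y2 : 2 * mu * inner (B b) (B (b - b')) <=
    2 * mu * inner (B b) (B b) + M / 2 * inner (b - b') (b - b').
  have := ler_wpM2l (ltW mu_gt0) (inner_young (B b) (B (b - b')) ltr01).
  by have := B_M (b - b'); rewrite !inner_norm invr1; lra.
rewrite /pd_gap /pd_norm; move: h1 h2 h3' h4' y1 y2.
rewrite !linearB /= !innerE.
rewrite ?(innerC a' a) ?(innerC b' b) ?(innerC c' c) ?(innerC e' e)
  ?(innerC (B b') (B b)) ?(innerC c (L _)) ?(innerC c' (L _)) ?(innerC e (C _))
  ?(innerC e' (C _)) ?(innerC (B b) (B (L _))) ?(innerC (B b') (B (L _))).
by lra.
Qed.

Variables (kappa omega : R).
Hypothesis kappaP : forall a, `|L a| ^+ 2 + `|C a| ^+ 2 <= kappa * `|a| ^+ 2.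
Hypothesis omegaP : forall a b, inner (B (L a)) (B b) <= omega * `|a| * `|b|.
Hypothesis tau_gt : M / 2 < tau.
Hypothesis sigma_gt : mu * kappa + M / 2 + mu ^+ 2 * omega ^+ 2 / (tau - M / 2) < sigma.

(** Complete squares: in [c] around [L a], in [e] around [C a], then in [|b|] around [r * |a|]; by
    the bound on [sigma] a positive multiple [s] of [|a|^2] is left. *)
Lemma pd_gap_coercive : exists2 k, 0 < k & forall a b c e,
  `|a| ^+ 2 + `|b| ^+ 2 + `|c| ^+ 2 + `|e| ^+ 2 <= k * pd_gap a b c e.
Proof.
pose t' := tau - M / 2; have t'0 : 0 < t' by rewrite subr_gt0.
pose r := mu * omega / t'.
pose s := sigma - (mu * kappa + M / 2 + mu ^+ 2 * omega ^+ 2 / t').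
have s0 : 0 < s by rewrite subr_gt0.
have rE : t' * r ^+ 2 = mu ^+ 2 * omega ^+ 2 / t' by rewrite /r; field; rewrite gt_eqF.
have rE1 : t' * r = mu * omega by rewrite /r mulrC divfK // gt_eqF.
have lower a b c e : s * `|a| ^+ 2 + t' * (`|b| - r * `|a|) ^+ 2
    + mu * `|c - L a| ^+ 2 + mu * `|e - C a| ^+ 2 <= pd_gap a b c e.
  rewrite /pd_gap /pd_norm !inner_norm !normBsqr (innerC c) (innerC e).
  have := ler_wpM2l (ltW mu_gt0) (kappaP a); have := ler_wpM2l (ltW mu_gt0) (omegaP a b).
  have -> : (`|b| - r * `|a|) ^+ 2 =
      `|b| ^+ 2 - `|b| * (r * `|a|) *+ 2 + r ^+ 2 * `|a| ^+ 2 by ring.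
  have -> : t' * (`|b| ^+ 2 - `|b| * (r * `|a|) *+ 2 + r ^+ 2 * `|a| ^+ 2) =
     t' * `|b| ^+ 2 - 2 * (t' * r) * `|a| * `|b| + (t' * r ^+ 2) * `|a| ^+ 2 by ring.
  rewrite rE rE1 /s /t'; lra.
(* The coefficients come from [half] and [b2], which recover [|b|], [|c|] and [|e|] from the squares
   in [lower]. *)
pose k := (1 + 2 * r ^+ 2 + 2 * `|kappa|) / s + 2 / t' + 2 / mu.
have k1 : 0 < 1 + 2 * r ^+ 2 + 2 * `|kappa|.
  by have := sqr_ge0 r; have := normr_ge0 kappa; lra.
exists k => [|a b c e]; first by rewrite !addr_gt0 // divr_gt0.
have half (K : finHilbertType R) (p q : K) : `|p| ^+ 2 <= 2 * `|p - q| ^+ 2 + 2 * `|q| ^+ 2.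
  have := sqr_ge0 `|p - 2 *: q|.
  by rewrite !normBsqr innerZr normrZ exprMn (ger0_norm (ler0n _ 2)); lra.
have kap : kappa * `|a| ^+ 2 <= `|kappa| * `|a| ^+ 2.
  by rewrite ler_wpM2r ?sqr_ge0 // ler_norm.
have b2 : `|b| ^+ 2 <= 2 * (`|b| - r * `|a|) ^+ 2 + 2 * r ^+ 2 * `|a| ^+ 2.
  by have := sqr_ge0 (`|b| - 2 * r * `|a|); lra.
have := lower a b c e; move: (half _ c (L a)) (half _ e (C a)) (kappaP a) kap b2.
have := sqr_ge0 `|a|; have := sqr_ge0 (`|b| - r * `|a|).
have := sqr_ge0 `|c - L a|; have := sqr_ge0 `|e - C a|.
move: (`|c - L a| ^+ 2) (`|e - C a| ^+ 2) ((`|b| - r * `|a|) ^+ 2) => u3 u4 u2.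
move: (`|a| ^+ 2) (`|b| ^+ 2) (`|c| ^+ 2) (`|e| ^+ 2) (`|L a| ^+ 2) (`|C a| ^+ 2).
move=> u1 b2 c2 e2 l2 q2 u4p u3p u2p u1p hc he hk hk' hb hQ.
set Q := pd_gap a b c e in hQ *.
have bound (w y : R) : 0 < w -> 0 <= y -> w * y <= Q -> y <= Q / w.
  by move=> w0 y0 wy; rewrite ler_pdivlMr // mulrC.
have m1 := mulr_ge0 (ltW s0) u1p; have m2 := mulr_ge0 (ltW t'0) u2p.
have m3 := mulr_ge0 (ltW mu_gt0) u3p; have m4 := mulr_ge0 (ltW mu_gt0) u4p.
have q1 : u1 <= Q / s by apply: bound => //; lra.
have q2' : u2 <= Q / t' by apply: bound => //; lra.
have q34 : u3 + u4 <= Q / mu by apply: bound => //; [exact: addr_ge0 | lra].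
have q1' := ler_wpM2l (ltW k1) q1.
have -> : k * Q = (1 + 2 * r ^+ 2 + 2 * `|kappa|) * (Q / s) + 2 * (Q / t') + 2 * (Q / mu).
  by rewrite /k; ring.
by move: hc he hk hk' hb q1' q2' q34; lra.
Qed.

End PrimalDualStep.

(** * Convergence of the primal-dual iteration *)

Section PrimalDualConvergence.
Context {R : realType} {X Z Zt W : finHilbertType R}.
Variables (Psi : Z -> \bar R) (Delta : set W) (gd : X -> X).
Variables (L : {linear X -> Z}) (C : {linear X -> W}) (B : {linear Z -> Zt}).
Variables (mu sigma tau M beta kappa omega : R).
Hypotheses (Psi_G : Gamma0 Psi) (Delta_G : Gamma0 (eindic Delta : W -> \bar R)).
Hypotheses (mu_gt0 : 0 < mu) (beta_gt0 : 0 < beta).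
Hypotheses (beta_M : beta <= M) (B_M : forall v, mu * `|B v| ^+ 2 <= M * `|v| ^+ 2).
Hypothesis kappaP : forall a, `|L a| ^+ 2 + `|C a| ^+ 2 <= kappa * `|a| ^+ 2.
Hypothesis omegaP : forall a b, inner (B (L a)) (B b) <= omega * `|a| * `|b|.
Hypothesis tau_gt : M / 2 < tau.
Hypothesis sigma_gt : mu * kappa + M / 2 + mu ^+ 2 * omega ^+ 2 / (tau - M / 2) < sigma.
Hypothesis gd_lip : forall x y, `|gd x - gd y| <= beta * `|x - y|.
Hypothesis gd_coco : forall x y,
  beta^-1 * `|gd x - gd y| ^+ 2 <= inner (gd x - gd y) (x - y).

(** Stationarity, tested against [h], with multipliers [w] and [z]; [v] is a maximizer in [gm_conj]
    at [L x], so that [adj B (B v)] is the gradient of [gm_conj] there. *)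
Definition kkt (x : X) (v w : Z) (z : W) :=
  [/\ forall h, inner (gd x) h + mu * inner (B v) (B (L h)) + mu * inner w (L h)
        + mu * inner z (C h) = 0,
      subdiff Psi v (adj B (B (L x - v))), subdiff Psi (L x) w
    & subdiff (eindic Delta : W -> \bar R) (C x) z].

Variables (x : nat -> X) (v w : nat -> Z) (z : nat -> W).

Hypothesis iter_x : forall k h, sigma * inner (x k - x k.+1) h =
  inner (gd (x k)) h + mu * inner (B (v k)) (B (L h)) + mu * inner (w k) (L h)
  + mu * inner (z k) (C h).
Hypothesis iter_v : forall k, subdiff Psi (v k.+1)
  ((tau / mu) *: (v k - v k.+1) + adj B (B (2 *: L (x k.+1) - L (x k) - v k))).
Hypothesis iter_w : forall k, subdiff Psi
  (2 *: L (x k.+1) - L (x k) + w k - w k.+1) (w k.+1).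
Hypothesis iter_z : forall k, subdiff (eindic Delta : W -> \bar R)
  (2 *: C (x k.+1) - C (x k) + z k - z k.+1) (z k.+1).

Let N := pd_norm L C B mu sigma tau.
Let Q := pd_gap L C B mu sigma tau M.

(** [fejer_step] for the differences with a solution; its monotonicity hypotheses come from pairing
    the inclusions at the iterate with those at the solution. *)
Lemma kkt_step xs vs ws zs k : kkt xs vs ws zs ->
  N (x k.+1 - xs) (v k.+1 - vs) (w k.+1 - ws) (z k.+1 - zs) <=
    N (x k - xs) (v k - vs) (w k - ws) (z k - zs)
    - Q (x k - x k.+1) (v k - v k.+1) (w k - w k.+1) (z k - z k.+1).
Proof.
move=> [kx kv kw kz].
have E (V : zmodType) (a b c : V) : a - b = (a - c) - (b - c).
  by rewrite opprB addrA subrK.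
rewrite (E _ (x k) (x k.+1) xs) (E _ (v k) (v k.+1) vs) (E _ (w k) (w k.+1) ws)
  (E _ (z k) (z k.+1) zs).
apply: (@fejer_step _ _ _ _ _ L C B mu sigma tau M beta mu_gt0 beta_gt0 beta_M B_M _ _
  (gd (x k) - gd xs)).
- rewrite -(E _ (x k) (x k.+1) xs) iter_x.
  have := kx (x k.+1 - xs).
  rewrite 2!innerDl 2!innerNl [B (v k - vs)]linearB !innerDl !innerNl.
  by lra.
- have := subdiff_monotone Psi_G (iter_v k) kv.
  rewrite -(ler_pM2l mu_gt0) mulr0.
  have -> : forall g,
     mu * inner ((tau / mu) *: (v k - v k.+1) + g - adj B (B (L xs - vs))) (v k.+1 - vs)
     = tau * inner (v k - v k.+1) (v k.+1 - vs) +
       mu * inner (g - adj B (B (L xs - vs))) (v k.+1 - vs).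
    move=> g; rewrite -addrA innerDl innerZl mulrDr mulrA (mulrC mu) divfK // gt_eqF //.
  have BE p q h : inner (adj B (B p) - adj B (B q)) h = inner (B (p - q)) (B h).
    by rewrite [B (p - q)]linearB !innerDl !innerNl !adjP.
  rewrite BE.
  rewrite (E _ (v k) (v k.+1) vs).
  set b := v k - vs; set b' := v k.+1 - vs.
  have -> : 2 *: L (x k.+1) - L (x k) - v k - (L xs - vs) =
     2 *: L (x k.+1 - xs) - L (x k - xs) - b.
    by apply: inner_inj => q; rewrite /b !linearB /= !innerE; ring.
  move: (L (x k.+1 - xs)) (L (x k - xs)) => p q.
  by rewrite [B (2 *: p - q - b)]linearB [B (2 *: p - q)]linearB linearZ /= !innerE; lra.
- have := subdiff_monotone Psi_G (iter_w k) kw.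
  rewrite innerC -[X in 0 <= X]innerC.
  rewrite (_ : _ - L xs = 2 *: L (x k.+1 - xs) - L (x k - xs) + (w k - ws) - (w k.+1 - ws)) //.
  by apply: inner_inj => q; rewrite !linearB /= !innerE; ring.
- have := subdiff_monotone Delta_G (iter_z k) kz.
  rewrite (_ : _ - C xs = 2 *: C (x k.+1 - xs) - C (x k - xs) + (z k - zs) - (z k.+1 - zs)) //.
  by apply: inner_inj => q; rewrite !linearB /= !innerE; ring.
- exact: gd_coco.
Qed.

Hypothesis kkt_ex : exists xs vs ws zs, kkt xs vs ws zs.

Lemma nonincreasing_diff_cvg0 (u : nat -> R) : (forall k, 0 <= u k) ->
  (forall k, u k.+1 <= u k) -> (u k - u k.+1) @[k --> \oo] --> 0.
Proof.
move=> u0 ui.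
have cu : cvgn u.
  apply: nonincreasing_is_cvgn; first by apply/nonincreasing_seqP.
  by exists 0 => _ [k _ <-].
rewrite -(subrr (limn u)); apply: cvgB => //.
by rewrite (cvg_shiftS u).
Qed.

Lemma sqr_norm_cvg0 (H : finHilbertType R) (u : nat -> H) (a : nat -> R) :
  (forall k, `|u k| ^+ 2 <= a k) -> a @ \oo --> 0 -> u @ \oo --> 0.
Proof.
move=> ua a0; apply/cvgrPdist_lt => e e0.
move/cvgrPdist_lt: a0 => /(_ (e ^+ 2) (exprn_gt0 _ e0)).
apply: filterS => k; rewrite !sub0r !normrN => h.
rewrite -(ltr_pXn2r (ltn0Sn 1)) ?nnegrE ?(ltW e0) //.
by apply: le_lt_trans (ua k) _; apply: le_lt_trans h; exact: ler_norm.
Qed.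

(** Opial's argument: the distance to every solution is nonincreasing, successive differences tend
    to 0, so a cluster point solves the system; the distance to that point tends to 0 along a
    subsequence, hence altogether. *)
Lemma primal_dual_cvg : exists xs vs ws zs, kkt xs vs ws zs /\ x @ \oo --> xs.
Proof.
have [k k0 kP] := pd_gap_coercive mu_gt0 kappaP omegaP tau_gt sigma_gt.
have Q0 a b c e : 0 <= Q a b c e.
  rewrite -(pmulr_rge0 _ k0); apply: le_trans (kP a b c e).
  by rewrite !addr_ge0 ?sqr_ge0.
have NQ a b c e : Q a b c e <= N a b c e.
  rewrite /Q /pd_gap gerBl mulr_ge0 ?addr_ge0 ?inner_ge0 //.
  by rewrite divr_ge0 // ltW // (lt_le_trans beta_gt0).
have Nk a b c e : `|a| ^+ 2 + `|b| ^+ 2 + `|c| ^+ 2 + `|e| ^+ 2 <= k * N a b c e.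
  by apply: le_trans (kP _ _ _ _) _; rewrite ler_pM2l //; exact: NQ.
have N0 a b c e : 0 <= N a b c e by apply: le_trans (NQ _ _ _ _).
have [xs [vs [ws [zs ks]]]] := kkt_ex.
pose u xs vs ws zs n := N (x n - xs) (v n - vs) (w n - ws) (z n - zs).
have ui xs' vs' ws' zs' n : kkt xs' vs' ws' zs' ->
    u xs' vs' ws' zs' n.+1 <= u xs' vs' ws' zs' n.
  by move=> /kkt_step-/(_ n)/le_trans; apply; rewrite gerBl.
have ub n : u xs vs ws zs n <= u xs vs ws zs 0%N.
  by elim: n => // n; apply: le_trans; exact: ui.
pose q n := Q (x n - x n.+1) (v n - v n.+1) (w n - w n.+1) (z n - z n.+1).
(* The gap of a step is at most the decrease of the distance, which tends to 0. *)
have kq0 : k * q n @[n --> \oo] --> 0.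
  have h := nonincreasing_diff_cvg0 (fun n => N0 _ _ _ _) (fun n => ui _ _ _ _ n ks).
  apply: (@squeeze_cvgr _ _ _ _ (fun=> 0) (fun n => k * (u xs vs ws zs n - u xs vs ws zs n.+1))).
  - apply: nearW => n; rewrite mulr_ge0 ?(ltW k0) ?Q0 //= ler_pM2l //.
    by have := kkt_step n ks; rewrite /u /q; lra.
  - exact: cvg_cst.
  - by rewrite -(mulr0 k); apply: cvgM => //; exact: cvg_cst.
have norms n : [/\ `|x n - x n.+1| ^+ 2 <= k * q n, `|v n - v n.+1| ^+ 2 <= k * q n,
    `|w n - w n.+1| ^+ 2 <= k * q n & `|z n - z n.+1| ^+ 2 <= k * q n].
  have := kP (x n - x n.+1) (v n - v n.+1) (w n - w n.+1) (z n - z n.+1).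
  rewrite -/(Q _ _ _ _) -/(q n); move: (k * q n) => r.
  have := sqr_ge0 `|x n - x n.+1|; have := sqr_ge0 `|v n - v n.+1|.
  have := sqr_ge0 `|w n - w n.+1|; have := sqr_ge0 `|z n - z n.+1|.
  by split; lra.
have dx : x n - x n.+1 @[n --> \oo] --> 0.
  by apply: sqr_norm_cvg0 kq0 => n; have [] := norms n.
have dv : v n - v n.+1 @[n --> \oo] --> 0.
  by apply: sqr_norm_cvg0 kq0 => n; have [] := norms n.
have dw : w n - w n.+1 @[n --> \oo] --> 0.
  by apply: sqr_norm_cvg0 kq0 => n; have [] := norms n.
have dz : z n - z n.+1 @[n --> \oo] --> 0.
  by apply: sqr_norm_cvg0 kq0 => n; have [] := norms n.
have bounded (H : finHilbertType R) (y : nat -> H) (ys : H) :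
    (forall n, `|y n - ys| ^+ 2 <= k * u xs vs ws zs n) ->
    forall n, `|y n| <= 1 + k * u xs vs ws zs 0%N + `|ys|.
  move=> yP n; rewrite -[y n](subrK ys) (le_trans (ler_normD _ _)) // lerD2r.
  have : k * u xs vs ws zs n <= k * u xs vs ws zs 0%N by rewrite ler_pM2l.
  (* The square is undone by [s <= 1 + s^2]. *)
  have := yP n; have := sqr_ge0 (`|y n - ys| - 1); have := sqr_ge0 `|y n - ys|; lra.
have [bx bv bw bz] : [/\ forall n, `|x n - xs| ^+ 2 <= k * u xs vs ws zs n,
    forall n, `|v n - vs| ^+ 2 <= k * u xs vs ws zs n,
    forall n, `|w n - ws| ^+ 2 <= k * u xs vs ws zs n &
    forall n, `|z n - zs| ^+ 2 <= k * u xs vs ws zs n].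
  have h n := Nk (x n - xs) (v n - vs) (w n - ws) (z n - zs).
  split => n; apply: le_trans (h n);
  have := sqr_ge0 `|x n - xs|; have := sqr_ge0 `|v n - vs|;
  have := sqr_ge0 `|w n - ws|; have := sqr_ge0 `|z n - zs|; lra.
(* Four successive extractions give one index map [p] along which all components converge. *)
have [p1 p1n [xl x1]] := bounded_subsequence (bounded _ _ _ bx).
have [p2 p2n [vl v2]] := bounded_subsequence (fun n => bounded _ _ _ bv (p1 n)).
have [p3 p3n [wl w3]] := bounded_subsequence (fun n => bounded _ _ _ bw (p1 (p2 n))).
have [p4 p4n [zl z4]] := bounded_subsequence (fun n => bounded _ _ _ bz (p1 (p2 (p3 n)))).
pose p n := p1 (p2 (p3 (p4 n))).
have pn n : (n <= p n)%N.
  by apply: leq_trans (p1n _); apply: leq_trans (p2n _); apply: leq_trans (p3n _).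
have px : x (p n) @[n --> \oo] --> xl.
  exact: subsequence_cvg p4n (subsequence_cvg p3n (subsequence_cvg p2n x1)).
have pv : v (p n) @[n --> \oo] --> vl.
  exact: subsequence_cvg p4n (subsequence_cvg p3n v2).
have pw : w (p n) @[n --> \oo] --> wl by exact: subsequence_cvg p4n w3.
have pz : z (p n) @[n --> \oo] --> zl by exact: z4.
(* The inclusions relate the steps [p n] and [p n + 1]; both have the same limit because successive
   differences vanish. *)
have next (H : finHilbertType R) (y : nat -> H) (yl : H) :
    y (p n) @[n --> \oo] --> yl -> y n - y n.+1 @[n --> \oo] --> 0 ->
    y (p n).+1 @[n --> \oo] --> yl.
  move=> yp dy; have dyp := subsequence_cvg pn dy.
  rewrite -(subr0 yl) (_ : (fun _ => _) = (fun n => y (p n) - (y (p n) - y (p n).+1))).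
    exact: cvgB.
  by apply/funext => n; rewrite opprB addrC subrK.
have px' := next _ _ _ px dx; have pv' := next _ _ _ pv dv.
have pw' := next _ _ _ pw dw; have pz' := next _ _ _ pz dz.
have lin (H K : finHilbertType R) (F : {linear H -> K}) (y : nat -> H) (yl : H) :
    y @ \oo --> yl -> F (y n) @[n --> \oo] --> F yl.
  by move=> yy; apply: cvg_comp yy _; exact: linear_hilbert_continuous.
have extr (K : finHilbertType R) (F : {linear X -> K}) :
    2 *: F (x (p n).+1) - F (x (p n)) @[n --> \oo] --> F xl.
  rewrite (_ : F xl = 2 *: F xl - F xl); last by rewrite scaler_nat mulr2n addrK.
  have h1 := lin _ _ F _ _ px; have h2 := lin _ _ F _ _ px'.
  by apply: cvgB h1; apply: cvgZl_tmp.
have kl : kkt xl vl wl zl.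
  split.
  - move=> h; apply/esym.
    have gx : gd (x (p n)) @[n --> \oo] --> gd xl.
      apply/cvgrPdist_lt => e e0; move/cvgrPdist_lt: px => /(_ (e / beta) (divr_gt0 e0 beta_gt0)).
      apply: filterS => n; rewrite ltr_pdivlMr // mulrC; apply: le_lt_trans.
      exact: gd_lip.
    have inn (H : finHilbertType R) (y : nat -> H) (yl h' : H) :
        y @ \oo --> yl -> inner (y n) h' @[n --> \oo] --> inner yl h'.
      by move=> yy; apply: cvg_inner => //; exact: cvg_cst.
    have mulc (r : R) (y : nat -> R) (yl : R) :
        y @ \oo --> yl -> r * y n @[n --> \oo] --> r * yl.
      by move=> yy; apply: cvgM => //; exact: cvg_cst.
    have rhs := cvgD (cvgD (cvgD (inn _ _ _ h gx)
      (mulc mu _ _ (inn _ _ _ (B (L h)) (lin _ _ B _ _ pv))))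
      (mulc mu _ _ (inn _ _ _ (L h) pw))) (mulc mu _ _ (inn _ _ _ (C h) pz)).
    have lhs := mulc sigma _ _ (inn _ _ _ h (subsequence_cvg pn dx)).
    rewrite inner0l mulr0 in lhs.
    apply: (cvg_unique (@norm_hausdorff _ _) lhs).
    rewrite (_ : (fun n => sigma * _) = (fun n => inner (gd (x (p n))) h +
      mu * inner (B (v (p n))) (B (L h)) + mu * inner (w (p n)) (L h) +
      mu * inner (z (p n)) (C h))); first exact: rhs.
    by apply/funext => n; rewrite iter_x.
  - apply: (subdiff_closed Psi_G (fun n => iter_v (p n)) pv').
    rewrite -[adj B _]add0r; apply: cvgD.
      by rewrite -(scaler0 _ (tau / mu)); apply: cvgZl_tmp; exact: subsequence_cvg pn dv.
    exact: (lin _ _ (adj B) _ _ (lin _ _ B _ _ (cvgB (extr _ L) pv))).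
  - apply: (subdiff_closed Psi_G (fun n => iter_w (p n)) _ pw').
    rewrite (_ : L xl = L xl + wl - wl); last by rewrite addrK.
    exact: (cvgB (cvgD (extr _ L) pw) pw').
  - apply: (subdiff_closed Delta_G (fun n => iter_z (p n)) _ pz').
    rewrite (_ : C xl = C xl + zl - zl); last by rewrite addrK.
    exact: (cvgB (cvgD (extr _ C) pz) pz').
exists xl, vl, wl, zl; split => //.
have sub0 (H : finHilbertType R) (y : nat -> H) (yl : H) :
    y (p n) @[n --> \oo] --> yl -> y (p n) - yl @[n --> \oo] --> 0.
  by move=> yy; rewrite -(subrr yl); apply: cvgB => //; exact: cvg_cst.
have x0 := sub0 _ _ _ px; have v0 := sub0 _ _ _ pv.
have w0 := sub0 _ _ _ pw; have z0 := sub0 _ _ _ pz.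
have up : u xl vl wl zl (p n) @[n --> \oo] --> 0.
  have -> : (0 : R) = N 0 0 0 0 by rewrite /N /pd_norm !linear0 !inner0l !mulr0; ring.
  have mulc (r : R) (H : finHilbertType R) (y y' : nat -> H) (yl yl' : H) :
      y @ \oo --> yl -> y' @ \oo --> yl' ->
      r * inner (y n) (y' n) @[n --> \oo] --> r * inner yl yl'.
    move=> yy yy'; apply: cvgM; first exact: cvg_cst.
    exact: cvg_inner.
  have Lx := lin _ _ L _ _ x0.
  exact: (cvgB (cvgB (cvgB (cvgD (cvgD (cvgD (mulc _ _ _ _ _ _ x0 x0) (mulc _ _ _ _ _ _ v0 v0))
    (mulc _ _ _ _ _ _ w0 w0)) (mulc _ _ _ _ _ _ z0 z0))
    (mulc _ _ _ _ _ _ (lin _ _ B _ _ Lx) (lin _ _ B _ _ v0))) (mulc _ _ _ _ _ _ Lx w0))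
    (mulc _ _ _ _ _ _ (lin _ _ C _ _ x0) z0)).
(* The whole sequence is nonincreasing, so one small term along [p] bounds all later ones. *)
have ul : u xl vl wl zl n @[n --> \oo] --> 0.
  apply/cvgrPdist_lt => e e0; move/cvgrPdist_lt: up => /(_ e e0)[n0 _ /(_ n0 (leqnn _)) /= h].
  exists (p n0) => // n /= pn0; rewrite sub0r normrN ger0_norm; last exact: N0.
  move: h; rewrite sub0r normrN ger0_norm; last exact: N0.
  apply: le_lt_trans; rewrite -(subnKC pn0); elim: (n - p n0)%N => [|i]; first by rewrite addn0.
  by apply: le_trans; rewrite addnS; exact: ui.
have xl0 : x n - xl @[n --> \oo] --> 0.
  apply: (@sqr_norm_cvg0 _ _ (fun n => k * u xl vl wl zl n)) => [n|].
    apply: le_trans (Nk (x n - xl) (v n - vl) (w n - wl) (z n - zl)).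
    have := sqr_ge0 `|v n - vl|; have := sqr_ge0 `|w n - wl|; have := sqr_ge0 `|z n - zl|.
    by lra.
  by rewrite -(mulr0 k); apply: cvgM => //; exact: cvg_cst.
rewrite -(add0r xl) (_ : x = (fun n => x n - xl + xl)); last by apply/funext => n; rewrite subrK.
by apply: cvgD => //; exact: cvg_cst.
Unshelve. all: by end_near.
Qed.

End PrimalDualConvergence.

(** * The extrapolated model *)

Section Euclidean.
Context {R : realType} {m : nat}.
Implicit Types (u v : euclid R m) (c : 'I_m -> R).

Definition ecol c : euclid R m := (\col_i c i : 'cV[R]_m).

Lemma ecoord_ecol c i : ecoord (ecol c) i = c i.
Proof. by rewrite /ecoord /ecol mxE. Qed.

Lemma ecoordB u v i : ecoord (u - v) i = ecoord u i - ecoord v i.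
Proof. by rewrite /ecoord !mxE. Qed.

Lemma inner_euclid u v : inner u v = \sum_(i < m) ecoord u i * ecoord v i.
Proof. by []. Qed.

Lemma norm_euclid u : `|u| ^+ 2 = \sum_(i < m) ecoord u i ^+ 2.
Proof. by rewrite -inner_norm inner_euclid; under eq_bigr do rewrite -expr2. Qed.

Lemma ecoord_le_norm u i : `|ecoord u i| <= `|u|.
Proof.
rewrite -(ler_pXn2r (ltn0Sn 1)) ?nnegrE // norm_euclid (bigD1 i) //=.
by rewrite real_normK ?num_real // lerDl; apply: sumr_ge0 => j _; exact: sqr_ge0.
Qed.

(** The crude constant [m] replaces the square root of [m], by [m <= m ^ 2]. *)
Lemma norm_euclid_le u (e : R) : 0 <= e -> (forall i, `|ecoord u i| <= e) ->
  `|u| <= m%:R * e.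
Proof.
move=> e0 ue; rewrite -(ler_pXn2r (ltn0Sn 1)) ?nnegrE ?mulr_ge0 // norm_euclid.
apply: (@le_trans _ _ (\sum_(i < m) e ^+ 2)).
  apply: ler_sum => i _; rewrite -real_normK ?num_real //.
  by rewrite ler_pXn2r ?nnegrE.
rewrite sumr_const card_ord exprMn -(mulr_natl (e ^+ 2)) ler_wpM2r ?sqr_ge0 //.
by rewrite -natrX ler_nat; case: (m) => // n; rewrite expnS expn1 leq_pmulr.
Qed.

Lemma ecoord_continuous i : continuous (fun u => ecoord u i).
Proof.
move=> u; apply/(@cvgrPdist_le _ _ _ (nbhs u)) => e e0; apply/nbhs_normP.
exists e => //= v uv; rewrite -ecoordB; apply: (le_trans (ecoord_le_norm _ _)).
exact: ltW.
Qed.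

End Euclidean.

(** * The setting, and smoothness of the extrapolation *)

Section Setting.
Context {R : realType} {X Z Zt W : finHilbertType R} {m : nat}.
Variables (A : {linear X -> euclid R m}) (Psi : Z -> \bar R) (mu : R).
Variables (L : {linear X -> Z}) (Delta : set W) (C : {linear X -> W}).
Variables (B : {linear Z -> Zt}).
Variables (f : euclid R m -> \bar R) (fi : 'I_m -> R -> \bar R).
Variables (fi1 fi2 : 'I_m -> R -> R).

Let D : set X := feasible Delta C.
Let Pi := range_itv A D.
Let Lam := curv_mx A D fi2.
Let ft := extrapolation A D fi fi1 fi2.
Let lip := \big[maxe/-oo%E]_(i < m) sup_curv A D fi2 i.
Let J0 := objective A Psi mu L B f.
Let J := objective A Psi mu L B (EFin \o ft).
Let d := smooth_part A mu L B ft.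
Let lam i := fine (inf_curv A D fi2 i).

Hypothesis data : regularization_data Psi mu L Delta C.
Hypothesis f_G : Gamma0 f.
Hypothesis fE : forall u, f u = (\sum_(i < m) fi i (ecoord u i))%E.
Hypothesis fi_G : forall i, Gamma0 (fi i : R^o -> \bar R).
Hypothesis fi_C2 : forall i, C2_over (Pi i) (fi i) (fi1 i) (fi2 i).
Hypothesis sup_fin : (forall i, sup_curv A D fi2 i < +oo)%E.
Hypothesis inf_ge0 : (forall i, 0 <= inf_curv A D fi2 i)%E.

Lemma feasible_neq0 : D !=set0.
Proof. by have [x [_ Dx]] := domain_neq0 data; exists x. Qed.

Lemma feasible_Pi i x : D x -> Pi i (ecoord (A x) i).
Proof.
move=> Dx; apply/andP; split.
  by apply: ereal_inf_lbound; exists x.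
by apply: ereal_sup_ubound; exists x.
Qed.

Lemma Pi_neq0 i : Pi i !=set0.
Proof.
by have [x Dx] := feasible_neq0; exists (ecoord (A x) i); exact: feasible_Pi.
Qed.

(** [quad_extension] reads its end points off the set [Pi i]; they delimit [Pi i] again, which is
    therefore a closed interval. *)
Lemma Pi_itv i t :
  Pi i t <-> (ereal_inf (EFin @` Pi i) <= t%:E <= ereal_sup (EFin @` Pi i))%E.
Proof.
split=> [Pt|/andP[lt th]].
  by rewrite ereal_inf_lbound ?ereal_sup_ubound //; exists t.
rewrite /Pi /range_itv /=; apply/andP; split.
  by apply: le_trans lt; apply: le_ereal_inf_tmp => _ [s /andP[+ _] <-].
by apply: (le_trans th); apply: ge_ereal_sup => _ [s /andP[_ +] <-].
Qed.

Lemma fi_fin i t : Pi i t -> fi i t = (fine (fi i t))%:E.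
Proof.
by move=> Pt; have [E [_ PE _ Ed _]] := fi_C2 i; have [/fineK] := Ed _ (PE _ Pt).
Qed.

Let e i := ext_val (Pi i) (fine \o fi i) (fi1 i) (fi2 i).
Let e1 i := ext_der (Pi i) (fi1 i) (fi2 i).
Let e2 i := ext_der2 (Pi i) (fi2 i).

Lemma e_der i t : has_der (e i) t (e1 i t).
Proof.
have [E [_ PE _ Ed Ec]] := fi_C2 i.
by apply: (@ext_val_has_der R _ E) => //; [exact: Pi_neq0 | exact: Pi_itv | move=> s /Ed[]].
Qed.

Lemma e1_der i t : has_der (e1 i) t (e2 i t).
Proof.
have [E [_ PE _ Ed Ec]] := fi_C2 i.
by apply: (@ext_der_has_der R _ E) => //; [exact: Pi_neq0 | exact: Pi_itv | move=> s /Ed[]].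
Qed.

Lemma e2_continuous i : continuous (e2 i).
Proof.
have [E [_ PE _ Ed Ec]] := fi_C2 i.
by apply: (@ext_der2_continuous R _ E) => //; [exact: Pi_neq0 | exact: Pi_itv].
Qed.

Lemma lip_ge i : (sup_curv A D fi2 i <= lip)%E.
Proof. by rewrite /lip (bigD1 i) //= le_max lexx. Qed.

Lemma lip_lty : (lip < +oo)%E.
Proof. by rewrite /lip; elim/big_ind: _ => [|x y hx hy|i _] //; rewrite ?ltNyr // gt_max hx. Qed.

(** [e2 i t] is the second derivative at a point of [Pi i]; its existence also makes both bounds
    finite, so that [fine] is faithful. *)
Lemma e2_bound i t : lam i <= e2 i t <= fine lip.
Proof.
have Pt : Pi i (nearest (Pi i) t).
  by apply: nearest_in; [exact: Pi_neq0 | exact: Pi_itv].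
have h1 : (inf_curv A D fi2 i <= (e2 i t)%:E)%E.
  by apply: ereal_inf_lbound; exists (nearest (Pi i) t).
have h2 : ((e2 i t)%:E <= lip)%E.
  apply: le_trans (lip_ge i).
  by apply: ereal_sup_ubound; exists (nearest (Pi i) t).
have [r rE] := ereal_real (lt_le_trans (ltNyr 0) (inf_ge0 i)) (le_lt_trans h1 (ltry _)).
have [s sE] := ereal_real (lt_le_trans (ltNyr _) h2) lip_lty.
by move: h1 h2; rewrite /lam rE sE !lee_fin => -> ->.
Qed.

Lemma lam_ge0 i : 0 <= lam i.
Proof. by rewrite fine_ge0. Qed.

Lemma extrapolationE u : ft u = \sum_(i < m) e i (ecoord u i).
Proof.
apply: eq_bigr => i _; exact: quad_extensionE.
Qed.

Definition gft (u : euclid R m) : euclid R m := ecol (fun i => e1 i (ecoord u i)).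

(** Sums the scalar Taylor bounds, keeping the curvature [lam i] of each coordinate for the
    comparison with [mu * |B (L x)|^2]. *)
Lemma ft_lower u v : ft u + inner (gft u) (v - u) +
  2^-1 * (\sum_(i < m) lam i * ecoord (v - u) i ^+ 2) <= ft v.
Proof.
rewrite !extrapolationE inner_euclid mulr_sumr -!big_split /=; apply: ler_sum => i _.
rewrite ecoord_ecol !ecoordB.
have := taylor_lower (e_der i) (e1_der i) (e2_bound i) (ecoord u i) (ecoord v i).
by lra.
Qed.

Lemma ft_upper u v : ft v <= ft u + inner (gft u) (v - u) +
  fine lip / 2 * `|v - u| ^+ 2.
Proof.
rewrite !extrapolationE inner_euclid norm_euclid mulr_sumr -!big_split /=; apply: ler_sum => i _.
rewrite ecoord_ecol !ecoordB.
exact: taylor_upper (e_der i) (e1_der i) (e2_bound i) (ecoord u i) (ecoord v i).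
Qed.

Lemma ft_convex_ineq u v : ft u + inner (gft u) (v - u) <= ft v.
Proof.
apply: le_trans (ft_lower u v); rewrite lerDl mulr_ge0 ?invr_ge0 //.
by apply: sumr_ge0 => i _; rewrite mulr_ge0 ?lam_ge0 ?sqr_ge0.
Qed.

Lemma ft_grad u : differentiable (ft : euclid R m -> R^o) u /\ grad ft u = gft u.
Proof.
apply: (@has_grad_quad _ _ _ _ _ (fine lip / 2)) => v.
have := ft_convex_ineq u v; have := ft_upper u v => h1 h2.
by rewrite ler_norml; apply/andP; split; lra.
Qed.

Lemma grad_ftE : grad ft = gft.
Proof. by apply/funext => u; have [] := ft_grad u. Qed.

Lemma gft_lipschitz u v : 0 <= fine lip -> `|gft u - gft v| <= fine lip * `|u - v|.
Proof.
move=> lip0; rewrite -(ler_pXn2r (ltn0Sn 1)) ?nnegrE ?mulr_ge0 //.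
rewrite exprMn !norm_euclid mulr_sumr; apply: ler_sum => i _.
rewrite !ecoordB !ecoord_ecol -exprMn.
(* The claim is symmetric in [u] and [v], while [der_incr] takes ordered arguments. *)
wlog uv : u v / ecoord v i <= ecoord u i => [h|].
  have [|/ltW] := leP (ecoord v i) (ecoord u i); first exact: h.
  by move/h; rewrite -sqrrN opprB -[leRHS]sqrrN -mulrN opprB.
have /andP[h1 h2] := der_incr (e1_der i) (e2_bound i) uv.
rewrite ler_pXn2r ?nnegrE //; last by rewrite mulr_ge0 ?subr_ge0.
by apply: le_trans h1; rewrite mulr_ge0 ?lam_ge0 ?subr_ge0.
Qed.

(** The Hessian, diagonal since [ft] is separable. *)
Definition hft (u h : euclid R m) : euclid R m :=
  ecol (fun i => e2 i (ecoord u i) * ecoord h i).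

Lemma gft_diff u : differentiable gft u /\ 'd gft u = hft u :> (_ -> _).
Proof.
have lD : linear (hft u).
  move=> a x y; apply/matrixP => i j; rewrite /hft /ecol /ecoord !mxE; ring.
pose DL : {linear euclid R m -> euclid R m} :=
  HB.pack (hft u) (GRing.isLinear.Build R _ _ _ (hft u) lD).
have cD := @linear_hilbert_continuous R (euclid R m) (euclid R m) DL.
apply: has_diffP => // eps eps0.
(* The factor [1 / (1 + m)] leaves room for the constant [m] of [norm_euclid_le]. *)
pose ok i h := `|e1 i (ecoord u i + ecoord h i) - e1 i (ecoord u i) -
  e2 i (ecoord u i) * ecoord h i| <= eps / (1 + m%:R) * `|ecoord h i|.
have near_i i : \forall h \near (0 : euclid R m), ok i h.
  have h1 := @e1_der i (ecoord u i) (eps / (1 + m%:R))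
    (divr_gt0 eps0 (ltr_pwDl ltr01 (ler0n _ _))).
  have := @ecoord_continuous R m i 0.
  by rewrite /continuous_at {2}/ecoord mxE => /(_ _ h1).
have all_i := filter_forall (nbhs_filter _) near_i.
near=> h.
apply: (@le_trans _ _ (m%:R * (eps / (1 + m%:R) * `|h|))); last first.
  rewrite mulrA ler_wpM2r // mulrCA ler_piMr ?(ltW eps0) //.
  by rewrite ler_pdivrMr ?ltr_pwDl // mul1r lerDr.
apply: norm_euclid_le => [|i].
  by rewrite mulr_ge0 // divr_ge0 // ltW.
apply: (@le_trans _ _ (eps / (1 + m%:R) * `|ecoord h i|)); last first.
  by rewrite ler_wpM2l ?ecoord_le_norm // divr_ge0 // ltW.
rewrite !ecoordB !ecoord_ecol.
have -> : ecoord (u + h) i = ecoord u i + ecoord h i by rewrite /ecoord mxE.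
by move: i; near: h.
Unshelve. all: by end_near.
Qed.

Lemma ft_twice_cont_diff : twice_cont_diff ft.
Proof.
split.
- by move=> u; have [] := ft_grad u.
- by move=> u; rewrite grad_ftE; have [] := gft_diff u.
rewrite grad_ftE => h u.
have -> : (fun x => 'd gft x h) = hft^~ h.
  by apply/funext => x; have [_ ->] := gft_diff x.
apply/(@cvgrPdist_le _ _ _ (nbhs u)) => eps eps0.
(* [k] absorbs the constant [m] and the factor [|h|], and is positive even if they vanish. *)
pose k := (1 + m%:R) * (1 + `|h|).
have k0 : 0 < k by rewrite mulr_gt0 // ltr_pwDl.
pose ok i v := `|e2 i (ecoord u i) - e2 i (ecoord v i)| <= eps / k.
have near_i i : \forall v \near u, ok i v.
  have := continuous_comp (@ecoord_continuous R m i u) (@e2_continuous i (ecoord u i)).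
  by move=> /(@cvgrPdist_le _ _ _ (nbhs u)) /(_ (eps / k)); apply; rewrite divr_gt0.
have all_i := filter_forall (nbhs_filter _) near_i.
near=> v.
apply: (@le_trans _ _ (m%:R * (eps / k * `|h|))); last first.
  have -> : m%:R * (eps / k * `|h|) = eps * (m%:R * `|h| / k) by ring.
  rewrite ler_piMr ?(ltW eps0) // ler_pdivrMr // mul1r /k.
  by have := ler0n R m; have := normr_ge0 h; nra.
apply: norm_euclid_le => [|i].
  by rewrite mulr_ge0 // divr_ge0 // ltW.
rewrite ecoordB !ecoord_ecol -mulrBl normrM ler_pM ?ecoord_le_norm //.
by move: i; near: v.
Unshelve. all: by end_near.
Qed.

(** Without coordinates the maximum is [-oo], and its [fine] is 0. *)
Lemma lip_ge0 : 0 <= fine lip.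
Proof.
case: (pickP (xpredT : pred 'I_m)) => [i _|noi].
  by have /andP[h1 h2] := e2_bound i 0; apply: le_trans h2; apply: le_trans h1; exact: lam_ge0.
by rewrite /lip big_pred0.
Qed.

Lemma grad_ft_lipschitz : (fine lip).-lipschitz (grad ft).
Proof.
move=> [u v] _; rewrite grad_ftE; exact: gft_lipschitz lip_ge0.
Qed.

Lemma ft_eq_f u : (forall i, Pi i (ecoord u i)) -> f u = (ft u)%:E.
Proof.
move=> uP; rewrite fE extrapolationE -sumEFin; apply: eq_bigr => i _.
rewrite {1}(fi_fin (uP i)) /e ext_val_id //; exact: Pi_itv.
Qed.

Lemma objective_extrapolation x : D x -> J x = J0 x.
Proof.
by move=> Dx; rewrite /J /J0 /objective /= ft_eq_f // => i; exact: feasible_Pi.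
Qed.

Lemma sol_eq : argmin_on D J = argmin_on D J0.
Proof.
apply/seteqP; split => x [Dx xmin]; split => // y Dy; have := xmin y Dy;
  by rewrite !objective_extrapolation.
Qed.

Lemma ft_supported : supported ft.
Proof. by move=> u; exists (gft u) => v; exact: ft_convex_ineq. Qed.

Lemma ft_Gamma0 : Gamma0 (EFin \o ft).
Proof.
have -> : EFin \o ft = (fun u => 0 + (ft u)%:E)%E by apply/funext => u; rewrite add0e.
apply: (@Gamma0_addr _ _ (fun=> 0%E)); last exact: ft_supported.
split => //; first by exists 0; rewrite /edom /= ltry.
  by move=> x a a0; exists setT => //; exact: filterT.
by move=> x y t t01; rewrite !mule0 adde0.
Qed.

Lemma R_is_cLiGME_SCF : cLiGME_SCF Psi mu L Delta C ft.
Proof.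
split => //; first exact: ft_Gamma0.
  by move=> u; have [] := ft_grad u.
by exists (fine lip); exact: grad_ft_lipschitz.
Qed.

(** * The smooth part of the objective and its gradient *)

Lemma LBBLE x y : inner (LBBL L B x) y = inner (B (L x)) (B (L y)).
Proof. by rewrite /LBBL !adjP. Qed.

Lemma AMAE x y : inner (AMA A Lam x) y =
  \sum_(i < m) lam i * ecoord (A x) i * ecoord (A y) i.
Proof.
rewrite /AMA adjP inner_euclid; apply: eq_bigr => i _.
by rewrite /Lam /curv_mx mul_diag_mx /ecoord !mxE.
Qed.

Definition gd (x : X) : X := adj A (gft (A x)) - mu *: LBBL L B x.

Lemma inner_gd x y :
  inner (gd x) y = inner (gft (A x)) (A y) - mu * inner (B (L x)) (B (L y)).
Proof. by rewrite /gd innerDl innerNl innerZl adjP LBBLE. Qed.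

Lemma smooth_part_expand x y : d y - d x - inner (gd x) (y - x) =
  (ft (A y) - ft (A x) - inner (gft (A x)) (A (y - x)))
  - mu / 2 * `|B (L (y - x))| ^+ 2.
Proof.
rewrite inner_gd /d /smooth_part.
have -> : B (L y) = B (L x) + B (L (y - x)) by rewrite !linearB addrC subrK.
by rewrite normDsqr; lra.
Qed.

Lemma smooth_part_quad : exists c, forall x y,
  `|d y - d x - inner (gd x) (y - x)| <= c * `|y - x| ^+ 2.
Proof.
have [a a0 aP] := linear_le_norm A.
have [b b0 bP] := linear_le_norm B; have [l l0 lP] := linear_le_norm L.
have mu0 := mu_gt0 data.
exists (fine lip / 2 * a ^+ 2 + mu / 2 * (b * l) ^+ 2) => x y.
rewrite smooth_part_expand.
have h1 := ft_convex_ineq (A x) (A y); have h2 := ft_upper (A x) (A y).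
rewrite -linearB in h1 h2.
have hA : fine lip / 2 * `|A (y - x)| ^+ 2 <= fine lip / 2 * (a ^+ 2 * `|y - x| ^+ 2).
  rewrite ler_wpM2l ?divr_ge0 ?lip_ge0 // -exprMn ler_pXn2r ?nnegrE ?mulr_ge0 ?(ltW a0) //.
have hB : mu / 2 * `|B (L (y - x))| ^+ 2 <= mu / 2 * ((b * l) ^+ 2 * `|y - x| ^+ 2).
  rewrite ler_wpM2l ?divr_ge0 ?(ltW mu0) // -exprMn.
  rewrite ler_pXn2r ?nnegrE ?mulr_ge0 ?(ltW b0) ?(ltW l0) //.
  by apply: (le_trans (bP _)); rewrite -mulrA ler_wpM2l ?(ltW b0).
have hB0 : 0 <= mu / 2 * `|B (L (y - x))| ^+ 2.
  by rewrite mulr_ge0 ?sqr_ge0 // divr_ge0 // ltW.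
have hA0 : 0 <= fine lip / 2 * (a ^+ 2 * `|y - x| ^+ 2).
  by rewrite mulr_ge0 ?divr_ge0 ?lip_ge0 // mulr_ge0 ?sqr_ge0.
by rewrite ler_norml; apply/andP; split; lra.
Qed.

Lemma smooth_part_grad x : differentiable (d : X -> R^o) x /\ grad d x = gd x.
Proof. by have [c cP] := smooth_part_quad; exact: has_grad_quad (cP x). Qed.

Lemma grad_smooth_partE : grad d = gd.
Proof. by apply/funext => x; have [] := smooth_part_grad x. Qed.

(** The concave part [- mu / 2 * |B (L x)|^2] of the enhancement moves into [d], which leaves [Psi]
    as the only nonsmooth term. *)
Lemma objectiveE x :
  J x = (mu%:E * Psi (L x) + (d x + mu * gm_conj Psi B (L x))%:E)%E.
Proof.
have mu0 := mu_gt0 data; have PG := Psi_Gamma0 data.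
rewrite /J /objective /= gmeE //; last exact: Psi_coercive data.
rewrite /d /smooth_part.
case: (Psi (L x)) (Gamma0_gtNy PG (L x)) => [r| |] // _.
  by rewrite -!EFinD -?EFinM -?EFinD; congr (_%:E); lra.
by rewrite addye // !gt0_muley ?lte_fin // addye // addey.
Qed.

(** * Consequences of the curvature condition *)

Section Curvature.
Hypothesis curv : psd (fun x => AMA A Lam x - mu *: LBBL L B x).

Lemma curvE x : mu * `|B (L x)| ^+ 2 <= \sum_(i < m) lam i * ecoord (A x) i ^+ 2.
Proof.
have := curv x; rewrite innerDl innerNl innerZl AMAE LBBLE inner_norm subr_ge0.
by under eq_bigr do rewrite -mulrA -expr2.
Qed.

(** By [curvE] the curvature kept in [ft_lower] outweighs the quadratic subtracted in [d]. *)
Lemma smooth_part_convex x y : d x + inner (gd x) (y - x) <= d y.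
Proof.
rewrite -subr_ge0 (_ : _ - _ = d y - d x - inner (gd x) (y - x)); last by ring.
rewrite smooth_part_expand; have := ft_lower (A x) (A y); rewrite -linearB.
by have := curvE (y - x); lra.
Qed.

Lemma smooth_part_supported : supported d.
Proof. by move=> x; exists (gd x) => y; exact: smooth_part_convex. Qed.

Lemma ftA_strongly_convex :
  strongly_convex_rel mu (quad_form (LBBL L B)) (ft \o A).
Proof.
move=> t x y _ _.
have E z : (ft \o A) z - mu * quad_form (LBBL L B) z = d z.
  by rewrite /quad_form LBBLE inner_norm /d /smooth_part /=; lra.
rewrite !E; have := @supported_conv _ _ d x y t%:num smooth_part_supported.
by apply; apply/andP; split; [exact: ge0 | exact: le1].
Qed.

Lemma objective_smooth_supported : supported (fun x => d x + mu * gm_conj Psi B (L x)).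
Proof.
have mu0 := mu_gt0 data.
apply: supportedD; first exact: smooth_part_supported.
apply: (@supported_comp _ _ _ L (fun z => mu * gm_conj Psi B z)) => z.
have [g gP] := @gm_conj_supported _ _ _ Psi B (Psi_Gamma0 data) (Psi_coercive data) z.
exists (mu *: g) => y; rewrite innerZl -mulrDr ler_wpM2l //; exact: ltW.
Qed.

Lemma objective_Gamma0 : Gamma0 J.
Proof.
have -> : J = (fun x => mu%:E * Psi (L x) + (d x + mu * gm_conj Psi B (L x))%:E)%E.
  by apply/funext => x; exact: objectiveE.
apply: Gamma0_addr objective_smooth_supported.
apply: Gamma0_scale_comp; [exact: Psi_Gamma0 data | exact: mu_gt0 data|].
by have [x [xd _]] := domain_neq0 data; exists x.
Qed.

Lemma quadratic_unbounded (k0 k1 k2 c : R) : 0 < k2 ->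
  exists2 t, 0 <= t & c < k0 + k1 * t + k2 * t ^+ 2.
Proof.
move=> k2p; pose t := 1 + (`|c - k0| + `|k1| + 1) / k2.
have tk : k2 * (t - 1) = `|c - k0| + `|k1| + 1.
  by rewrite /t addrAC subrr add0r mulrC divfK // gt_eqF.
have t1 : 1 <= t by rewrite lerDl divr_ge0 ?(ltW k2p) // addr_ge0 // addr_ge0.
exists t; first by apply: le_trans t1.
have := ler_norm (c - k0); have := ler_norm (- k1); rewrite normrN.
have := normr_ge0 (c - k0); have := normr_ge0 k1.
move: tk t1; set a := `|_|; set b := `|_|; nra.
Qed.

Lemma objective_ge x : (forall i, Pi i (ecoord (A x) i)) -> (f (A x) <= J x)%E.
Proof.
move=> xP; rewrite /J /objective /= (ft_eq_f xP) leeDl // mule_ge0 //.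
  by rewrite lee_fin ltW // (mu_gt0 data).
by apply: gme_ge0; [exact: Psi_Gamma0 data | exact: Psi_coercive data].
Qed.

Lemma objective_shift x n : A n = 0 -> L n = 0 -> J (x + n) = J x.
Proof. by move=> An Ln; rewrite /J /objective /= !linearD An Ln !addr0. Qed.

(** * Rays along which the objective stays bounded *)

Section Ray.
Variables (x0 h : X) (c : R).
Hypothesis ray_Pi : forall t, 0 <= t -> forall i, Pi i (ecoord (A (x0 + t *: h)) i).
Hypothesis ray_le : forall t, 0 <= t -> (J (x0 + t *: h)%R <= c%:E)%E.

(** [f (A x)] is at most [c] along the ray, whereas [A h <> 0] would carry [A x] out of the ball of
    radius [r]. *)
Lemma ray_A : coercive f -> A h = 0.
Proof.
move=> cf; have [r rP] := cf c.
apply/eqP/negPn/negP => Ah0; have Ah : 0 < `|A h| by rewrite normr_gt0.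
pose t := (`|r| + `|A x0| + 1) / `|A h|.
have tA : t * `|A h| = `|r| + `|A x0| + 1 by rewrite divfK // gt_eqF.
have t0 : 0 <= t by rewrite divr_ge0 // addr_ge0 // addr_ge0.
have : (c%:E < f (A (x0 + t *: h)%R))%E.
  apply: rP; rewrite linearD linearZ /=.
  have := ler_normB (A x0 + t *: A h) (A x0).
  rewrite addrAC subrr add0r normrZ (ger0_norm t0) tA.
  by have := ler_norm r; lra.
by rewrite ltNge (le_trans (objective_ge (ray_Pi t0)) (ray_le t0)).
Qed.

(** Otherwise [curvE] gives a coordinate with [lam i > 0] moved by [A h], whose term in [ft] grows
    quadratically. *)
Lemma ray_BL : bounded_below f -> B (L h) = 0.
Proof.
move=> [M MP]; apply/eqP/negPn/negP => BL0.
have BLp : 0 < mu * `|B (L h)| ^+ 2.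
  by rewrite mulr_gt0 ?(mu_gt0 data) // exprn_gt0 // normr_gt0.
have [i ip] : exists i, 0 < lam i * ecoord (A h) i ^+ 2.
  apply: contrapT => none.
  have := lt_le_trans BLp (curvE h); rewrite ltNge => /negP; apply.
  by apply: sumr_le0 => i _; rewrite leNgt; apply/negP => ip; apply: none; exists i.
pose a := ecoord (A x0) i; pose s := ecoord (A h) i.
have k2 : 0 < lam i / 2 * s ^+ 2 by rewrite mulrAC divr_gt0.
have [t t0] := quadratic_unbounded M (e1 i a * s) c k2.
have tP := ray_Pi t0; rewrite ltNge => /negP; apply.
pose u := A (x0 + t *: h).
(* Freezing coordinate [i] at its value for [t = 0] stays in the product of the [Pi j], so the lower
   bound [M] of [f] controls the sum of the other terms. *)
pose u' := ecol (fun j => if j == i then a else ecoord u j) : euclid R m.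
have uP j : Pi j (ecoord u' j).
  rewrite ecoord_ecol; case: eqP => [->|_]; last exact: tP.
  by have := @ray_Pi 0 (lexx _) i; rewrite scale0r addr0.
have ui : ecoord u i = a + t * s.
  by rewrite /u linearD linearZ /a /s /ecoord !mxE.
have h1 : M <= ft u' by rewrite -lee_fin -(ft_eq_f uP).
have h2 : ft u <= c.
  by rewrite -lee_fin -(ft_eq_f tP); exact: le_trans (objective_ge tP) (ray_le t0).
have h3 : ft u' = e i a + \sum_(j < m | j != i) e j (ecoord u j).
  rewrite extrapolationE (bigD1 i) //= ecoord_ecol eqxx; congr (_ + _).
  by apply: eq_bigr => j ji; rewrite ecoord_ecol (negbTE ji).
have h4 : ft u = e i (a + t * s) + \sum_(j < m | j != i) e j (ecoord u j).
  by rewrite extrapolationE (bigD1 i) //= ui.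
have := taylor_lower (e_der i) (e1_der i) (e2_bound i) a (a + t * s).
move: h1 h2; rewrite h3 h4; set S := \sum_(j < m | _) _.
by rewrite (addrC a) addrK; lra.
Qed.

(** As [B (L h) = 0], the correction [G] of [Psi] is constant along the ray; since [f] is bounded
    below by [M], [Psi] stays bounded above there, and coercivity forces [L h = 0]. *)
Lemma ray_L : bounded_below f -> L h = 0.
Proof.
move=> bf; have BL := ray_BL bf; have [M MP] := bf.
apply/eqP/negPn/negP => Lh0; have Lh : 0 < `|L h| by rewrite normr_gt0.
have mu0 := mu_gt0 data.
pose G := gm_conj Psi B (L x0) - 2^-1 * `|B (L x0)| ^+ 2.
have [r rP] := Psi_coercive data ((c - M) / mu - G).
pose t := (`|r| + `|L x0| + 1) / `|L h|.
have tL : t * `|L h| = `|r| + `|L x0| + 1 by rewrite divfK // gt_eqF.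
have t0 : 0 <= t by rewrite divr_ge0 // addr_ge0 // addr_ge0.
have : (((c - M) / mu - G)%:E < Psi (L (x0 + t *: h)%R))%E.
  apply: rP; rewrite linearD linearZ /=.
  have := ler_normB (L x0 + t *: L h) (L x0).
  rewrite addrAC subrr add0r normrZ (ger0_norm t0) tL.
  by have := ler_norm r; lra.
have BtL : B (t *: L h) = 0 by rewrite linearZ /= BL scaler0.
have := ray_le t0; have := MP (A (x0 + t *: h)); rewrite (ft_eq_f (ray_Pi t0)) lee_fin.
rewrite /J /objective /= gmeE; [|exact: Psi_Gamma0 data|exact: Psi_coercive data].
have -> : L (x0 + t *: h) = L x0 + t *: L h by rewrite linearD linearZ.
rewrite gm_conj_ker //; [|exact: Psi_Gamma0 data|exact: Psi_coercive data].
rewrite [B (_ + _)]linearD BtL addr0 -/G.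
case: (Psi _) => [b| |] //; last by rewrite addye // gt0_muley ?lte_fin // addey.
rewrite -!EFinD -?EFinM -?EFinD lee_fin lte_fin => h1 h2 h3.
have h4 : (c - M) / mu * mu = c - M by rewrite divfK // gt_eqF.
have : ((c - M) / mu - G) * mu < b * mu by rewrite ltr_pM2r.
by move: h1 h2 h4; set q := (c - M) / mu; lra.
Qed.

End Ray.

(** * Existence of minimizers for the model *)

Lemma feasible_closed : closed D.
Proof.
apply: (@preimage_closed _ _ C Delta); last exact: Delta_closed data.
by move=> x _; exact: linear_hilbert_continuous.
Qed.

Lemma feasible_convex : convex_set D.
Proof.
apply/convex_setP => x y t t01 Dx Dy; rewrite /D /feasible /preimage /= linearD !linearZ.
by apply: (convex_setP Delta).1 => //; exact: Delta_convex data.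
Qed.

Lemma objective_lty x : edom (Psi \o L) x -> (J x < +oo)%E.
Proof.
move=> xd; rewrite objectiveE.
have [r ->] := ereal_real (Gamma0_gtNy (Psi_Gamma0 data) (L x)) xd.
by rewrite -EFinM -EFinD ltry.
Qed.

Lemma sol_neq0_bounded : bounded_set D -> argmin_on D J !=set0.
Proof.
move=> [M [_ DM]]; have [x0 [_ Dx0]] := domain_neq0 data.
have MD x : D x -> `|x| <= M + 1 by apply: (DM (M + 1)); rewrite ltrDl.
have [x [Dx xmin]] := @bounded_sublevel_argmin _ _ J D x0 (M + 1)
  (Gamma0_lsc objective_Gamma0) feasible_closed Dx0 (fun x Dx _ => MD x Dx).
by exists x.
Qed.

Lemma sol_neq0_no_ray :
  (forall x0 h c, (forall t, 0 <= t -> forall i, Pi i (ecoord (A (x0 + t *: h)) i)) ->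
    (forall t, 0 <= t -> (J (x0 + t *: h)%R <= c%:E)%E) -> h = 0) ->
  argmin_on D J !=set0.
Proof.
move=> noray; have [x0 [dx0 Dx0]] := domain_neq0 data.
have JN := Gamma0_gtNy objective_Gamma0.
have [c cE] := ereal_real (JN x0) (objective_lty dx0).
have [|x [Dx xmin]] :=
    argmin_no_ray objective_Gamma0 feasible_closed feasible_convex Dx0 (objective_lty dx0).
  move=> h hP; apply: (noray x0 h c) => t t0; have [Dt Jt] := hP t t0.
    by move=> i; exact: feasible_Pi.
  by rewrite -cE.
by exists x.
Qed.

(* [J] does not vary along [N], and no ray of [(D + N) :&: N^perp] stays in a
   sublevel set of [J]. *)
Lemma sol_neq0_multipolyhedral : coercive f -> asymptotically_multipolyhedral D ->
  argmin_on D J !=set0.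
Proof.
move=> cf mD; have JN := Gamma0_gtNy objective_Gamma0.
pose N := [set n | A n = 0 /\ L n = 0].
have N0 : N 0 by split; rewrite linear0.
have ND x y : N x -> N y -> N (x + y).
  by move=> [A1 L1] [A2 L2]; split; rewrite linearD ?A1 ?A2 ?L1 ?L2 addr0.
have NZ (a : R) x : N x -> N (a *: x).
  by move=> [A1 L1]; split; rewrite linearZ /= ?A1 ?L1 scaler0.
have cN : closed N.
  apply: closed_seqP => u l uN ul; split.
    have cl : A (u n) @[n --> \oo] --> A l.
      by apply: cvg_comp ul _; exact: linear_hilbert_continuous.
    have := norm_hausdorff; move=> /(_ R (euclid R m))/(cvg_unique)/(_ _ _ _ _ cl); apply.
    rewrite (_ : (fun _ => _) = fun=> 0); first exact: cvg_cst.
    by apply/funext => n; have [] := uN n.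
  have cl : L (u n) @[n --> \oo] --> L l.
    by apply: cvg_comp ul _; exact: linear_hilbert_continuous.
  have := norm_hausdorff; move=> /(_ R Z)/(cvg_unique)/(_ _ _ _ _ cl); apply.
  rewrite (_ : (fun _ => _) = fun=> 0); first exact: cvg_cst.
  by apply/funext => n; have [] := uN n.
pose D' := [set x | exists2 n, N n & D (x + n)].
have cD' : closed D' by apply: multipolyhedral_add_subspace => //; exact: feasible_neq0.
pose E := D' `&` [set x | forall n, N n -> inner x n = 0].
have cE : closed E.
  apply: closedI => //; apply: closed_seqP => u l uP ul n Nn.
  have cl : inner (u k) n @[k --> \oo] --> inner l n by apply: cvg_inner => //; exact: cvg_cst.
  have := norm_hausdorff; move=> /(_ R R^o)/(cvg_unique)/(_ _ _ _ _ cl); apply.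
  rewrite (_ : (fun _ => _) = fun=> 0); first exact: cvg_cst.
  by apply/funext => k; exact: uP.
have kE : convex_set E.
  apply/convex_setP => x y t t01 [[n1 Nn1 Dx] xN] [[n2 Nn2 Dy] yN]; split; last first.
    by move=> n Nn; rewrite innerDl !innerZl xN // yN // !mulr0 addr0.
  exists (t *: n1 + (1 - t) *: n2); first by apply: ND; apply: NZ.
  by rewrite addrACA -!scalerDr; apply: (convex_setP D).1 => //; exact: feasible_convex.
have proj x : exists2 q, forall n, N n -> inner q n = 0 & exists2 n, N n & x = q + n.
  have [Np pP] := orth_projection cN N0 ND NZ x.
  by exists (x - metric_proj N x) => //; exists (metric_proj N x) => //; rewrite subrK.
have DE x : D x -> exists2 q, E q & J q = J x.
  move=> Dx; have [q qN [n Nn xE]] := proj x.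
  exists q; first by split => //; exists n => //; rewrite -xE.
  by rewrite xE; have [An Ln] := Nn; rewrite objective_shift.
have [x0 [dx0 Dx0]] := domain_neq0 data.
have [q0 Eq0 Jq0] := DE x0 Dx0.
have Jq0y : (J q0 < +oo)%E by rewrite Jq0; exact: objective_lty.
have [c cE'] := ereal_real (JN q0) Jq0y.
have [h hP|q [Eq qmin]] := argmin_no_ray objective_Gamma0 cE kE Eq0 Jq0y.
  have hPi t : 0 <= t -> forall i, Pi i (ecoord (A (q0 + t *: h)) i).
    move=> /hP[[[n [An _] Dn] _] _] i; have := feasible_Pi i Dn.
    by rewrite linearD An addr0.
  have hJ t : 0 <= t -> (J (q0 + t *: h)%R <= c%:E)%E.
    by move=> /hP[_]; rewrite -cE'.
  have Nh : N h.
    split; first exact: ray_A hPi hJ cf.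
    by apply: ray_L hPi hJ _; exact: coercive_bounded_below.
  (* [h] lies in [N], and both [q0] and [q0 + h] are orthogonal to [N]; so [h] is orthogonal to
     itself. *)
  have [_ /(_ h Nh) q0h] := Eq0; have [[_ orth] _] := hP 1 ler01.
  have := orth h Nh; rewrite scale1r innerDl q0h add0r inner_norm => /eqP.
  by rewrite sqrf_eq0 normr_eq0 => /eqP.
have [[n [An Ln] Dn] _] := Eq.
exists (q + n); split => // y Dy; rewrite objective_shift //.
by have [q' Eq' <-] := DE y Dy; exact: qmin.
Qed.

Lemma sol_neq0 :
  [\/ coercive f /\ asymptotically_multipolyhedral D,
      coercive f /\ [set x | A x = 0] `&` [set x | L x = 0] = [set 0],
      bounded_below f /\ [set x | L x = 0] = [set 0] |
      bounded_set D] -> argmin_on D J !=set0.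
Proof.
case=> [[cf mD]|[cf nul]|[bf nul]|bD].
- exact: sol_neq0_multipolyhedral.
- apply: sol_neq0_no_ray => x0 h c hPi hJ.
  have : ([set x | A x = 0] `&` [set x | L x = 0]) h.
    split; first exact: ray_A hPi hJ cf.
    by apply: ray_L hPi hJ _; exact: coercive_bounded_below.
  by rewrite nul.
- apply: sol_neq0_no_ray => x0 h c hPi hJ.
  have : [set x | L x = 0] h by exact: ray_L hPi hJ bf.
  by rewrite nul.
- exact: sol_neq0_bounded.
Qed.

(** * Minimizers and the optimality system *)

Section Optimality.
Hypothesis rules : subdiff_rules Psi L Delta C J.

Let Delta_neq0 : Delta !=set0.
Proof. by have [x Dx] := feasible_neq0; exists (C x). Qed.

Let Psi_c := Psi_coercive data.
Let Psi_g := Psi_Gamma0 data.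

(* No sum rule for subdifferentials is needed, as [d] and [gm_conj Psi B \o L] are
   differentiable. *)
Lemma subdiff_objective x a v r : (J x < +oo)%E -> subdiff J x a -> Psi v = r%:E ->
  gm_conj Psi B (L x) = inner (B (L x)) (B v) - r - 2^-1 * `|B v| ^+ 2 ->
  subdiff (Psi \o L) x (mu^-1 *: (a - gd x - mu *: adj L (adj B (B v)))).
Proof.
move=> Jx xa vE GE; have mu0 := mu_gt0 data.
have dom : exists x, (Psi (L x) < +oo)%E by have [y [yd _]] := domain_neq0 data; exists y.
have PN := Gamma0_gtNy Psi_g.
have Px : (Psi (L x) < +oo)%E.
  move: Jx; rewrite objectiveE; case: (Psi (L x)) (PN (L x)) => [b| |] //; rewrite ?ltry //.
  by rewrite gt0_muley ?lte_fin // addye.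
have Jy y : J y = (mu%:E * Psi (L y) + (d y + mu * gm_conj Psi B (L y))%:E)%E.
  exact: objectiveE.
have key : subdiff (fun y => mu%:E * Psi (L y))%E x
    (- (gd x + mu *: adj L (adj B (B v)) - a)).
  (* The Fermat rule for [mu * Psi (L .)], the smooth term being [d + mu * gm_conj (L .)] minus the
     linear form of [a]. *)
  apply: (@fermat_rule _ _ _ (fun y => d y + mu * gm_conj Psi B (L y) - inner a y)).
  - exact: Gamma0_scale_comp.
  - by have [b ->] := ereal_real (PN _) Px; rewrite -EFinM ltry.
  - move=> y; have := xa y; rewrite !Jy; have [b ->] := ereal_real (PN _) Px.
    case: (Psi (L y)) (PN (L y)) => [b'| |] // _; last first.
      by move=> _; rewrite gt0_muley ?lte_fin // addye // leey.
    by rewrite -!EFinM -!EFinD !lee_fin innerDr innerNr; lra.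
  - move=> h; have [c cP] := smooth_part_quad.
    exists (c * `|h| ^+ 2 + mu / 2 * `|B (L h)| ^+ 2) => t _.
    have := cP x (x + t *: h).
    rewrite [x + _]addrC addrK innerZr normrZ exprMn real_normK ?num_real //.
    rewrite ler_norml => /andP[_ d1].
    have := gm_conj_upper Psi_g Psi_c (L (t *: h)) vE GE.
    rewrite -linearD [B (L (t *: h))](_ : _ = t *: B (L h)); last by rewrite !linearZ.
    rewrite innerZr normrZ exprMn real_normK ?num_real // [x + _]addrC.
    move=> /(ler_wpM2l (ltW mu0)) d2.
    rewrite innerDl innerDl innerNl innerZl !adjP innerDr innerZr.
      by move: d1 d2; lra.
have [b Pb] := ereal_real (PN _) Px.
move=> y; have := key y; rewrite /= Pb.
case: (Psi (L y)) (PN (L y)) => [b'| |] // _; last by rewrite leey.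
rewrite -!EFinM -!EFinD !lee_fin !innerZl innerNl => h'.
rewrite -(ler_pM2l mu0) mulrDr mulVKf ?gt_eqF //.
have oppE (g k : X) : a - g - k = - (g + k - a) by rewrite opprB opprD addrA.
by rewrite oppE innerNl.
Qed.

(** The rules split the zero subgradient into [a] and [adj C z0]; [subdiff_objective] and the chain
    rule for [Psi] turn [a] into [w], and [v] is a maximizer in [gm_conj]. *)
Lemma sol_kkt x : argmin_on D J x -> exists v w z, kkt Psi Delta gd L C B mu x v w z.
Proof.
move=> [Dx xmin]; have mu0 := mu_gt0 data.
have [r1 r2 r3] := rules.
have JN := Gamma0_gtNy objective_Gamma0.
have Jx : (J x < +oo)%E.
  have [y [yd Dy]] := domain_neq0 data; apply: le_lt_trans (xmin y Dy) _; exact: objective_lty.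
have : subdiff (fun x => J x + eindic Delta (C x))%E x 0.
  move=> y; rewrite inner0l adde0 /eindic (mem_set (Dx : Delta (C x))) adde0.
  case: ifPn => [/set_mem Dy|_]; first by rewrite adde0; exact: xmin.
  by rewrite addey ?leey // -ltNye.
rewrite r1 => -[a xa [b]]; rewrite r3 => -[z0 z0x zb] ab.
have [v [r [vE GE]]] := gm_conj_attained B Psi_g Psi_c (L x).
have := subdiff_objective Jx xa vE GE; rewrite r2 => -[w wx wE].
(* [kkt] carries a factor [mu] in front of each multiplier; normal cones are invariant under this
   rescaling. *)
exists v, w, (mu^-1 *: z0); split => //.
- move=> h; rewrite innerZl mulVKf ?gt_eqF // -[inner z0 _]adjP zb.
  have := congr1 (fun q => mu * inner q h) wE.
  rewrite adjP innerZl mulVKf ?gt_eqF // => ->.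
  have := congr1 (fun q => inner q h) ab; rewrite innerDl inner0l.
  rewrite (innerDl (a - gd x)) (innerDl a) !innerNl innerZl !adjP; move: (inner (gd x) h).
  by move=> q; lra.
- exact: gm_conj_optimal vE GE.
- have [Cx zP] := subdiff_eindicP Delta_neq0 z0x.
  apply: subdiff_eindic => // y Dy; rewrite innerZl pmulr_rle0 ?invr_gt0 //; exact: zP.
Qed.
End Optimality.

Let Delta_neq0 : Delta !=set0.
Proof. by have [x Dx] := feasible_neq0; exists (C x). Qed.

Let Psi_c := Psi_coercive data.
Let Psi_g := Psi_Gamma0 data.
Let PN := Gamma0_gtNy Psi_g.

(** Adds the convexity inequality of [d], those of [Psi] and of the indicator, and the affine lower
    bound of [gm_conj] given by [v]; stationarity cancels the linear terms. *)
Lemma kkt_sol x v w z : kkt Psi Delta gd L C B mu x v w z -> argmin_on D J x.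
Proof.
move=> [kx kv kw kz]; have mu0 := mu_gt0 data.
have [Dx zP] := subdiff_eindicP Delta_neq0 kz.
split => // y Dy.
have [b bE] := ereal_real (PN _) (subdiff_finite Psi_g kw).
have [r rE] := ereal_real (PN _) (subdiff_finite Psi_g kv).
rewrite !objectiveE bE; have := kw (L y); rewrite bE.
case: (Psi (L y)) (PN (L y)) => [b'| |] // _; last first.
  by move=> _; rewrite gt0_muley ?lte_fin // addye // leey.
rewrite -!EFinM -!EFinD !lee_fin -linearB => h1.
have h2 := smooth_part_convex x y; have h3 := zP (C y) Dy; rewrite -linearB in h3.
have h4 := gm_conj_subdiff Psi_g Psi_c rE kv.
have h5 := gm_conj_ge B Psi_g Psi_c (L y) rE.
have h6 := kx (y - x).
have h7 : inner (B v) (B (L (y - x))) = inner (B (L y)) (B v) - inner (B (L x)) (B v).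
  by rewrite !linearB innerDr innerNr !(innerC (B v)).
move: (ler_wpM2l (ltW mu0) h1) (ler_wpM2l (ltW mu0) h5) (ler_wpM2l (ltW mu0) h3).
move: h2 h6; rewrite h7 h4; lra.
Qed.

Lemma prox_scaled_subdiff (c : R) y : 0 < c ->
  subdiff Psi (prox (fun u => c%:E * Psi u)%E y)
    (c^-1 *: (y - prox (fun u => c%:E * Psi u)%E y)).
Proof.
move=> c0; have [m0 m0P] := coercive_bounded_below Psi_g Psi_c.
have [u0 u0P] := Gamma0_proper Psi_g.
have cG : Gamma0 (fun u => c%:E * Psi u)%E.
  by apply: (@Gamma0_scale_comp _ _ _ idfun) => //; exists u0.
have cm u : ((c * m0)%:E <= c%:E * Psi u)%E.
  by rewrite EFinM lee_pmul2l // lte_fin.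
have := prox_subdiff y cG cm; set p := prox _ y => py u.
have := subdiff_finite cG py; have := py u.
case: (Psi p) (PN p) => [b| |] // _; last by rewrite gt0_muley ?lte_fin.
case: (Psi u) (PN u) => [b'| |] // _; last by rewrite leey.
rewrite -!EFinM -!EFinD !lee_fin innerZl => h _.
by rewrite -(ler_pM2l c0) mulrDr mulVKf ?gt_eqF.
Qed.

(** * Convergence of the algorithm *)

Section Iteration.
Variables (beta sigma tau : R) (x : nat -> X) (v w : nat -> Z) (z : nat -> W).
Hypothesis beta_gt0 : 0 < beta.
Hypothesis d_lip : beta.-lipschitz (grad d).
(** The reciprocal of the step-size parameter [rho]. *)
Let M := Num.max beta (mu * opnorm B ^+ 2).
Hypothesis steps : step_size_cond mu L C B M^-1 sigma tau.
Hypothesis iter : cLiGME_iteration Psi mu L Delta C B d sigma tau x v w z.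

Let M_gt0 : 0 < M. Proof. by rewrite lt_max beta_gt0. Qed.
Let sigma_gt0 : 0 < sigma. Proof. by have [] := steps. Qed.
Let tau_gt : M / 2 < tau.
Proof. by have [_ + _] := steps; rewrite invfM invrK mulrC. Qed.
Let tau_gt0 : 0 < tau. Proof. by apply: lt_trans tau_gt; rewrite divr_gt0. Qed.

Lemma iter_x_weak k h : sigma * inner (x k - x k.+1) h =
  inner (gd (x k)) h + mu * inner (B (v k)) (B (L h)) + mu * inner (w k) (L h)
  + mu * inner (z k) (C h).
Proof.
have [-> _ _ _] := iter k; rewrite grad_smooth_partE !innerE !adjP.
by field; rewrite gt_eqF.
Qed.

Lemma iter_v_incl k : subdiff Psi (v k.+1)
  ((tau / mu) *: (v k - v k.+1) + adj B (B (2 *: L (x k.+1) - L (x k) - v k))).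
Proof.
have mu0 := mu_gt0 data; have [_ vE _ _] := iter k.
have := @prox_scaled_subdiff (mu / tau) ((2 * mu / tau) *: adj B (B (L (x k.+1)))
   - (mu / tau) *: adj B (B (L (x k))) + (v k - (mu / tau) *: adj B (B (v k))))
   (divr_gt0 mu0 tau_gt0).
rewrite -vE; congr (subdiff _ _); apply: inner_inj => h.
rewrite !linearB !linearZ /= !innerE !adjP.
by field; rewrite !gt_eqF.
Qed.

(** Moreau's identity: the argument of the update minus [w k.+1] is its proximal point for [Psi],
    with residual [w k.+1]. *)
Lemma iter_w_incl k : subdiff Psi
  (2 *: L (x k.+1) - L (x k) + w k - w k.+1) (w k.+1).
Proof.
have [m0 m0P] := coercive_bounded_below Psi_g Psi_c; have [_ _ wE _] := iter k.
have := prox_subdiff (2 *: L (x k.+1) - L (x k) + w k) Psi_g m0P.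
rewrite {1}wE {1}wE (prox_conjugate _ Psi_g m0P); set q := 2 *: _ - _ + _.
by rewrite subKr.
Qed.

Lemma iter_z_incl k : subdiff (eindic Delta : W -> \bar R)
  (2 *: C (x k.+1) - C (x k) + z k - z k.+1) (z k.+1).
Proof.
have [_ _ _ zE] := iter k.
have := metric_proj_normal (2 *: C (x k.+1) - C (x k) + z k) (Delta_closed data)
  (Delta_convex data) Delta_neq0.
by rewrite !zE; set q := 2 *: _ - _ + _; rewrite subKr.
Qed.

Lemma iteration_cvg : subdiff_rules Psi L Delta C J -> argmin_on D J !=set0 ->
  exists2 xs, argmin_on D J xs & x @ \oo --> xs.
Proof.
move=> rules [xs xsP]; have mu0 := mu_gt0 data.
pose kappa := opnorm (fun x => adj L (L x) + adj C (C x)).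
pose omega := opnorm (fun x => adj B (B (L x))).
have opB u : mu * `|B u| ^+ 2 <= M * `|u| ^+ 2.
  apply: (@le_trans _ _ (mu * opnorm B ^+ 2 * `|u| ^+ 2)); last first.
    by rewrite ler_wpM2r ?sqr_ge0 // le_max lexx orbT.
  have h := opnorm_le B u; rewrite -mulrA ler_pM2l // -exprMn.
  by rewrite ler_pXn2r ?nnegrE //; exact: le_trans h.
have kP a : `|L a| ^+ 2 + `|C a| ^+ 2 <= kappa * `|a| ^+ 2.
  have h := opnorm_le ((adj L \o L) \+ (adj C \o C)) a.
  have -> : `|L a| ^+ 2 + `|C a| ^+ 2 = inner (adj L (L a) + adj C (C a)) a.
    by rewrite innerDl !adjP !inner_norm.
  apply: le_trans (ler_norm _) _; apply: le_trans (inner_le _ _) _.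
  by rewrite expr2 mulrA ler_wpM2r.
have oP a b : inner (B (L a)) (B b) <= omega * `|a| * `|b|.
  have h := opnorm_le (adj B \o (B \o L)) a.
  rewrite -adjP; apply: le_trans (ler_norm _) _; apply: le_trans (inner_le _ _) _.
  by rewrite ler_wpM2r.
have t'0 : 0 < tau - M / 2 by rewrite subr_gt0.
have s_gt : mu * kappa + M / 2 + mu ^+ 2 * omega ^+ 2 / (tau - M / 2) < sigma.
  have [_ _] := steps; apply: le_lt_trans; rewrite -/kappa -/omega -addrA lerD2l.
  (* With [rho = 1 / M] the fraction splits into the required term and [M / 2] times a ratio that is
     at least 1. *)
  have -> : (2 * M^-1 * mu ^+ 2 * omega ^+ 2 + tau) / (2 * M^-1 * tau - 1) =
      mu ^+ 2 * omega ^+ 2 / (tau - M / 2) + (M / 2) * (tau / (tau - M / 2)).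
    by field; rewrite !gt_eqF //; move: t'0; rewrite -(pmulr_lgt0 _ (ltr0n R 2)) mulrBl divfK //.
  rewrite addrC lerD2l -[leLHS]mulr1 ler_pM2l ?divr_gt0 //.
  rewrite ler_pdivlMr // mul1r gerBl; exact/ltW/divr_gt0.
have gl p q : `|gd p - gd q| <= beta * `|p - q|.
  by have := d_lip (conj I I : (setT `*` setT) (p, q)); rewrite /= grad_smooth_partE.
have [c cP] := smooth_part_quad.
have gc := cocoercive cP beta_gt0 gl smooth_part_convex.
have eG := Gamma0_eindic (Delta_closed data) (Delta_convex data) Delta_neq0.
have kx : exists xs vs ws zs, kkt Psi Delta gd L C B mu xs vs ws zs.
  by exists xs; exact: sol_kkt.
have bM : beta <= M by rewrite le_max lexx.
have [xl [vl [wl [zl [kl xc]]]]] := primal_dual_cvg Psi_g eG mu0 beta_gt0 bM opB kP oP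
  tau_gt s_gt gl gc iter_x_weak iter_v_incl iter_w_incl iter_z_incl kx.
by exists xl => //; exact: kkt_sol kl.
Qed.

End Iteration.

End Curvature.

End Setting.

Theorem corollary1 (R : realType) (X Z Zt W : finHilbertType R) (m : nat)
    (A : {linear X -> euclid R m}) (Psi : Z -> \bar R) (mu : R)
    (L : {linear X -> Z}) (Delta : set W) (C : {linear X -> W})
    (B : {linear Z -> Zt})
    (f : euclid R m -> \bar R) (fi : 'I_m -> R -> \bar R)
    (fi1 fi2 : 'I_m -> R -> R) :
  let Pi := range_itv A (feasible Delta C) in
  let Lam := curv_mx A (feasible Delta C) fi2 in
  let ft := extrapolation A (feasible Delta C) fi fi1 fi2 in
  let lip := \big[maxe/-oo%E]_(i < m) sup_curv A (feasible Delta C) fi2 i in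
  let J0 := objective A Psi mu L B f in
  let J := objective A Psi mu L B (EFin \o ft) in
  let sol0 := argmin_on (feasible Delta C) J0 in
  let sol := argmin_on (feasible Delta C) J in
  let curvature_cond := psd (fun x => AMA A Lam x - mu *: LBBL L B x) in
  let d := smooth_part A mu L B ft in
  regularization_data Psi mu L Delta C ->
  Gamma0 f ->
  (forall u, f u = (\sum_(i < m) fi i (ecoord u i))%E) ->
  (forall i, Gamma0 (fi i : R^o -> \bar R)) ->
  (forall i, C2_over (Pi i) (fi i) (fi1 i) (fi2 i)) ->
  (forall i, sup_curv A (feasible Delta C) fi2 i < +oo)%E ->
  (forall i, 0 <= inf_curv A (feasible Delta C) fi2 i)%E ->
  Lam != 0 ->
  [/\ (* (a) *)
      [/\ twice_cont_diff ft, (lip < +oo)%E & (fine lip).-lipschitz (grad ft)],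
      (* (b) *)
      sol = sol0 /\ cLiGME_SCF Psi mu L Delta C ft,
      (* (c) *)
      curvature_cond ->
        strongly_convex_rel mu (quad_form (LBBL L B)) (ft \o A) /\ Gamma0 J,
      (* (d) *)
      curvature_cond ->
        [\/ coercive f /\ asymptotically_multipolyhedral (feasible Delta C),
            coercive f /\ [set x | A x = 0] `&` [set x | L x = 0] = [set 0],
            bounded_below f /\ [set x | L x = 0] = [set 0] |
            bounded_set (feasible Delta C)] ->
        sol0 !=set0 /\ sol !=set0
    & (* (e) *)
      curvature_cond -> sol !=set0 -> subdiff_rules Psi L Delta C J ->
      forall (beta sigma tau : R) (x : nat -> X) (v w : nat -> Z) (z : nat -> W),
        0 < beta -> beta.-lipschitz (grad d) ->
        step_size_cond mu L C B (Num.max beta (mu * opnorm B ^+ 2))^-1 sigma tau ->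
        cLiGME_iteration Psi mu L Delta C B d sigma tau x v w z ->
        exists2 xs, sol0 xs & x @ \oo --> xs].
Proof.
move=> Pi Lam ft lip J0 J sol0 sol curvature_cond d data fG fE fiG C2 sup_fin
  inf_ge0 _.
have solE : sol = sol0 := sol_eq Psi mu L B fE C2.
split.
- split; first exact: ft_twice_cont_diff data C2 sup_fin inf_ge0.
    exact: lip_lty sup_fin.
  exact: grad_ft_lipschitz data C2 sup_fin inf_ge0.
- by split=> //; exact: R_is_cLiGME_SCF data C2 sup_fin inf_ge0.
- move=> curv; split; first exact: ftA_strongly_convex data C2 sup_fin inf_ge0 curv.
  exact: objective_Gamma0 data C2 sup_fin inf_ge0 curv.
- move=> curv cases; rewrite -solE.
  have ne : sol !=set0 := sol_neq0 data fG fE C2 sup_fin inf_ge0 curv cases.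
  by split.
- move=> curv ne rules beta sigma tau x v w z beta0 dlip steps iter; rewrite -solE.
  have [xs solxs xcvg] :=
    iteration_cvg data C2 sup_fin inf_ge0 curv beta0 dlip steps iter rules ne.
  by exists xs.
Qed.
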